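(* Let $\Omega$ be an almost John domain. Then the following are true: (a) Every end is divisible by some prime end. (b) Every prime end has a singleton impression. (c) Every $x\in\partial\Omega$ is accessible and there is at least one prime end with impression $\{x\}$. (d) There is a homeomorphism $\Phi:\overline\Omega^P\to\overline\Omega^M$ such that $\Phi|_\Omega$ is the identity map. (e) If $1\le p\in Q(x)$ and $Q(x)\ne(0,1]$ for all $x\in\partial\Omega$, then $\partial_P\Omega$ is also the $\mathrm{Mod}_p$-prime end boundary. (f) The prime end closure $\overline\Omega^P$ is metrizable and compact.
   Context: Setting: $(X,d,\mu)$ is a metric measure space with more than one point, $\mu$ is a Borel measure with $0<\mu(B)<\infty$ for all balls $B$, and $1\le p<\infty$ is fixed. $X$ is complete, $\mu$ is doubling (there is $C_\mu>0$ with $\mu(B(x,2r))\le C_\mu\mu(B(x,r))$ for all balls), and $X$ supports a $p$-Poincaré inequality: there are $C_{PI}>0$, $\lambda\ge1$ such that for all balls $B$ and all $u\in N^{1,p}(X)$, $\frac{1}{\mu(B)}\int_B|u-u_B|\,d\mu\le C_{PI}\operatorname{diam}(B)\bigl(\frac{1}{\mu(\lambda B)}\int_{\lambda B}g_u^p\,d\mu\bigr)^{1/p}$, where $u_B=\frac{1}{\mu(B)}\int_B u\,d\mu$. Here a nonnegative Borel function $g$ is an upper gradient of $u:X\to[-\infty,\infty]$ if for every nonconstant rectifiable curve $\gamma:[0,l_\gamma]\to X$ parameterized by arc length, $|u(\gamma(0))-u(\gamma(l_\gamma))|\le\int_\gamma g\,ds$ when both values are finite, and $\int_\gamma g\,ds=\infty$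 otherwise; $N^{1,p}(X)$ is the space of measurable $u$ with $\int_X|u|^p\,d\mu+\inf_g\int_X g^p\,d\mu<\infty$ (infimum over upper gradients $g$ of $u$), and $g_u$ is the minimal $p$-weak upper gradient of $u$ (the a.e.-smallest $L^p$ function satisfying the upper gradient inequality for all curves except a family $\Gamma$ for which some nonnegative Borel $\rho\in L^p(X)$ has $\int_\gamma\rho\,ds=\infty$ for all $\gamma\in\Gamma$). $\Omega\subsetneq X$ is a bounded domain (bounded nonempty connected open set); closures and boundaries of subsets of $\Omega$ are taken in $X$. John domains: write $\delta_\Omega(x)=\operatorname{dist}(x,X\setminus\Omega)$. A domain $\Omega$ is a John domain if there are $C_\Omega\ge1$ and $x_0\in\Omega$ such that every $x\in\Omega$ can be joined to $x_0$ by a rectifiable curve $\gamma:[0,l_\gamma]\to\Omega$ parameterized by arc length with $\gamma(0)=x$, $\gamma(l_\gamma)=x_0$ and $t\le C_\Omega\delta_\Omega(\gamma(t))$ for $0\le t\le l_\gamma$. The 1-dimensional Hausdorff content is $\mathcal H^1_\infty(E)=\inf\{\sum_{j=1}^\infty r_j: E\subset\bigcup_{j=1}^\infty B(x_j,r_j)\}$. A domain $\Omega$ is an almost John domain if for each $r>0$ there is a closed set $F\subset\overline\Omega$ such that $\mathcal H^1_\infty(F)<r$ and $\Omega\setminus F$ is a John domain (the John constant and center may depend on $r$). Ends: A bounded connected set $E\subsetneq\Omega$ is acceptable if $\overline E\cap\partial\Omega\ne\varnothing$. A sequence $\{E_k\}_{k=1}^\infty$ of acceptable sets is a chain if (i)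 $E_{k+1}\subset E_k$ for all $k$; (ii) $\operatorname{dist}(\Omega\cap\partial E_{k+1},\Omega\cap\partial E_k)>0$ for all $k$; (iii) the impression $\bigcap_{k=1}^\infty\overline{E}_k$ is contained in $\partial\Omega$. A chain $\{E_k\}$ divides a chain $\{F_k\}$ if for each $k$ there is $l$ with $E_l\subset F_k$. Two chains are equivalent if they divide each other; an end $[E_k]$ is an equivalence class of chains, and its impression $I[E_k]$ is the impression of any representative chain. Division is well defined between ends. A prime end is an end that is not divisible by any other end. $\partial_E\Omega$ is the set of all ends, $\partial_P\Omega$ the set of all prime ends, and $\overline\Omega^P=\Omega\cup\partial_P\Omega$ is the prime end closure. Accessibility: $x\in\partial\Omega$ is accessible if there is a (possibly nonrectifiable) curve $\gamma:[0,1]\to X$ with $\gamma(1)=x$ and $\gamma([0,1))\subset\Omega$. Topology on $\Omega\cup\partial_E\Omega$: a sequence of points $\{x_n\}$ in $\Omega$ converges to the end $[E_k]$ if for all $k$ there is $n_k$ with $x_n\in E_k$ whenever $n\ge n_k$. A sequence of ends $\{[E_k^n]\}_{n=1}^\infty$ converges to the end $[E_k^\infty]$ if for every $k$ there is $n_k$ such that for each $n\ge n_k$ there is $l_{n,k}$ with $E^n_{l_{n,k}}\subset E_k^\infty$. Points of $\Omega$ converge to points of $\Omega$ as in the metric topology, and no sequence of ends converges to a point of $\Omega$. A set $C\subset\Omega\cup\partial_E\Omega$ is closed if every $y\in\Omega\cup\partial_E\Omega$ which is a limit of a sequence in $C$ belongs to $C$. $\overline\Omega^P$ carries the induced topology.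 Mazurkiewicz closure: for $x,y\in\Omega$, $d_M(x,y)=\inf\operatorname{diam}E$, the infimum over all connected sets $E\subset\Omega$ containing $x$ and $y$; $\overline\Omega^M$ is the completion of $(\Omega,d_M)$ (with $\Omega$ identified with its image). Modulus: for a family $\Gamma$ of nonconstant rectifiable curves, $\mathrm{Mod}_p(\Gamma)=\inf_\rho\int_X\rho^p\,d\mu$, the infimum over nonnegative Borel $\rho$ with $\int_\gamma\rho\,ds\ge1$ for all $\gamma\in\Gamma$. $\mathrm{Mod}_p(E,F,U)$ is the $p$-modulus of the family of nonconstant rectifiable curves in $U$ starting in $E$ and ending in $F$. A chain $\{E_k\}$ is a $\mathrm{Mod}_p$-chain if $\lim_{k\to\infty}\mathrm{Mod}_p(E_k,K,\Omega)=0$ for every compact $K\subset\Omega$. An end is a $\mathrm{Mod}_p$-end if some $\mathrm{Mod}_p$-chain represents it. A $\mathrm{Mod}_p$-end is a $\mathrm{Mod}_p$-prime end if the only $\mathrm{Mod}_p$-end dividing it is itself. The $\mathrm{Mod}_p$-prime end boundary is the set of all $\mathrm{Mod}_p$-prime ends. Pointwise dimension set: $Q(x)$ is the set of all $q>0$ for which there are $C_q,R_q>0$ with $\frac{\mu(B(x,r))}{\mu(B(x,R))}\le C_q(r/R)^q$ for all $0<r\le R\le R_q$ (it is a bounded interval with left end point $0$). *)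

(* Defs.v *)
From HB Require Import structures.
From mathcomp Require Import all_boot all_order all_algebra generic_quotient.
From mathcomp Require Import all_classical all_reals all_analysis.
From mathcomp Require Import measurable_realfun metric_structure.

Set Implicit Arguments.
Unset Strict Implicit.
Unset Printing Implicit Defensive.

Import Order.TTheory GRing.Theory Num.Theory.
Import numFieldNormedType.Exports.

Local Open Scope classical_set_scope.
Local Open Scope ring_scope.

(* Measurable types are pointed in the library, so a metric space carrying a
   Borel measure is taken pointed. *)
#[short(type="pmetricType")]
HB.structure Definition PointedMetric (R : numDomainType) :=
  {T of Metric R T & isPointed T}.

#[short(type="completeMetricType")]
HB.structure Definition CompleteMetric (R : numDomainType) :=
  {T of Metric R T & Complete T}.

Notation borel X := (g_sigma_algebraType (@open X)).

Section metric_preliminaries.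
Context {R : realType} {X : metricType R}.
Implicit Types (A B E : set X) (x y : X).

(* The supremum and infimum are taken in the extended reals: [diam set0] is
   [-oo] and the distance to [set0] is [+oo]. *)
Definition diam A : \bar R :=
  ereal_sup [set (mdist z.1 z.2)%:E | z in A `*` A].

Definition set_dist A B : \bar R :=
  ereal_inf [set (mdist z.1 z.2)%:E | z in A `*` B].

Definition metric_bounded A : Prop := (diam A < +oo)%E.

Definition boundary A : set X := closure A `\` interior A.

Definition bounded_domain A : Prop :=
  [/\ A !=set0, open A, connected A, metric_bounded A & A <> setT].

Definition hausdorff_content1 E : \bar R :=
  ereal_inf [set s | exists (c : nat -> X) (r : nat -> R),
    [/\ forall j, 0 < r j,
        E `<=` \bigcup_j ball (c j) (r j)
      & s = (\sum_(0 <= j <oo) (r j)%:E)%E]].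

Definition curve_length (gamma : R -> X) (a b : R) : \bar R :=
  ereal_sup [set (\sum_(0 <= i < size s)
    mdist (gamma (nth b (a :: s) i)) (gamma (nth b (a :: s) i.+1)))%:E
    | s in itv_partition a b].

(* Only the values of [gamma] on [0, l] are relevant.  Rectifiability and
   continuity on [0, l] follow from the arc length condition. *)
Definition arc_length_param (l : R) (gamma : R -> X) : Prop :=
  0 <= l /\ forall t, 0 <= t <= l -> curve_length gamma 0 t = t%:E.

Definition john_domain A : Prop :=
  bounded_domain A /\
  exists (C : R) (x0 : X), [/\ 1 <= C, A x0 &
    forall x, A x -> exists (l : R) (gamma : R -> X),
      [/\ arc_length_param l gamma, gamma 0 = x, gamma l = x0
        & forall t, 0 <= t <= l -> A (gamma t) /\
            (t%:E <= C%:E * set_dist [set gamma t] (~` A))%E]].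

Definition almost_john_domain A : Prop :=
  bounded_domain A /\
  forall r : R, 0 < r -> exists F : set X,
    [/\ closed F, F `<=` closure A, (hausdorff_content1 F < r%:E)%E
      & john_domain (A `\` F)].

Definition accessible A x : Prop :=
  exists gamma : R -> X,
    [/\ {within `[0, 1], continuous gamma}, gamma 1 = x
      & forall t, 0 <= t < 1 -> A (gamma t)].

End metric_preliminaries.

Record boundedDomain (R : realType) (X : metricType R) := BoundedDomain {
  domain_set :> set X;
  domainP : bounded_domain domain_set }.

(* Nonconstant rectifiable curves, parameterized by arc length. *)
Record arcCurve (R : realType) (X : metricType R) := ArcCurve {
  arc_len : R;
  arc_fun :> R -> X;
  arc_len_gt0 : 0 < arc_len;
  arcP : arc_length_param arc_len arc_fun }.

Definition curve_integral (R : realType) (X : metricType R)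
    (gamma : arcCurve X) (rho : X -> \bar R) : \bar R :=
  (\int[lebesgue_measure]_(t in `[0%R, arc_len gamma]) rho (gamma t))%E.

Section metric_measure_space.
Context {R : realType} {X : pmetricType R}.
Variable mu : {measure set (borel X) -> \bar R}.
Variable p : R.
Implicit Types (u g : X -> \bar R) (x : X).

Local Open Scope ereal_scope.

Definition nonneg_borel g : Prop :=
  measurable_fun setT (g : borel X -> \bar R) /\ forall x, 0 <= g x.

(* Measurability with respect to the completion of [mu].  On functions that
   agree with a Borel function outside a null set the library integral against
   [mu] is the integral against the completion. *)
Definition mu_measurable u : Prop :=
  exists v : borel X -> \bar R,
    measurable_fun setT v /\ {ae mu, forall x, u x = v x}.

Definition p_integral u : \bar R := \int[mu]_x (`|u x| `^ p).

Definition ball_average x (r : R) u : \bar R :=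
  ((fine (mu (ball x r)))^-1)%:E * \int[mu]_(y in ball x r) u y.

Definition upper_gradient_along u g (gamma : arcCurve X) : Prop :=
  let a := u (gamma 0%R) in let b := u (gamma (arc_len gamma)) in
  (a \is a fin_num -> b \is a fin_num ->
     `|a - b| <= curve_integral gamma g) /\
  (~ (a \is a fin_num /\ b \is a fin_num) -> curve_integral gamma g = +oo).

Definition upper_gradient u g : Prop :=
  nonneg_borel g /\ forall gamma, upper_gradient_along u g gamma.

Definition p_exceptional (Gamma : set (arcCurve X)) : Prop :=
  exists rho, [/\ nonneg_borel rho, p_integral rho < +oo
    & forall gamma, Gamma gamma -> curve_integral gamma rho = +oo].

Definition p_weak_upper_gradient u g : Prop :=
  [/\ mu_measurable g, forall x, 0 <= g x
    & exists2 Gamma, p_exceptional Gamma &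
        forall gamma, ~ Gamma gamma -> upper_gradient_along u g gamma].

Definition minimal_p_weak_upper_gradient u g : Prop :=
  [/\ p_weak_upper_gradient u g, p_integral g < +oo
    & forall h, p_weak_upper_gradient u h -> p_integral h < +oo ->
        {ae mu, forall x, g x <= h x}].

Definition newtonian u : Prop :=
  mu_measurable u /\
  p_integral u + ereal_inf [set p_integral g | g in upper_gradient u] < +oo.

Definition doubling : Prop :=
  exists2 C : R, (0 < C)%R & forall x (r : R), (0 < r)%R ->
    mu (ball x (2 * r)%R) <= C%:E * mu (ball x r).

Definition poincare : Prop :=
  exists (C lambda : R), [/\ (0 < C)%R, (1 <= lambda)%R &
    forall x (r : R) u g, (0 < r)%R ->
      newtonian u -> minimal_p_weak_upper_gradient u g ->
      ball_average x r (fun y => `|u y - ball_average x r u|) <=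
      C%:E * diam (ball x r) *
        (ball_average x (lambda * r)%R (fun y => g y `^ p)) `^ p^-1].

Definition family_modulus (Gamma : set (arcCurve X)) : \bar R :=
  ereal_inf [set p_integral rho | rho in [set rho | nonneg_borel rho /\
    forall gamma, Gamma gamma -> 1 <= curve_integral gamma rho]].

Definition modulus (E F U : set X) : \bar R :=
  family_modulus [set gamma | [/\
    forall t : R, (0 <= t <= arc_len gamma)%R -> U (gamma t),
    E (gamma 0%R) & F (gamma (arc_len gamma))]].

Definition pointwise_dims x : set R :=
  [set q : R | (0 < q)%R /\ exists (C R0 : R), [/\ (0 < C)%R, (0 < R0)%R &
    forall r s : R, (0 < r)%R -> (r <= s)%R -> (s <= R0)%R ->
      (fine (mu (ball x r)) / fine (mu (ball x s)) <= C * (r / s) `^ q)%R]].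

End metric_measure_space.

Section ends.
Context {R : realType} {X : metricType R}.
Variable Om : set X.

Definition acceptable (E : set X) : Prop :=
  [/\ E `<=` Om, E <> Om, metric_bounded E, connected E
    & closure E `&` boundary Om !=set0].

Definition impression (E : nat -> set X) : set X := \bigcap_k closure (E k).

Definition chain (E : nat -> set X) : Prop :=
  [/\ forall k, acceptable (E k),
      forall k, E k.+1 `<=` E k,
      forall k, (0 < set_dist (Om `&` boundary (E k.+1))
                              (Om `&` boundary (E k)))%E
    & impression E `<=` boundary Om].

Definition chain_divides (E F : nat -> set X) : Prop :=
  forall k, exists l, E l `<=` F k.

Definition chain_class (E : nat -> set X) : set (nat -> set X) :=
  [set F | [/\ chain F, chain_divides E F & chain_divides F E]].

Definition ends : set (set (nat -> set X)) := chain_class @` chain.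

Definition end_divides (e f : set (nat -> set X)) : Prop :=
  exists E F, [/\ e E, f F & chain_divides E F].

Definition end_impression (e : set (nat -> set X)) : set X :=
  \bigcup_(E in e) impression E.

Definition prime_ends : set (set (nat -> set X)) :=
  [set e | ends e /\ forall f, ends f -> end_divides f e -> f = e].

Definition points_to_end (x : nat -> X) (e : set (nat -> set X)) : Prop :=
  forall E, e E -> forall k, exists n0, forall n, (n0 <= n)%N -> E k (x n).

Definition ends_to_end (f : nat -> set (nat -> set X))
    (e : set (nat -> set X)) : Prop :=
  forall E, e E -> forall k, exists n0, forall n, (n0 <= n)%N ->
    exists F l, f n F /\ F l `<=` E k.

Definition end_space : Type := (Om + ends)%type.

HB.instance Definition _ := gen_eqMixin end_space.
HB.instance Definition _ := gen_choiceMixin end_space.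

Definition seq_limit (u : nat -> end_space) (y : end_space) : Prop :=
  match y with
  | inl x => exists2 v : nat -> Om, u = inl \o v &
      set_val (v n) @[n --> \oo] --> (set_val x : X)
  | inr e =>
      (exists2 v : nat -> Om, u = inl \o v &
         points_to_end (set_val \o v) (set_val e)) \/
      (exists2 f : nat -> ends, u = inr \o f &
         ends_to_end (set_val \o f) (set_val e))
  end.

Definition seq_closed (C : set end_space) : Prop :=
  forall u y, (forall n, C (u n)) -> seq_limit u y -> C y.

Let seq_open (A : set end_space) : Prop := seq_closed (~` A).

Let seq_limit_sub (u : nat -> end_space) y (phi : nat -> nat) :
  (forall n, (n <= phi n)%N) -> seq_limit u y -> seq_limit (u \o phi) y.
Proof.
move=> phiP; case: y => [x|e] /=.
  case=> v -> vx; exists (v \o phi) => //=.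
  apply: (@cvg_comp _ _ _ phi (fun n => set_val (v n)) \oo \oo) vx.
  move=> A [N _ NA]; exists N => // n /= Nn; apply: NA => /=.
  exact: leq_trans Nn (phiP n).
case=> -[v -> ve]; [left|right]; exists (v \o phi) => // E eE k.
  have [n0 n0P] := ve E eE k; exists n0 => n n0n.
  exact/n0P/(leq_trans n0n)/phiP.
have [n0 n0P] := ve E eE k; exists n0 => n n0n.
exact/n0P/(leq_trans n0n)/phiP.
Qed.

Let seq_openT : seq_open setT.
Proof. by move=> u y uT _; exfalso; exact: (uT 0%N I). Qed.

Let seq_openI : setI_closed seq_open.
Proof.
move=> A B oA oB u y; rewrite setCI => uAB uy.
have [inf|] := pselect (forall N, exists n, (N <= n)%N /\ (~` A) (u n)).
  have [phi phiP] := choice inf; left.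
  apply: (oA (u \o phi)) => [n|]; first by have [] := phiP n.
  by apply: seq_limit_sub uy => n; have [] := phiP n.
move=> /existsNP[N fin]; right.
apply: (oB (u \o addn N)) => [n|].
  have [nA|//] := uAB (N + n)%N; exfalso; apply: fin.
  by exists (N + n)%N; rewrite leq_addr.
by apply: seq_limit_sub uy => n; rewrite leq_addl.
Qed.

Let seq_open_bigU (I : Type) (f : I -> set end_space) :
  (forall i, seq_open (f i)) -> seq_open (\bigcup_i f i).
Proof.
move=> of_ u y uf uy; rewrite setC_bigcup => i _.
apply: (of_ i u) => // n; have := uf n.
by rewrite setC_bigcup; apply.
Qed.

HB.instance Definition _ := isOpenTopological.Build end_space
  seq_openT seq_openI seq_open_bigU.

Definition prime_end_closure : set end_space :=
  [set y | match y with inl _ => True | inr e => prime_ends (set_val e) end].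

Definition prime_closure_inj (x : Om) : prime_end_closure :=
  exist _ (inl x) (mem_set (I : prime_end_closure (inl x))).

End ends.
Arguments seq_closed {R X} Om C.
Arguments prime_end_closure {R X} Om _.

Section modulus_ends.
Context {R : realType} {X : pmetricType R}.
Variables (mu : {measure set (borel X) -> \bar R}) (p : R) (Om : set X).

Definition mod_chain (E : nat -> set X) : Prop :=
  chain Om E /\ forall K : set X, compact K -> K `<=` Om ->
    modulus mu p (E k) K Om @[k --> \oo] --> 0%E.

Definition mod_ends : set (set (nat -> set X)) :=
  [set e | ends Om e /\ exists2 E, e E & mod_chain E].

Definition mod_prime_ends : set (set (nat -> set X)) :=
  [set e | mod_ends e /\
    forall f, mod_ends f -> end_divides f e -> f = e].

End modulus_ends.

Section mazurkiewicz.
Context {R : realType} {X : metricType R}.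
Variable Om : boundedDomain X.

Definition mazurkiewicz_dist (x y : X) : R :=
  fine (ereal_inf [set diam E | E in
    [set E : set X | [/\ connected E, E `<=` Om, E x & E y]]]).

Definition mazurkiewicz : Type := set_type Om.

HB.instance Definition _ := Choice.on mazurkiewicz.

Let S (x y : X) : set (\bar R) := [set diam E | E in
    [set E : set X | [/\ connected E, E `<=` Om, E x & E y]]].

Let diam_ge (E : set X) x y : E x -> E y -> ((mdist x y)%:E <= diam E)%E.
Proof. by move=> Ex Ey; apply: ereal_sup_ubound; exists (x, y). Qed.

Let S_ge (x y : X) : ((mdist x y)%:E <= ereal_inf (S x y))%E.
Proof. by apply: le_ereal_inf_tmp => _ [E [_ _ Ex Ey] <-]; exact: diam_ge. Qed.

Let S_fin (x y : X) : domain_set Om x -> domain_set Om y ->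
  ereal_inf (S x y) \is a fin_num.
Proof.
move=> Ox Oy; have [_ _ Oc Ob _] := domainP Om.
rewrite fin_numElt; apply/andP; split.
  by apply: lt_le_trans (S_ge x y); rewrite ltNyr.
apply: (le_lt_trans _ Ob); apply: ereal_inf_lbound.
by exists (Om : set X) => //; split.
Qed.

Let S_sym (x y : X) : S x y = S y x.
Proof.
rewrite /S; congr (_ @` _); apply/seteqP.
by split=> E [? ? ? ?]; split.
Qed.

Let diamU (A B : set X) y : A y -> B y ->
  (diam (A `|` B) <= diam A + diam B)%E.
Proof.
move=> Ay By.
have dA0 : (0 <= diam A)%E by rewrite (le_trans _ (diam_ge Ay Ay))// mdistxx.
have dB0 : (0 <= diam B)%E by rewrite (le_trans _ (diam_ge By By))// mdistxx.
apply: ge_ereal_sup => _ [[a b] /= [[Aa|Ba] [Ab|Bb]] <-].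
- by rewrite (le_trans (diam_ge Aa Ab))// leeDl.
- rewrite (@le_trans _ _ ((mdist a y)%:E + (mdist y b)%:E)%E)//.
    by rewrite -EFinD lee_fin metric_triangle.
  by rewrite leeD// diam_ge.
- rewrite (@le_trans _ _ ((mdist y b)%:E + (mdist a y)%:E)%E)//.
    by rewrite -EFinD lee_fin addrC metric_triangle.
  by rewrite leeD// diam_ge.
- by rewrite (le_trans (diam_ge Ba Bb))// leeDr.
Qed.

Let S_triangle (y x z : X) :
  domain_set Om x -> domain_set Om y -> domain_set Om z ->
  mazurkiewicz_dist x z <= mazurkiewicz_dist x y + mazurkiewicz_dist y z.
Proof.
move=> Ox Oy Oz; apply/ler_addgt0Pl => e e0.
have e20 : 0 < e / 2 by rewrite divr_gt0.
have [_ [A [cA AO Ax Ay] <-] Ad] := lb_ereal_inf_adherent e20 (S_fin Ox Oy).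
have [_ [B [cB BO By Bz] <-] Bd] := lb_ereal_inf_adherent e20 (S_fin Oy Oz).
have xy := S_fin Ox Oy; have yz := S_fin Oy Oz; have xz := S_fin Ox Oz.
rewrite -lee_fin !EFinD /mazurkiewicz_dist !fineK//.
apply: (@le_trans _ _ (diam (A `|` B))).
  apply: ereal_inf_lbound; exists (A `|` B) => //; split => //.
  - by apply: connectedU => //; exists y.
  - by move=> t [/AO|/BO].
  - by left.
  - by right.
apply: (le_trans (diamU Ay By)).
apply: (le_trans (leeD (ltW Ad) (ltW Bd))).
by rewrite addeACA -EFinD -splitr addeC.
Qed.

Let dM (x y : mazurkiewicz) : R := mazurkiewicz_dist (set_val x) (set_val y).

Let OmP (x : mazurkiewicz) : domain_set Om (set_val x). Proof. exact: set_valP. Qed.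

Let dMxx x : dM x x = 0.
Proof.
apply/eqP; rewrite -eqe /dM fineK ?S_fin//; apply/eqP/le_anti/andP; split.
  apply: ereal_inf_lbound; exists [set set_val x].
    split=> //; first exact: connected1.
    by move=> _ ->; exact: OmP.
  rewrite /diam (_ : [set _ | _ in _] = [set 0%E]) ?ereal_sup1//.
  apply/seteqP; split=> [_ [[a b] /= [-> ->] <-]|_ ->]; first by rewrite mdistxx.
  by exists (set_val x, set_val x) => //=; rewrite mdistxx.
by apply: le_trans (S_ge _ _); rewrite mdistxx.
Qed.

Let dM_positivity x y : dM x y = 0 -> x = y.
Proof.
move=> dxy; apply: val_inj; apply: (@mdist_positivity R X).
apply/eqP; rewrite eq_le mdist_ge0 andbT -lee_fin.
apply: (le_trans (S_ge _ _)).
by rewrite -(fineK (S_fin (OmP x) (OmP y))) lee_fin -dxy.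
Qed.

Let dM_sym x y : dM x y = dM y x.
Proof. by rewrite /dM /mazurkiewicz_dist -/(S _ _) S_sym. Qed.

Let dM_triangle y x z : dM x z <= dM x y + dM y z.
Proof. exact: S_triangle. Qed.

HB.instance Definition _ := @isMetric.Build R mazurkiewicz
  dM dMxx dM_positivity dM_sym dM_triangle.

End mazurkiewicz.

(* Cauchy sequences modulo vanishing distance. *)
Section completion.
Context {R : realType} {T : metricType R}.
Local Open Scope quotient_scope.

Definition cauchy_seqs : set (nat -> T) := [set u | cauchy (u @ \oo)].

Definition same_limit (u v : cauchy_seqs) : bool :=
  `[< mdist (set_val u n) (set_val v n) @[n --> \oo] --> (0 : R) >].

Let dist_cvg0P (u v : nat -> T) :
  (mdist (u n) (v n) @[n --> \oo] --> (0 : R)) <->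
  forall e : R, 0 < e -> \forall n \near \oo, mdist (u n) (v n) < e.
Proof.
split=> [/cvgrPdist_lt uv e /uv|uv].
  by apply: filterS => n; rewrite sub0r normrN ger0_norm// mdist_ge0.
apply/cvgrPdist_lt => e /uv; apply: filterS => n.
by rewrite sub0r normrN ger0_norm// mdist_ge0.
Qed.

Let same_limit_refl : reflexive same_limit.
Proof.
by move=> u; apply/asboolP/dist_cvg0P => e e0; apply: nearW => n; rewrite mdistxx.
Qed.

Let same_limit_sym : symmetric same_limit.
Proof.
move=> u v; apply/idP/idP => /asboolP uv; apply/asboolP;
  by under eq_fun do rewrite metric_sym.
Qed.

Let same_limit_trans : transitive same_limit.
Proof.
move=> v u w /asboolP/dist_cvg0P uv /asboolP/dist_cvg0P vw.
apply/asboolP/dist_cvg0P => e e0.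
have e20 : 0 < e / 2 by rewrite divr_gt0.
near=> n; rewrite (le_lt_trans (metric_triangle _ (set_val v n) _))//.
by rewrite [ltRHS]splitr ltrD//; near: n; [exact: uv|exact: vw].
Unshelve. all: by end_near. Qed.

Canonical same_limit_equiv :=
  EquivRel same_limit same_limit_refl same_limit_sym same_limit_trans.

Definition completion : Type := {eq_quot same_limit_equiv}.

HB.instance Definition _ := Choice.on completion.

Definition completion_class (u : cauchy_seqs) : completion :=
  \pi_({eq_quot same_limit_equiv}) u.

Definition completion_seq (a : completion) : nat -> T :=
  set_val (repr (a : {eq_quot same_limit_equiv}) : cauchy_seqs).

Definition completion_dist (a b : completion) : R :=
  lim (mdist (completion_seq a n) (completion_seq b n) @[n --> \oo]).

Let cauchy_completion_seq a : cauchy (completion_seq a @ \oo).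
Proof.
exact: (@set_valP _ cauchy_seqs (repr (a : {eq_quot same_limit_equiv}))).
Qed.

Let cauchy_mdist (u : nat -> T) (e : R) : cauchy (u @ \oo) -> 0 < e ->
  exists N, forall m n, (N <= m)%N -> (N <= n)%N -> mdist (u m) (u n) < e.
Proof.
move=> /cauchy_ballP cu /cu[[A B] /= [[N1 _ N1A] [N2 _ N2B]] AB].
exists (maxn N1 N2) => m n; rewrite !geq_max => /andP[m1 _] /andP[_ n2].
have := AB (u m, u n) (conj (N1A _ m1) (N2B _ n2)).
by rewrite /= ballEmdist.
Qed.

Let cvg_dist (u v : nat -> T) : cauchy (u @ \oo) -> cauchy (v @ \oo) ->
  cvgn (fun n => mdist (u n) (v n)).
Proof.
move=> cu cv; apply/cauchy_cvgP/cauchy_ballP => e e0.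
have e20 : 0 < e / 2 by rewrite divr_gt0.
have [N NP] := cauchy_mdist cu e20; have [M MP] := cauchy_mdist cv e20.
pose K := maxn N M.
exists ((fun n => mdist (u n) (v n)) @` [set n | (K <= n)%N],
        (fun n => mdist (u n) (v n)) @` [set n | (K <= n)%N]).
  by split; exists K => // n Kn; exists n.
move=> [_ _] /= [[m + <-] [n + <-]] /=; rewrite !geq_max.
move=> /andP[Nm Mm] /andP[Nn Mn].
have key i j : (N <= i)%N -> (M <= i)%N -> (N <= j)%N -> (M <= j)%N ->
    mdist (u i) (v i) - mdist (u j) (v j) < e.
  move=> Ni Mi Nj Mj; rewrite ltrBlDr [e]splitr.
  apply: (le_lt_trans (metric_triangle _ (u j) _)).
  rewrite -addrA ltrD ?NP//.
  apply: (le_lt_trans (metric_triangle _ (v j) _)).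
  by rewrite [ltRHS]addrC ltrD2l MP.
rewrite /ball /= ltr_norml key// andbT ltrNl opprB key//.
Qed.

Let completion_dist_cvg a b :
  mdist (completion_seq a n) (completion_seq b n) @[n --> \oo] -->
    completion_dist a b.
Proof. by apply: cvg_dist; exact: cauchy_completion_seq. Qed.

Let completion_distxx a : completion_dist a a = 0.
Proof.
rewrite /completion_dist; under eq_fun do rewrite mdistxx.
exact: (@lim_cst R).
Qed.

Let completion_dist_positivity a b : completion_dist a b = 0 -> a = b.
Proof.
move=> ab0; have := completion_dist_cvg (a := a) (b := b); rewrite ab0 => ab.
have : same_limit (repr (a : {eq_quot same_limit_equiv}))
                  (repr (b : {eq_quot same_limit_equiv})) by apply/asboolP.
move=> /(@eqmodP _ same_limit_equiv).
by rewrite !reprK.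
Qed.

Let completion_dist_sym a b : completion_dist a b = completion_dist b a.
Proof.
by rewrite /completion_dist; under eq_fun do rewrite metric_sym.
Qed.

Let completion_dist_triangle b a c :
  completion_dist a c <= completion_dist a b + completion_dist b c.
Proof.
apply: (@ler_cvg_to _ _ _ _ (fun n => mdist (completion_seq a n) (completion_seq c n))
  (fun n => mdist (completion_seq a n) (completion_seq b n) +
            mdist (completion_seq b n) (completion_seq c n)) _ _
  (completion_dist_cvg (a := a) (b := c))).
- by apply: cvgD; exact: completion_dist_cvg.
- by apply: nearW => n; exact: metric_triangle.
Qed.

HB.instance Definition _ := @isMetric.Build R completion completion_dist
  completion_distxx completion_dist_positivity completion_dist_sym
  completion_dist_triangle.

Let cauchy_cst (x : T) : cauchy ((fun=> x) @ \oo).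
Proof.
apply/cauchy_ballP => e e0; exists ([set x], [set x]).
  by split; exists 0%N.
by move=> [_ _] /= [-> ->]; exact: ballxx.
Qed.

Definition completion_inj (x : T) : completion :=
  completion_class (exist _ (fun=> x) (mem_set (cauchy_cst x))).

End completion.
Arguments completion {R} T.

Section topological_notions.
Context {T U : topologicalType}.

Definition homeomorphism (f : T -> U) : Prop :=
  continuous f /\ exists g : U -> T, [/\ continuous g, cancel f g & cancel g f].

End topological_notions.

Definition metrizable (R : realType) (T : topologicalType) : Prop :=
  exists d : T -> T -> R,
    [/\ forall x y, d x y = 0 <-> x = y,
        forall x y, d x y = d y x,
        forall x y z, d x z <= d x y + d y z
      & forall A : set T, open A <->
          forall x, A x -> exists2 r : R, 0 < r & [set y | d x y < r] `<=` A].

(* Main.v *)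
Require Import Defs.
From mathcomp Require Import all_boot all_order all_algebra.
From mathcomp Require Import all_classical all_reals all_analysis.
From mathcomp Require Import measurable_realfun metric_structure.
From mathcomp Require Import lra ring.

(* Poincare's inequality, tested on a cut-off indicator of the set of points
   reached by [e]-chains, shows that nearby points are joined by [e]-chains of
   comparable diameter for every [e]; as [X] is complete, the chains refine to
   paths, so that [X] is locally path connected in a quantitative way. Testing
   needs a minimal weak upper gradient, obtained from the lattice property.

   A component of the trace of a ball on [Om] that meets a smaller concentric
   ball contains a ball of comparable radius: the exceptional closed set has too
   small a content to contain the component, and the John curve of a point off
   that set leads into such a ball. By doubling there are finitely many of these
   components, i.e. the Mazurkiewicz metric is totally bounded and its completion
   compact.

   Each boundary point [m] of the completion defines a chain, the components
   near [m] of the traces of balls shrinking to the point of [X] below [m]. By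
   compactness every chain is divisible by one of these, whence the prime ends
   are exactly their classes, and all that is claimed about impressions,
   accessibility and topology can be read off the completion. Finally, if
   [mu (ball x r)] is at most of order [r ^ q] with [q > p] or [q = p > 1],
   admissible densities averaged over concentric annuli show that these chains
   have modulus tending to zero. *)

(** Poincare's inequality is applied only where its right-hand side vanishes, so the size of the
    chains depends on [lambda] alone and not on [e]. This uniformity lets the chains be refined to
    paths without any control of their length. The price is that the inequality speaks of minimal
    weak upper gradients: one must exist for the test function before it can be said to vanish where
    the explicit gradient does.

    The John constant of [Om] minus [F] may change with the radius. Total boundedness tolerates
    this, since it asks for finitely many components at one scale at a time.

    A chain is compared with a point of the completion by asking that the point lie in the closure,
    taken in the completion, of each of its sets. The positive distance between successive relative
    boundaries turns this nearness into division. The topology on ends is given by sequences and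
    lives on all ends, prime or not, so closed sets have to be exhibited in that larger space. *)

Set Implicit Arguments.
Unset Strict Implicit.
Unset Printing Implicit Defensive.

Import Order.TTheory GRing.Theory Num.Theory.
Import numFieldNormedType.Exports.

Local Open Scope classical_set_scope.
Local Open Scope ring_scope.

(** * Metric spaces *)

Section metric_basics.
Context {R : realType} {X : metricType R}.
Implicit Types (A E U : set X) (x y z : X).

Lemma ballP x (r : R) y : ball x r y <-> mdist x y < r.
Proof. by rewrite ballEmdist. Qed.

Lemma nbhs_mdistP x A :
  nbhs x A <-> exists2 e : R, 0 < e & forall y, mdist x y < e -> A y.
Proof.
rewrite nbhs_ballP; split=> -[e e0 eA]; exists e => // y.
  by move/ballP/eA.
by move/ballP/eA.
Qed.

Lemma open_mdistP A :
  open A <-> forall x, A x -> exists2 e : R, 0 < e & forall y, mdist x y < e -> A y.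
Proof. by rewrite openE; split=> H x /H /nbhs_mdistP. Qed.

Lemma closure_mdistP A x :
  closure A x <-> forall e : R, 0 < e -> exists2 y, A y & mdist x y < e.
Proof.
split=> [H e e0|H B /nbhs_mdistP [e e0 eB]].
  have [|y [Ay xy]] := H [set y | mdist x y < e]; last by exists y.
  by apply/nbhs_mdistP; exists e.
by have [y Ay xy] := H _ e0; exists y; split=> //; exact: eB.
Qed.

Lemma open_mball x (r : R) : open (ball x r).
Proof.
apply/open_mdistP => y /ballP xy; exists (r - mdist x y); first by rewrite subr_gt0.
move=> z yz; apply/ballP; apply: le_lt_trans (metric_triangle _ y _) _.
by rewrite addrC -ltrBrDr.
Qed.

Lemma mdist_lt_half x y z (r : R) :
  mdist x y < r / 2 -> mdist y z < r / 2 -> mdist x z < r.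
Proof. by have := metric_triangle x y z; lra. Qed.

Definition mcauchy (u : nat -> X) := forall e : R, 0 < e ->
  exists N, forall m n, (N <= m)%N -> (N <= n)%N -> mdist (u m) (u n) < e.

Definition mcvg (u : nat -> X) x := forall e : R, 0 < e ->
  exists N, forall n, (N <= n)%N -> mdist x (u n) < e.

Definition mcomplete := forall u, mcauchy u -> exists x, mcvg u x.

Definition net_covered A (e : R) :=
  exists s : seq X, forall y, A y -> exists2 c, c \in s & mdist c y < e.

Definition tot_bounded A := forall e : R, 0 < e -> net_covered A e.

Lemma half_pow_gt0 n : 0 < (2^-1 : R) ^+ n.
Proof. by rewrite exprn_gt0// invr_gt0. Qed.

Lemma half_pow_small (C e : R) : 0 <= C -> 0 < e -> exists N, forall n, (N <= n)%N -> C * 2^-1 ^+ n < e.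
Proof.
move=> C0 e0; exists (Num.truncn (C / e)).+1 => n Nn.
have h : C / e < n%:R by rewrite -truncn_lt_nat ?divr_ge0// ltW.
have h2 : n%:R <= (2 ^ n)%N%:R :> R by rewrite ler_nat ltnW// ltn_expl.
rewrite exprVn -natrX ltr_pdivrMr ?ltr0n ?expn_gt0// mulrC.
by rewrite -ltr_pdivrMr//; apply: lt_le_trans h h2.
Qed.

Lemma geometric_cauchy (u : nat -> X) (C : R) :
  0 <= C -> (forall n, mdist (u n) (u n.+1) <= C * 2^-1 ^+ n) ->
  forall n k, mdist (u n) (u (n + k)%N) <= 2 * C * 2^-1 ^+ n.
Proof.
move=> C0 uC n k.
(* The subtracted tail makes the bound provable by induction on [k]. *)
suff : mdist (u n) (u (n + k)%N) <= 2 * C * 2^-1 ^+ n - 2 * C * 2^-1 ^+ (n + k).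
  by move/le_trans; apply; rewrite gerBl !mulr_ge0// ltW// half_pow_gt0.
elim: k => [|k IH]; first by rewrite addn0 mdistxx subrr.
have := metric_triangle (u n) (u (n + k)%N) (u (n + k.+1)%N).
have := uC (n + k)%N; rewrite addnS (exprS _ (n + k)).
have := half_pow_gt0 (n + k); lra.
Qed.

Lemma geometric_mcauchy (u : nat -> X) (C : R) :
  0 <= C -> (forall n, mdist (u n) (u n.+1) <= C * 2^-1 ^+ n) -> mcauchy u.
Proof.
move=> C0 uC e e0; have C20 : 0 <= 2 * C by rewrite mulr_ge0.
have e20 : 0 < e / 2 by rewrite divr_gt0.
have [N NP] := half_pow_small C20 e20.
exists N => m n Nm Nn; apply: (@mdist_lt_half _ (u N)).
  rewrite metric_sym -(subnK Nm) addnC; apply: le_lt_trans (NP N _) => //.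
  exact: geometric_cauchy.
rewrite -(subnK Nn) addnC; apply: le_lt_trans (NP N _) => //.
exact: geometric_cauchy.
Qed.

Lemma geometric_lim (u : nat -> X) (C : R) : mcomplete ->
  0 <= C -> (forall n, mdist (u n) (u n.+1) <= C * 2^-1 ^+ n) ->
  exists x, forall n, mdist x (u n) <= 2 * C * 2^-1 ^+ n.
Proof.
move=> cX C0 uC; have [x xu] := cX _ (geometric_mcauchy C0 uC).
exists x => n; apply/ler_addgt0Pr => e e0; have [N NP] := xu _ e0.
apply: le_trans (metric_triangle _ (u (n + N)%N) _) _.
rewrite addrC lerD//; first by rewrite metric_sym geometric_cauchy.
by rewrite ltW// NP// leq_addl.
Qed.

(* An ultrafilter containing a totally bounded set contains balls of radius
   [2^-n], whose centers form a Cauchy sequence. *)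
Lemma tot_bounded_compact A : mcomplete -> tot_bounded A -> closed A -> compact A.
Proof.
move=> cX tA clA; rewrite compact_ultra => F UF FA.
have small n : exists c, F [set y | mdist c y < 2^-1 ^+ n].
  have [s sP] := tA _ (half_pow_gt0 n).
  have : F [set y | exists2 c, c \in s & mdist c y < 2^-1 ^+ n].
    by apply: filterS FA => y /sP.
  elim: s {sP} => [|c s IH] Fs; first by have [y [z]] := filter_ex Fs.
  have [Fc|Fc] := in_ultra_setVsetC [set y | mdist c y < 2^-1 ^+ n] UF.
    by exists c.
  apply: IH; apply: filterS (filterI Fs Fc) => y [[z]].
  by rewrite inE => /orP[/eqP -> //|zs zy _]; exists z.
have [c cP] := choice small.
have cc n : mdist (c n) (c n.+1) <= 2 * 2^-1 ^+ n.
  have [y [/= h1 h2]] := filter_ex (filterI (cP n) (cP n.+1)).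
  have := metric_triangle (c n) y (c n.+1); rewrite (metric_sym y).
  by have := half_pow_gt0 n; rewrite exprS in h2; lra.
have [x xP] := geometric_lim cX (ler0n R 2) cc.
have Fx : F --> x.
  move=> B /nbhs_mdistP [e e0 eB].
  have [N /(_ N (leqnn _)) NP] := half_pow_small (ler0n R 5) e0.
  apply: filterS (cP N) => y /= cy; apply: eB.
  apply: le_lt_trans (metric_triangle _ (c N) _) _.
  by have := xP N; rewrite /= in cy *; lra.
exists x; split=> //; rewrite (proj1 (closure_id A) clA) => B Bx.
exact: filter_ex (filterI FA (Fx _ Bx)).
Qed.

(** A cluster point with arbitrarily late indices spares the extraction of subsequences later. *)
Lemma compact_seq_cluster A (u : nat -> X) : compact A -> (forall n, A (u n)) ->
  exists2 x, A x & forall (e : R) N, 0 < e -> exists2 n, (N <= n)%N & mdist x (u n) < e.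
Proof.
move=> cA uA; have FA : (u @ \oo) A by exists 0%N => // n _; exact: uA.
have [x [Ax xu]] := cA (u @ \oo) _ FA.
exists x => // e N e0.
have FN : (u @ \oo) (u @` [set n | (N <= n)%N]) by exists N => // n Nn; exists n.
have xe : nbhs x [set y | mdist x y < e] by apply/nbhs_mdistP; exists e.
by have [_ [[n Nn <-] xn]] := xu _ _ FN xe; exists n.
Qed.

End metric_basics.
Arguments mcomplete {R} X.

(** * Chains and paths *)

Section paths.
Context {R : realType} {X : metricType R}.
Implicit Types (A E U : set X) (x y z : X).

Lemma mdist_small_eq x y (C : R) : (forall n, mdist x y <= C * 2^-1 ^+ n) -> x = y.
Proof.
move=> H; apply/eqP; apply: contrapT => /negP; rewrite -mdist_gt0 => xy.
have C0 : 0 <= C by have := H 0%N; rewrite expr0 mulr1; apply: le_trans; exact: mdist_ge0.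
have [N NP] := half_pow_small C0 xy.
by have := le_lt_trans (H N) (NP N (leqnn N)); rewrite ltxx.
Qed.

Lemma continuous_mdistP (f : R -> X) :
  continuous f <-> forall t (e : R), 0 < e -> exists2 d : R, 0 < d &
    forall s, `|t - s| < d -> mdist (f t) (f s) < e.
Proof.
split=> [cf t e e0|H t B /nbhs_mdistP [e e0 eB]].
  have /(cf t)/nbhs_ballP [d d0 dP] : nbhs (f t) [set y | mdist (f t) y < e].
    by apply/nbhs_mdistP; exists e.
  by exists d => // s ts; exact: dP.
have [d d0 dP] := H t e e0.
by apply/nbhs_ballP; exists d => // s ts; apply: eB; exact: dP.
Qed.

Definition chainable (kappa : R) := forall x y (r e : R), 0 < e -> mdist x y < r ->
  exists s : seq X, [/\ path (fun a b => mdist a b < e) x s, last x s = y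
    & forall z, z \in s -> mdist x z < kappa * r].

Definition path_in U x y := exists gamma : R -> X,
  [/\ continuous gamma, gamma 0 = x, gamma 1 = y & forall t, U (gamma t)].

Section refinement.
Variables (kappa : R) (y : X).
Hypotheses (kappa_gt0 : 0 < kappa) (ch : chainable kappa).

(** A finite chain ending at [y] is stored as a sequence that stays at [y] from the index [c.2] on,
    so that it can be read at any index. *)
Definition fine_chain (e : R) (c : (nat -> X) * nat) :=
  [/\ (0 < c.2)%N, forall i, mdist (c.1 i) (c.1 i.+1) < e
    & forall i, (c.2 <= i)%N -> c.1 i = y].

(** Every link is replaced by a finer chain padded to a common length [m]. The new point of index
    [k] then sits over the old one of index [k %/ m], so both chains can be compared at the same
    time of a parameter interval. *)
Lemma refine_chain (e e' : R) (c : (nat -> X) * nat) : 0 < e' -> fine_chain e c ->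
  exists c' : (nat -> X) * nat, [/\ fine_chain e' c', c'.1 0%N = c.1 0%N &
    exists m, [/\ (0 < m)%N, c'.2 = (c.2 * m)%N &
      forall k, mdist (c.1 (k %/ m)%N) (c'.1 k) < kappa * e]].
Proof.
case: c => c N e'0 [/= N0 ce cy].
have e0 : 0 < e by apply: le_lt_trans (ce 0%N); exact: mdist_ge0.
have /choice [s sP] : forall i, exists s : seq X,
    [/\ path (fun a b => mdist a b < e') (c i) s, last (c i) s = c i.+1,
        forall z, z \in s -> mdist (c i) z < kappa * e & ((N <= i)%N -> s = [::])].
  move=> i; case: (leqP N i) => Ni.
    by exists [::]; split => //=; rewrite !cy// ltnW.
  by have [s [s1 s2 s3]] := ch e'0 (ce i); exists s; split.
pose v i j := nth (c i.+1) (c i :: s i) j.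
have v_last i j : (size (s i) <= j)%N -> v i j = c i.+1.
  rewrite leq_eqVlt => /orP[/eqP <-|h]; last by rewrite /v nth_default.
  by have [_ <- _ _] := sP i; rewrite /v nth_last.
have v_step i j : mdist (v i j) (v i j.+1) < e'.
  case: (ltnP j (size (s i))) => h.
    by have [/(pathP (c i.+1)) H _ _ _] := sP i; exact: H.
  by rewrite !v_last ?mdistxx// ltnW.
have v_near i j : mdist (c i) (v i j) < kappa * e.
  case: j => [|j]; first by rewrite mdistxx mulr_gt0.
  have [_ _ H _] := sP i.
  case: (ltnP j (size (s i))) => h; first by apply: H; rewrite /v /= mem_nth.
  rewrite (v_last _ _ (leqW h)); have [_ H2 _ _] := sP i.
  have [s0|] := eqVneq (s i) [::]; first by rewrite -H2 s0 mdistxx mulr_gt0.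
  move=> sn; apply: H; rewrite -H2; case: (s i) sn => //= a l _; exact: mem_last.
(* One more than the longest link: each block has reached [c i.+1] by its last index, where the next
   block starts. *)
pose m := (\max_(i < N) size (s i)).+1.
have sm i : (size (s i) < m)%N.
  case: (ltnP i N) => Ni.
    by rewrite ltnS (@leq_bigmax _ (fun i : 'I_N => size (s i)) (Ordinal Ni)).
  by have [_ _ _ ->] := sP i.
exists (fun k => v (k %/ m)%N (k %% m)%N, (N * m)%N); split => /=.
- split=> [|k|k Nk] /=.
  + by rewrite muln_gt0 N0.
  + have [km|km] := eqVneq (k %% m).+1 m.
      have -> : (k.+1 %/ m = (k %/ m).+1)%N.
        by rewrite {1}(divn_eq k m) -addnS km -mulSnr mulnK.
      have -> : (k.+1 %% m = 0)%N.
        by rewrite {1}(divn_eq k m) -addnS km -mulSnr modnMl.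
      by rewrite v_last ?mdistxx// -ltnS km.
    have km' : ((k %% m).+1 < m)%N by rewrite ltn_neqAle km ltn_mod.
    have -> : (k.+1 %/ m = k %/ m)%N.
      by rewrite {1}(divn_eq k m) -addnS divnMDl// (divn_small km') addn0.
    have -> : (k.+1 %% m = (k %% m).+1)%N.
      by rewrite {1}(divn_eq k m) -addnS modnMDl modn_small.
    exact: v_step.
  + have Nkm : (N <= k %/ m)%N by rewrite leq_divRL.
    have [_ _ _ /(_ Nkm) s0] := sP (k %/ m)%N.
    by rewrite v_last ?s0// cy// leqW.
- by rewrite div0n mod0n.
- by exists m; split=> // k; exact: v_near.
Qed.

Lemma truncn_step (a b : R) : a <= b -> b <= a + 1 ->
  (Num.truncn a <= Num.truncn b <= (Num.truncn a).+1)%N.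
Proof.
move=> ab ba; rewrite le_truncn//= truncn_le_nat.
by apply: le_lt_trans ba _; rewrite -[in ltRHS]natr1 ltrD2r truncnS_gt.
Qed.

(** At a given time, the index in the refined chain divided by [m] is the index in the coarse
    one. *)
Lemma truncn_mul_div (a : R) m : (0 < m)%N -> (Num.truncn (a * m%:R) %/ m)%N = Num.truncn a.
Proof.
move=> m0; have m0' : 0 < m%:R :> R by rewrite ltr0n.
have [a0|a0] := ltP a 0.
  have neg b : b < 0 -> Num.truncn (b : R) = 0%N.
    by move=> b0; apply/eqP; rewrite -leqn0 truncn_le_nat (lt_le_trans b0).
  by rewrite (neg _ a0) neg ?div0n// nmulr_rlt0.
have /andP[q1 q2] := truncn_itv a0.
have am0 : 0 <= a * m%:R by rewrite mulr_ge0.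
apply/eqP; rewrite eqn_leq -ltnS ltn_divLR// leq_divRL//.
by rewrite truncn_lt_nat// truncn_ge_nat// !natrM ltr_pM2r// ler_pM2r// q1 q2.
Qed.

Hypothesis cX : mcomplete X.

(* Successive refinements of a chain from [x] to [y], read as step functions
   on [0, 1], converge uniformly to a path. *)
Lemma chainable_path x (r : R) : mdist x y < r ->
  path_in (ball x ((1 + 2 * kappa) * r)) x y.
Proof.
move=> xy; have r0 : 0 < r by apply: le_lt_trans xy; exact: mdist_ge0.
pose e n : R := r * 2^-1 ^+ n.
have e0 n : 0 < e n by rewrite mulr_gt0// half_pow_gt0.
have /choice [F FP] : forall q : nat * ((nat -> X) * nat), exists c' : (nat -> X) * nat,
    fine_chain (e q.1) q.2 -> [/\ fine_chain (e q.1.+1) c', c'.1 0%N = q.2.1 0%N &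
    exists m, [/\ (0 < m)%N, c'.2 = (q.2.2 * m)%N &
      forall k, mdist (q.2.1 (k %/ m)%N) (c'.1 k) < kappa * e q.1]].
  move=> [n c]; have [fc|nfc] := pselect (fine_chain (e n) c); last by exists c.
  by have [c' c'P] := refine_chain (e0 n.+1) fc; exists c'.
pose c0 i : X := if i is 0%N then x else y.
pose st := fix st n := if n is n'.+1 then F (n', st n') else (c0, 1%N).
have stP n : fine_chain (e n) (st n).
  elim: n => [|n IH]; last by have [] := FP (n, st n) IH.
  split=> //= [[|i]|[|i]]//; rewrite /e expr0 mulr1//= mdistxx//.
have st0 n : (st n).1 0%N = x.
  by elim: n => //= n IH; have [_ -> _] := FP (n, st n) (stP n).
pose f n (t : R) := (st n).1 (Num.truncn (t * (st n).2%:R)).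
have fstep n t : mdist (f n t) (f n.+1 t) <= (kappa * r) * 2^-1 ^+ n.
  have [_ _ [m [m0 mE mP]]] := FP (n, st n) (stP n).
  rewrite /f [st n.+1]/= mE natrM mulrA.
  have := mP (Num.truncn (t * (st n).2%:R * m%:R)).
  by rewrite truncn_mul_div// /e mulrA => /ltW.
have kr0 : 0 <= kappa * r by rewrite mulr_ge0// ltW.
have /choice [g gP] : forall t, exists z, forall n,
    mdist z (f n t) <= 2 * (kappa * r) * 2^-1 ^+ n.
  by move=> t; apply: geometric_lim => //; exact: fstep.
exists g; split.
- apply/continuous_mdistP => t d d0.
  (* Twice the uniform error [2 * kappa * r * 2^-n] of the [n]-th step function, plus one of its
     links. *)
  have C0 : 0 <= 4 * (kappa * r) + r by rewrite addr_ge0 ?mulr_ge0// ltW.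
  have [n nP] := half_pow_small C0 d0; have {}nP := nP n (leqnn n).
  have [N0 step _] := stP n.
  have N0' : 0 < (st n).2%:R :> R by rewrite ltr0n.
  have close a b : a <= b -> b <= a + (st n).2%:R^-1 -> mdist (f n a) (f n b) <= e n.
    move=> ab ba; rewrite /f.
    have := @truncn_step (a * (st n).2%:R) (b * (st n).2%:R).
    rewrite ler_pM2r// => /(_ ab).
    have -> : a * (st n).2%:R + 1 = (a + (st n).2%:R^-1) * (st n).2%:R.
      by rewrite mulrDl mulVf// gt_eqF.
    rewrite ler_pM2r// => /(_ ba).
    rewrite (leq_eqVlt _ (_.+1)) ltnS => /andP[h1 /orP[/eqP ->|h2]].
      exact/ltW.
    have -> : Num.truncn (b * (st n).2%:R) = Num.truncn (a * (st n).2%:R).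
      by apply/eqP; rewrite eqn_leq h1 h2.
    by rewrite mdistxx ltW.
  exists ((st n).2%:R^-1); first by rewrite invr_gt0.
  move=> s; rewrite ltr_norml => /andP[ts st'].
  have fts : mdist (f n t) (f n s) <= e n.
    by have [|/ltW] := leP t s => ?; [|rewrite metric_sym]; apply: close => //; lra.
  have := metric_triangle (g t) (f n t) (g s).
  have := metric_triangle (f n t) (f n s) (g s).
  by have := gP t n; have := gP s n; rewrite (metric_sym (g s)) /e in fts *; lra.
- by apply: (@mdist_small_eq _ _ (2 * (kappa * r))) => n; have := gP 0 n; rewrite /f mul0r truncn0 st0.
- apply: (@mdist_small_eq _ _ (2 * (kappa * r))) => n; have := gP 1 n; rewrite /f mul1r.
  by have [_ _ H] := stP n; rewrite H// truncn_ge_nat.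
(* The coarsest chain takes only the values [x] and [y], within [r] of [x], and is uniformly
   [2 * kappa * r] close to the path. *)
- move=> t; apply/ballP; apply: le_lt_trans (metric_triangle _ (f 0%N t) _) _.
  have := gP t 0%N; rewrite expr0 mulr1 (metric_sym (g t)).
  have : mdist x (f 0%N t) < r by rewrite /f /= mulr1; case: (Num.truncn t) => //=; rewrite mdistxx.
  lra.
Qed.

End refinement.
End paths.
Arguments chainable {R} X kappa.

(** * Retraction of the line onto an interval *)

Section clamp.
Context {R : realType}.
Implicit Types (l s t : R).

Lemma clampP l t : 0 <= l -> [\/ t <= 0 /\ Num.max 0 (Num.min l t) = 0,
  [/\ 0 <= t, t <= l & Num.max 0 (Num.min l t) = t]
  | l <= t /\ Num.max 0 (Num.min l t) = l].
Proof.
move=> l0; have [t0|t0] := leP t 0.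
  by constructor 1; rewrite (min_idPr _) ?(max_idPl _)//; lra.
have [tl|tl] := leP t l.
  by constructor 2; rewrite (max_idPr (ltW t0)); split=> //; lra.
by constructor 3; rewrite (max_idPr l0); split=> //; lra.
Qed.

Lemma clamp_dist l s t : 0 <= l ->
  `|Num.max 0 (Num.min l s) - Num.max 0 (Num.min l t)| <= `|s - t|.
Proof.
move=> l0; have [st|st] := leP 0 (s - t); [rewrite (ger0_norm st)|rewrite (ltr0_norm st)];
  rewrite ler_norml; case: (clampP s l0) => [[? ->]|[? ? ->]|[? ->]];
  case: (clampP t l0) => [[? ->]|[? ? ->]|[? ->]]; apply/andP; split; lra.
Qed.

Definition clamp01 (t : R) : R := Num.max 0 (Num.min 1 t).

Lemma clamp01P (t : R) : [\/ t <= 0 /\ clamp01 t = 0, [/\ 0 <= t, t <= 1 & clamp01 t = t]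
  | 1 <= t /\ clamp01 t = 1].
Proof. exact: clampP. Qed.

Lemma clamp01_dist (s t : R) : `|clamp01 s - clamp01 t| <= `|s - t|.
Proof. exact: clamp_dist. Qed.

Lemma clamp01_0 : clamp01 0 = 0.
Proof. by case: (clamp01P 0) => [[? ->]|[? ? ->]|[? ->]]//; lra. Qed.

Lemma clamp01_1 : clamp01 1 = 1.
Proof. by case: (clamp01P 1) => [[? ->]|[? ? ->]|[? ->]]//; lra. Qed.

End clamp.

(** * Gluing of paths and components of open sets *)

Section path_gluing.
Context {R : realType} {X : metricType R}.
Implicit Types (A E U V : set X) (x y z : X).

(** The pieces [k.-1] and [k] agree at the time [k]. Infinitely many pieces are allowed for the sake
    of accessibility; a finite concatenation is completed by constant pieces. *)
Lemma glue_paths (P : nat -> R -> X) :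
  (forall k, continuous (P k)) -> (forall k, P k 1 = P k.+1 0) ->
  continuous (fun s : R => P (Num.truncn s) (clamp01 (s - (Num.truncn s)%:R))).
Proof.
move=> cP PP; pose Q k s := P k (clamp01 (s - k%:R)).
apply/continuous_mdistP => s e e0.
have cQ k : exists2 d : R, 0 < d & forall s', `|s - s'| < d -> mdist (Q k s) (Q k s') < e.
  have [d d0 dP] := (continuous_mdistP (P k)).1 (cP k) (clamp01 (s - k%:R)) e e0.
  exists d => // s' ss'; apply: dP; apply: le_lt_trans (clamp01_dist _ _) _.
  by rewrite (_ : s - k%:R - (s' - k%:R) = s - s')//; lra.
pose k := Num.truncn s.
have [d1 d10 d1P] := cQ k; have [d2 d20 d2P] := cQ k.-1.
have ks : s < k%:R + 1 by rewrite natr1 truncnS_gt.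
(* If [k < s], nearby times stay above [k]. If [s = k], they may fall into the piece [k.-1], which
   ends where the piece [k] starts. Negative times truncate to 0 and are clamped. *)
pose d3 := if k%:R < s then s - k%:R else 1.
have d30 : 0 < d3 by rewrite /d3; case: ifP => //; rewrite subr_gt0.
exists (Num.min (Num.min d1 d2) (Num.min d3 (Num.min (k%:R + 1 - s) 1))).
  by rewrite !lt_min d10 d20 d30 subr_gt0 ks ltr01.
move=> s'; rewrite !lt_min -!andbA => /and5P[h1 h2 h3 h4 h5].
have [ss'|s's] := leP s s'.
  have -> : Num.truncn s' = k.
    apply/eqP; rewrite eqn_leq [in X in _ && X]le_truncn// andbT truncn_le_nat -natr1.
    by move: h4; rewrite ltr_norml => /andP[]; lra.
  exact: d1P.
have [s'k|ks'] := ltnP (Num.truncn s') k; last first.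
  have -> : Num.truncn s' = k by apply/eqP; rewrite eqn_leq ks' andbT le_truncn// ltW.
  exact: d1P.
have s0 : 1 <= s by rewrite -truncn_gt0; apply: leq_ltn_trans s'k.
have k_s : k%:R <= s by rewrite truncn_le; lra.
have s'ltk : s' < k%:R.
  apply: lt_le_trans (truncnS_gt s') _; by rewrite ler_nat.
have sk : s = k%:R.
  apply/eqP; rewrite eq_le k_s andbT leNgt; apply/negP => ks2.
  by move: h3; rewrite /d3 ks2 ltr_norml => /andP[]; lra.
have k0 : (0 < k)%N by apply: leq_ltn_trans s'k.
have k1 : (k.-1%:R + 1 = k%:R :> R) by rewrite natr1 prednK.
have -> : Num.truncn s' = k.-1.
  apply/eqP; rewrite eqn_leq -ltnS prednK// s'k /=.
  rewrite truncn_ge_nat; move: h5; rewrite ltr_norml => /andP[]; last by lra.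
  by have : (0 : R) <= k.-1%:R by []; lra.
have -> : P (Num.truncn s) (clamp01 (s - (Num.truncn s)%:R)) = Q k.-1 s.
  have e1 : s - k.-1%:R = 1 by lra.
  have e0' : s - (Num.truncn s)%:R = 0 by rewrite -/k; lra.
  by rewrite /Q e1 e0' -/k clamp01_0 clamp01_1 PP prednK.
exact: d2P.
Qed.

Lemma path_in_sub U V x y : U `<=` V -> path_in U x y -> path_in V x y.
Proof. by move=> UV [g [cg g0 g1 gU]]; exists g; split=> // t; exact: UV. Qed.

Lemma path_in_refl U x : U x -> path_in U x x.
Proof. by move=> Ux; exists (fun=> x); split=> // t; exact: cst_continuous. Qed.

Lemma path_in_sym U x y : path_in U x y -> path_in U y x.
Proof.
move=> [g [cg g0 g1 gU]]; exists (fun t => g (1 - t)); split=> [|||t//].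
- move=> t; apply: continuous_comp; last exact: cg.
  by apply: cvgB; [exact: cvg_cst|exact: cvg_id].
- by rewrite subr0.
- by rewrite subrr.
Qed.

Lemma path_in_trans U x y z : path_in U x y -> path_in U y z -> path_in U x z.
Proof.
move=> [g [cg g0 g1 gU]] [h [ch h0 h1 hU]].
pose P k : R -> X := match k with 0%N => g | 1%N => h | _ => fun=> z end.
have cP k : continuous (P k).
  by case: k => [|[|k]] //= t; exact: cst_continuous.
have PP k : P k 1 = P k.+1 0 by case: k => [|[|k]] //=; rewrite g1.
pose G (s : R) := P (Num.truncn s) (clamp01 (s - (Num.truncn s)%:R)).
exists (G \o (fun t => 2 * t)); rewrite /G; split.
- move=> t; apply: continuous_comp.
    by apply: cvgM; [exact: cvg_cst|exact: cvg_id].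
  exact: glue_paths.
- rewrite /= mulr0 truncn0 /= subr0 -g0; congr g.
  exact: clamp01_0.
- rewrite /= mulr1.
  have -> : Num.truncn (2 : R) = 2%N by apply: truncn_def; rewrite lexx ltr_nat.
  by [].
- move=> t /=; case: (Num.truncn _) => [|[|k]] //=.
  by rewrite -h1.
Qed.

Lemma path_in_component U x y : path_in U x y -> connected_component U x y.
Proof.
move=> [g [cg g0 g1 gU]]; exists (g @` `[0, 1]).
  split.
  - by exists 0 => //=; rewrite in_itv/= lexx ler01.
  - by move=> _ [t _ <-].
  - apply: connected_continuous_connected; first exact: segment_connected.
    exact: continuous_subspaceT.
by exists 1 => //=; rewrite in_itv/= ler01 lexx.
Qed.

Definition loc_path_connected (L : R) :=
  forall x y (r : R), mdist x y < r -> path_in (ball x (L * r)) x y.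

Section locally_path_connected.
Variable L : R.
Hypotheses (L0 : 0 < L) (lpc : loc_path_connected L).

Lemma lpc_ball U x : open U -> U x ->
  exists2 e : R, 0 < e & forall y, mdist x y < e -> path_in U x y.
Proof.
move=> /open_mdistP oU /oU [e e0 eU]; exists (e / L); first by rewrite divr_gt0.
move=> y xy; apply: path_in_sub (lpc xy) => z /ballP; rewrite mulrC divfK ?gt_eqF//.
exact: eU.
Qed.

Lemma connected_open_path U x y : open U -> connected U -> U x -> U y -> path_in U x y.
Proof.
move=> oU cU Ux Uy.
suff E : [set y | path_in U x y] = U by rewrite -E in Uy.
apply: cU.
- by exists x; exact: path_in_refl.
- exists [set y | path_in U x y].
    apply/open_mdistP => z [g [cg g0 g1 gU]].
    have Uz : U z by rewrite -g1.
    have [e e0 eP] := lpc_ball oU Uz; exists e => // w /eP.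
    by apply: path_in_trans; exists g.
  by apply/esym/setIidPr => z [g [_ _ <-]].
- exists (~` [set y | U y /\ ~ path_in U x y]).
    apply: open_closedC; apply/open_mdistP => z [Uz nz].
    have [e e0 eP] := lpc_ball oU Uz; exists e => // w /eP zw; split.
      by have [g [_ _ <- ]] := zw.
    by move=> xw; apply: nz; apply: path_in_trans xw _; exact: path_in_sym.
  apply/seteqP; split=> z /=.
    by move=> xz; split; [have [g [_ _ <-]] := xz|case].
  by move=> [Uz /not_andP[//|]]; exact: contrapT.
Qed.

Lemma component_open U x : open U -> open (connected_component U x).
Proof.
move=> oU; apply/open_mdistP => y xy.
have [e e0 eP] := lpc_ball oU (connected_component_sub xy).
by exists e => // z /eP/path_in_component; exact: connected_component_trans.
Qed.

Lemma component_rel_closed U x y : open U -> U y ->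
  closure (connected_component U x) y -> connected_component U x y.
Proof.
move=> oU Uy /closure_mdistP H; have [e e0 eP] := lpc_ball oU Uy.
have [z xz /eP/path_in_component yz] := H e e0.
by apply: connected_component_trans xz _; exact: connected_component_sym.
Qed.

End locally_path_connected.

(* The paths are traversed on consecutive unit intervals of [0, +oo[, which
   [t / (1 - t)] compresses to [0, 1[. *)
Lemma accessible_glue U x (z : nat -> X) (C : R) : 0 <= C ->
  (forall k, path_in (U `&` ball x (C * 2^-1 ^+ k)) (z k) (z k.+1)) -> accessible U x.
Proof.
move=> C0 /choice [P PP].
have cP k : continuous (P k) by have [] := PP k.
have PS k : P k 1 = P k.+1 0 by have [_ _ -> _] := PP k; have [_ -> _ _] := PP k.+1.
pose h (s : R) := P (Num.truncn s) (clamp01 (s - (Num.truncn s)%:R)).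
have ch : continuous h by exact: glue_paths.
pose g (t : R) := if t < 1 then h (t / (1 - t)) else x.
have cg : continuous g.
  apply/continuous_mdistP => t e e0.
  have [t1|t1|t1] := ltgtP t 1.
  - have /(_ [set y | mdist (h (t / (1 - t))) y < e]) : {for t, continuous (h \o (fun s : R => s / (1 - s)))}.
      apply: continuous_comp; last exact: ch.
      apply: cvgM; first exact: cvg_id.
      apply: cvgV; first by rewrite subr_eq0 gt_eqF.
      by apply: cvgB; [exact: cvg_cst|exact: cvg_id].
    case=> [|d /= d0 dP]; first by apply/nbhs_mdistP; exists e.
    exists (Num.min d (1 - t)); first by rewrite lt_min d0 subr_gt0.
    move=> s; rewrite lt_min => /andP[sd]; rewrite ltr_norml => /andP[s1 s2].
    rewrite /g t1; have -> : s < 1 by lra.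
    exact: dP.
  - exists (t - 1) => [|s]; first by rewrite subr_gt0.
    rewrite ltr_norml => /andP[s1 s2].
    have s1' : 1 <= s by lra.
    by rewrite /g (ltNge t) (ltW t1)/= (ltNge s) s1'/= mdistxx.
  - have [N NP] := half_pow_small C0 e0.
    (* If [1 - s < 1 / (N + 1)] then [s / (1 - s) > N], so only paths from the [N]-th on are seen,
       and they lie within [C * 2^-N] of [x]. *)
    exists (N.+1%:R^-1) => [|s]; first by rewrite invr_gt0.
    rewrite t1 /g ltxx; case: ifP => [s1|_ _]; last by rewrite mdistxx.
    rewrite ger0_norm; last by lra.
    move=> sN; set u := s / (1 - s); have s10 : 0 < 1 - s by lra.
    have uN : (N <= Num.truncn u)%N.
      have N0 : (0 : R) < N.+1%:R by [].
      have h1 : (1 - s) * N.+1%:R < 1 by rewrite -ltr_pdivlMr// div1r.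
      have Nu : N%:R <= u.
        by rewrite /u ler_pdivlMr//; move: h1; rewrite -natr1; lra.
      by rewrite truncn_ge_nat//; apply: le_trans Nu.
    rewrite /h; have [_ _ _ /(_ (clamp01 (u - (Num.truncn u)%:R))) [_ /ballP]] := PP (Num.truncn u).
    by move/lt_trans; apply; exact: NP.
exists g; split.
- exact: continuous_subspaceT.
- by rewrite /g ltxx.
- move=> t /andP[t0 t1]; rewrite /g t1 /h.
  by have [_ _ _ /(_ (clamp01 (t / (1 - t) - (Num.truncn (t / (1 - t)))%:R))) []] := PP (Num.truncn (t / (1 - t))).
Qed.

End path_gluing.
Arguments loc_path_connected {R} X L.

(** * Curves parameterized by arc length *)

Section arcs.
Context {R : realType} {X : metricType R}.
Implicit Types (g : R -> X) (a b s t l : R) (p q : seq R).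

Fixpoint polygon_length g a p : R :=
  if p is c :: p' then mdist (g a) (g c) + polygon_length g c p' else 0.

Lemma polygon_lengthE g a b p :
  \sum_(0 <= i < size p) mdist (g (nth b (a :: p) i)) (g (nth b (a :: p) i.+1)) =
  polygon_length g a p.
Proof.
elim: p a => [|c p IH] a; first by rewrite big_nil.
by rewrite [size _]/= big_nat_recl//= -IH.
Qed.

Lemma curve_lengthE g a b : curve_length g a b =
  ereal_sup [set (polygon_length g a p)%:E | p in itv_partition a b].
Proof.
by rewrite /curve_length; congr ereal_sup; apply/eq_imagel => p _;
  rewrite polygon_lengthE.
Qed.

Lemma path_le_last a p : path <%R a p -> a <= last a p.
Proof.
by elim: p a => //= c p IH a /andP[ac /IH]; apply: le_trans; exact: ltW.
Qed.

Lemma polygon_length_rcons g a p t :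
  polygon_length g a (rcons p t) = polygon_length g a p + mdist (g (last a p)) (g t).
Proof. by elim: p a => [|c p IH] a /=; rewrite ?addr0 ?add0r// IH addrA. Qed.

Lemma polygon_length_shift g a b p :
  polygon_length (fun t => g (a + t)) b p = polygon_length g (a + b) (map (+%R a) p).
Proof. by elim: p b => //= c p IH b; rewrite IH. Qed.

Section arc_length.
Variables (l : R) (g : R -> X).
Hypothesis gP : arc_length_param l g.

(** Appending [t] to a partition of [[0, s]] adds [mdist (g s) (g t)] to the polygon, while the two
    lengths are [s] and [t]. *)
Lemma arc_lipschitz s t : 0 <= s -> s <= t -> t <= l -> mdist (g s) (g t) <= t - s.
Proof.
case: gP => l0 H s0; rewrite le_eqVlt => /orP[/eqP ->|st tl].
  by rewrite mdistxx subrr.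
have sl : 0 <= s <= l by rewrite s0 (le_trans (ltW st)).
have tl' : 0 <= t <= l by rewrite (le_trans s0 (ltW st)).
rewrite lerBrDl -lerBrDr -lee_fin -(H _ sl) curve_lengthE.
apply: ge_ereal_sup => _ [p [p1 /eqP p2] <-]; rewrite lee_fin lerBrDr -lee_fin -(H _ tl').
rewrite curve_lengthE; apply: ereal_sup_ubound; exists (rcons p t).
  by split; [rewrite rcons_path p1 p2|rewrite last_rcons].
by rewrite polygon_length_rcons p2.
Qed.

Lemma arc_dist s t : 0 <= s <= l -> 0 <= t <= l -> mdist (g s) (g t) <= `|t - s|.
Proof.
move=> /andP[s0 sl] /andP[t0 tl]; have [st|/ltW ts] := leP s t.
  by rewrite ger0_norm ?subr_ge0//; exact: arc_lipschitz.
by rewrite metric_sym distrC ger0_norm ?subr_ge0//; exact: arc_lipschitz.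
Qed.

Lemma polygon_length_le a p : 0 <= a -> path <%R a p -> last a p <= l ->
  polygon_length g a p <= last a p - a.
Proof.
elim: p a => [|c p IH] a a0 /=; first by rewrite subrr.
move=> /andP[ac cp] pl; have cl := path_le_last cp.
have := IH c (le_trans a0 (ltW ac)) cp pl.
have := arc_lipschitz a0 (ltW ac) (le_trans cl pl); lra.
Qed.

(** The link that crosses [s] is broken there by the triangle inequality; everything before [s] is
    bounded by the Lipschitz property. *)
Lemma polygon_length_split s t a p : 0 <= a -> a <= s -> s < t -> t <= l ->
  path <%R a p -> last a p = t ->
  exists q, [/\ path <%R s q, last s q = t &
    polygon_length g a p <= (s - a) + polygon_length g s q].
Proof.
move=> a0 as_ st tl; elim: p a a0 as_ => [|c p IH] a a0 as_ /=.
  by move=> _ at_; move: as_; rewrite at_ leNgt st.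
move=> /andP[ac cp] pt; have ct : c <= t by rewrite -pt path_le_last.
have [cs|sc] := leP c s.
  have [q [q1 q2 q3]] := IH c (le_trans a0 (ltW ac)) cs cp pt.
  exists q; split=> //.
  have := arc_lipschitz a0 (ltW ac) (le_trans ct tl); lra.
exists (c :: p); split=> //=; first by rewrite sc.
have := arc_lipschitz a0 as_ (ltW (lt_le_trans st tl)).
have := metric_triangle (g a) (g s) (g c); lra.
Qed.

(** Upper gradient inequalities will be applied to subcurves. The length is at most [t] by the
    Lipschitz bound, and at least [t] because a nearly optimal polygon of [[0, a + t]] loses at most
    [a] when cut at [a]. *)
Lemma arc_shift a b : 0 <= a -> a < b -> b <= l ->
  arc_length_param (b - a) (fun t => g (a + t)).
Proof.
move=> a0 ab bl; split=> [|t /andP[t0 tb]]; first by rewrite subr_ge0 ltW.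
have atl : a + t <= l by apply: le_trans bl; lra.
rewrite curve_lengthE; apply/eqP; rewrite eq_le; apply/andP; split.
  apply: ge_ereal_sup => _ [p [p1 /eqP p2] <-].
  rewrite lee_fin polygon_length_shift addr0.
  have lastE : last a (map (+%R a) p) = a + t by rewrite -p2 -(last_map (+%R a)) addr0.
  apply: le_trans (polygon_length_le a0 _ _) _; rewrite ?lastE//; last by lra.
  by rewrite -{1}(addr0 a) path_map; apply: sub_path p1 => x y xy /=; rewrite ltrD2l.
move: t0; rewrite (le_eqVlt 0 t) => /orP[/eqP <-|t0].
  by apply: ereal_sup_ubound; exists [::] => //; split.
apply/lee_addgt0Pr => e e0.
have [_ H] := gP; have at0 : 0 <= a + t <= l by rewrite atl andbT addr_ge0// ltW.
have Hf : ereal_sup [set (polygon_length g 0 p)%:E | p in itv_partition 0 (a + t)] \is a fin_num.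
  by rewrite -curve_lengthE H.
have [_ [p [p1 /eqP p2] <-]] := ub_ereal_sup_adherent e0 Hf.
rewrite -[ereal_sup _]curve_lengthE H// => pe.
have aat : a < a + t by rewrite ltrDl.
have [q [q1 q2 q3]] := polygon_length_split (lexx 0) a0 aat atl p1 p2.
apply: (@le_trans _ _ ((polygon_length g a q)%:E + e%:E)%E).
  by rewrite -EFinD lee_fin; rewrite -EFinB lte_fin in pe; lra.
rewrite leeD2r//; apply: ereal_sup_ubound; exists (map (+%R (- a)) q).
  have -> : 0 = - a + a by rewrite addNr.
  split; last by rewrite last_map q2 addKr.
  by rewrite path_map; apply: sub_path q1 => x y xy /=; rewrite ltrD2l.
rewrite polygon_length_shift addr0 -map_comp (eq_map (g := id)) ?map_id//.
by move=> x /=; rewrite addNKr.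
Qed.

Lemma arc_continuous : continuous (fun t => g (Num.max 0 (Num.min l t))).
Proof.
case: gP => l0 _; apply/continuous_mdistP => t e e0; exists e => // s ts.
apply: le_lt_trans ts.
have cl u : 0 <= Num.max 0 (Num.min l u) <= l.
  by rewrite le_max lexx ge_max l0 ge_min lexx.
apply: le_trans (arc_dist (cl t) (cl s)) _; rewrite distrC.
exact: clamp_dist.
Qed.

Lemma arc_clampE t : 0 <= t <= l -> g (Num.max 0 (Num.min l t)) = g t.
Proof. by move=> /andP[t0 tl]; rewrite (min_idPr tl) (max_idPr t0). Qed.

Lemma arc_image_connected s : 0 <= s <= l -> connected (g @` `[0, s]).
Proof.
move=> /andP[s0 sl]; rewrite (_ : _ @` _ = (fun t => g (Num.max 0 (Num.min l t))) @` `[0, s]).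
  apply: connected_continuous_connected; first exact: segment_connected.
  exact/continuous_subspaceT/arc_continuous.
apply: eq_imagel => t /=; rewrite in_itv/= => /andP[t0 ts].
by rewrite arc_clampE// t0 (le_trans ts).
Qed.

End arc_length.
End arcs.

(** * Almost John domains *)

Section almost_john.
Context {R : realType} {X : metricType R}.
Implicit Types (A E U Om F : set X) (x y z w : X).

Lemma mdist_continuous x : continuous (mdist x : X -> R).
Proof.
move=> y; apply/cvgrPdist_lt => e e0; apply/nbhs_mdistP; exists e => // z yz.
rewrite ltr_norml; have := metric_triangle x y z; have := metric_triangle x z y.
by rewrite (metric_sym z); move=> ? ?; apply/andP; split; lra.
Qed.

(** The distance from [x] is 1-Lipschitz, hence maps a ball of radius [rr j] into an interval of
    length [2 * rr j]. A cover of [E] thus yields intervals covering []a, b[], and Lebesgue measure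
    is countably subadditive. *)
Lemma content_lower_bound (E : set X) x (a b : R) : a <= b ->
  (forall t, a < t < b -> exists2 z, E z & mdist x z = t) ->
  (((b - a) / 2)%:E <= hausdorff_content1 E)%E.
Proof.
move=> ab abE; apply: le_ereal_inf_tmp => _ [c [rr [rr0 Ecov ->]]].
pose I j : set R := `](mdist x (c j) - rr j), (mdist x (c j) + rr j)[%classic.
have Icov : `]a, b[%classic `<=` \bigcup_j I j.
  move=> t /=; rewrite in_itv/= => /abE [z /Ecov [j _ /ballP cz] <-].
  exists j => //; rewrite /I /= in_itv/=.
  have := metric_triangle x (c j) z; have := metric_triangle x z (c j).
  by rewrite (metric_sym z); move=> ? ?; apply/andP; split; lra.
have : (lebesgue_measure (`]a, b[%classic : set R) <= \sum_(0 <= j <oo) lebesgue_measure (I j))%E.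
  by apply: measure_sigma_subadditive => // j; exact: measurable_itv.
rewrite lebesgue_measure_itv/= lte_fin.
have -> : (\sum_(0 <= j <oo) lebesgue_measure (I j) = \sum_(0 <= j <oo) ((rr j)%:E + (rr j)%:E))%E.
  apply: eq_eseriesr => j _; rewrite /I lebesgue_measure_itv/= lte_fin.
  have r0 := rr0 j; rewrite ifT; last by lra.
  rewrite -!EFinD; congr (_%:E); lra.
rewrite nneseriesD; [|by move=> j _ _; rewrite lee_fin ltW..].
set S := (\sum_(0 <= j <oo) (rr j)%:E)%E.
have S0 : (0 <= S)%E by apply: nneseries_ge0 => j _ _; rewrite lee_fin ltW.
have [ab'|ba] := ltP a b.
  case: S S0 => [s||]//; last by move=> _ _; rewrite leey.
  by rewrite -!EFinD !lee_fin; lra.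
by move=> _; apply: le_trans S0; rewrite lee_fin; lra.
Qed.

Section finitely_connected.
Variables (L : R) (Om : set X).
Hypotheses (L0 : 0 < L) (lpc : loc_path_connected X L).

(** A component that does not contain [x0] crosses the shell between the radii [r / 2] and
    [3 * r / 4], and [F] is too small to contain that crossing. A John curve from a point off [F],
    followed for a length [r / 8], stays within [7 * r / 8] of [x] and gets as far as [r / (8 * C)]
    from the complement. *)
Lemma john_carrot F (C : R) x w x0 (r : R) :
  open Om -> connected Om -> Om x0 -> 1 <= C -> 0 < r -> Om w -> mdist x w < r / 2 ->
  (hausdorff_content1 F < (r / 8)%:E)%E ->
  (forall z, (Om `\` F) z -> exists (l : R) (gamma : R -> X),
      [/\ arc_length_param l gamma, gamma 0 = z, gamma l = x0
        & forall t, 0 <= t <= l -> (Om `\` F) (gamma t) /\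
            (t%:E <= C%:E * set_dist [set gamma t] (~` (Om `\` F)))%E]) ->
  connected_component (Om `&` ball x r) w x0 \/
  exists2 q, connected_component (Om `&` ball x r) w q &
    ball q (r / (8 * C)) `<=` Om `&` ball x r.
Proof.
move=> oO cO Ox0 C1 r0 Ow xw Fr john; set U := connected_component _ w.
have oOB : open (Om `&` ball x r) by apply: openI => //; exact: open_mball.
have Ow' : (Om `&` ball x r) w by split=> //; apply/ballP; lra.
have Uw : U w by exact: connected_component_refl.
have US : U `<=` Om `&` ball x r by exact: connected_component_sub.
have [|nUx0] := pselect (U x0); [by left|right].
(* Otherwise [U] keeps away from the sphere of radius [r], so that it is open and closed in the
   connected set [Om] and contains [x0]. *)
have [v Uv xv] : exists2 v, U v & 3 / 4 * r < mdist x v.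
  apply: contrapT => /forall2NP nv; apply: nUx0.
  have Ule z : U z -> mdist x z <= 3 / 4 * r.
    by move=> Uz; case: (nv z) => [//|/negP]; rewrite -leNgt.
  suff -> : U = Om by [].
  apply: cO.
  - by exists w.
  - exists U; first exact: (component_open L0 lpc).
    by apply/esym/setIidPr => z /US [].
  - exists (closure U); first exact: closed_closure.
    apply/seteqP; split=> z; first by move=> Uz; split; [exact: (US _ Uz).1|exact: subset_closure].
    move=> [Oz cz]; apply: (component_rel_closed L0 lpc) => //; split=> //; apply/ballP.
    have r80 : 0 < r / 8 by rewrite divr_gt0.
    have [y Uy zy] := (closure_mdistP _ _).1 cz (r / 8) r80.
    have := Ule y Uy; have := metric_triangle x y z; rewrite (metric_sym y); lra.
(* If [F] contained this part of [U], its content would be at least half of [3 / 4 * r - r / 2],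
   which is [r / 8]. *)
have [z [Uz nFz xz]] : exists z, [/\ U z, ~ F z & mdist x z < 3 / 4 * r].
  apply: contrapT => nz; move: Fr; apply/negP; rewrite -leNgt.
  have -> : r / 8 = (3 / 4 * r - r / 2) / 2 by lra.
  apply: (@content_lower_bound _ x); first by lra.
  move=> t /andP[t1 t2].
  have Ui : is_interval (mdist x @` U).
    apply/connected_intervalP/connected_continuous_connected.
      exact: component_connected.
    exact/continuous_subspaceT/mdist_continuous.
  have [z Uz zt] : (mdist x @` U) t.
    by apply: (Ui (mdist x w) (mdist x v)); [exists w|exists v|lra].
  exists z => //; apply: contrapT => nFz; apply: nz; exists z; split=> //.
  by rewrite zt.
have [Oz Bz] := US _ Uz.
have [l [g [gP g0 gl gJ]]] := john z (conj Oz nFz).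
(* A curve ending by the time [r / 8] would put its end point [x0] into [U]. *)
pose t := Num.min l (r / 8).
have l0 : 0 <= l by have [] := gP.
have t0l : 0 <= t <= l by rewrite le_min l0 ge_min lexx divr_ge0// ltW.
have tr : t <= r / 8 by rewrite ge_min lexx orbT.
have gB s : 0 <= s <= t -> mdist x (g s) < 7 / 8 * r.
  move=> /andP[s0 st]; have /andP[_ tl] := t0l.
  have := arc_lipschitz gP (lexx 0) s0 (le_trans st tl).
  rewrite g0 subr0; have := metric_triangle x z (g s); lra.
have Ugt : U (g t).
  apply: connected_component_trans Uz _; exists (g @` `[0, t]).
    split.
    - by exists 0 => //=; rewrite in_itv/= lexx; have /andP[] := t0l.
    - move=> y [s /=]; rewrite in_itv/= => st <-.
      have /andP[s0 st1] := st; have /andP[_ tl] := t0l.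
      split; last by apply/ballP; have := gB s st; lra.
      have sl : 0 <= s <= l by rewrite s0 (le_trans st1).
      by have [[]] := gJ s sl.
    - exact: (arc_image_connected gP).
  by exists t => //=; rewrite in_itv/= lexx andbT; have /andP[] := t0l.
have tE : t = r / 8.
  have [lr|] := boolP (l <= r / 8); last first.
    by rewrite -ltNge => rl; rewrite /t (min_idPr (ltW rl)).
  by exfalso; apply: nUx0; rewrite -gl; move: Ugt; rewrite /t (min_idPl lr).
exists (g t) => // y /ballP gy.
have C0 : 0 < C by apply: lt_le_trans C1.
split; last first.
  apply/ballP; have := metric_triangle x (g t) y.
  have tt : 0 <= t <= t by rewrite lexx andbT; have /andP[] := t0l.
  have : r / (8 * C) <= r / 8.
    by rewrite invfM mulrA ler_pdivrMr// ler_peMr// divr_ge0// ltW.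
  by have := gB t tt; lra.
apply: contrapT => nOy; have [_] := gJ t t0l; apply/negP; rewrite -ltNge.
apply: (@le_lt_trans _ _ (C%:E * (mdist (g t) y)%:E)%E).
  rewrite lee_pmul2l ?lte_fin//.
  apply: ereal_inf_lbound; exists (g t, y) => //; split=> //= -[Oy _]; exact: nOy.
by rewrite -EFinM lte_fin {2}tE mulrC -ltr_pdivlMr// -mulrA -invfM.
Qed.

(** With [sg = rho / (2 * L)], two centers of balls of radius [rho] that are [sg] close to the same
    net point are joined by a path inside the first ball. One representative per net point therefore
    suffices, together with [x0] for the component that contains it. *)
Lemma almost_john_joined x (r : R) : almost_john_domain Om -> 0 < r ->
  tot_bounded (ball x r) -> exists s : seq X, (forall z, z \in s -> Om z) /\
    forall w, Om w -> mdist x w < r / 2 ->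
      exists2 z, z \in s & connected_component (Om `&` ball x r) w z.
Proof.
move=> [[_ oO cO _ _] aj] r0 tB.
have [F [_ _ Fr [_ [C [x0 [C1 [Ox0 _] john]]]]]] := aj _ (divr_gt0 r0 (ltr0n _ 8)).
have C0 : 0 < C by apply: lt_le_trans C1.
pose rho := r / (8 * C); have rho0 : 0 < rho by rewrite divr_gt0// mulr_gt0.
pose sg := rho / (2 * L); have sg0 : 0 < sg by rewrite divr_gt0// mulr_gt0.
pose P c q := ball q rho `<=` Om `&` ball x r /\ mdist c q < sg.
have /choice [rep repP] : forall c, exists q, Om q /\ ((exists q', P c q') -> P c q).
  move=> c; have [[q Pq]|np] := pselect (exists q, P c q); last by exists x0; split.
  exists q; split=> //; have [/(_ q) H _] := Pq.
  by have [//|//] := H _; apply/ballP; rewrite mdistxx.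
have [cs csP] := tB _ sg0.
exists (x0 :: map rep cs); split.
  by move=> z; rewrite inE => /orP[/eqP ->//|/mapP [c _ ->]]; have [] := repP c.
move=> w Ow xw.
have [wx0|[q wq qB]] := john_carrot oO cO Ox0 C1 r0 Ow xw Fr john.
  by exists x0; rewrite // mem_head.
have qq : ball q rho q by apply/ballP; rewrite mdistxx.
have [c cc cq] := csP q (qB q qq).2.
have [_ rc] := repP c; have [|rB cr] := rc; first by exists q.
exists (rep c); first by rewrite inE map_f ?orbT.
apply: connected_component_trans wq _; apply: path_in_component.
have qr : mdist q (rep c) < 2 * sg.
  by have := metric_triangle q c (rep c); rewrite (metric_sym q c); lra.
apply: path_in_sub (lpc qr) => y yq; apply: qB; move: yq.
by rewrite /sg (_ : L * _ = rho)//; field; rewrite gt_eqF.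
Qed.

End finitely_connected.
End almost_john.

(** * The Mazurkiewicz completion *)

Section cauchy.
Context {R : realType} {T : metricType R}.

Lemma mcauchyP (u : nat -> T) : cauchy (u @ \oo) <-> mcauchy u.
Proof.
split=> [/cauchy_ballP cu e e0|cu].
  have [[A B] /= [[N1 _ N1A] [N2 _ N2B]] AB] := cu e e0.
  exists (maxn N1 N2) => m n; rewrite !geq_max => /andP[m1 _] /andP[_ n2].
  by apply/ballP; exact: AB (u m, u n) (conj (N1A _ m1) (N2B _ n2)).
apply/cauchy_ballP => e e0; have [N NP] := cu e e0.
exists (u @` [set n | (N <= n)%N], u @` [set n | (N <= n)%N]).
  by split; exists N => // n Nn; exists n.
by move=> [_ _] /= [[m Nm <-] [n Nn <-]]; apply/ballP; exact: NP.
Qed.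

End cauchy.

Lemma mdist_cvg (R : realType) (T : metricType R) (u v : nat -> T) :
  mcauchy u -> mcauchy v -> cvgn (fun n => mdist (u n) (v n)).
Proof.
move=> cu cv; apply/cauchy_cvgP; apply/(@mcauchyP R R^o) => e e0.
have e20 : 0 < e / 2 by rewrite divr_gt0.
have [N NP] := cu _ e20; have [K KP] := cv _ e20.
exists (maxn N K) => m n; rewrite !geq_max => /andP[Nm Km] /andP[Nn Kn].
change (`|mdist (u n) (v n) - mdist (u m) (v m)| < e); rewrite ltr_norml.
have := NP _ _ Nm Nn; have := KP _ _ Km Kn.
have := metric_triangle (u m) (u n) (v m); have := metric_triangle (u n) (v n) (v m).
have := metric_triangle (u n) (u m) (v n); have := metric_triangle (u m) (v m) (v n).
by rewrite (metric_sym (u n) (u m)) (metric_sym (v n) (v m)); move=> *; apply/andP; split; lra.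
Qed.

(** * Distances and compactness in the completion *)

Section completion_theory.
Context {R : realType} {T : metricType R}.
Local Open Scope quotient_scope.
Local Notation M := (completion T).

Lemma completion_seq_cauchy (a : M) : mcauchy (completion_seq a).
Proof.
apply/mcauchyP.
exact: (@set_valP _ cauchy_seqs (repr (a : {eq_quot same_limit_equiv}))).
Qed.

Lemma completion_classE (a : M) : completion_class (repr (a : {eq_quot same_limit_equiv})) = a.
Proof. exact: reprK. Qed.

(** The distance is defined through the representative picked by [repr]; this lets it be estimated
    on any other one. *)
Lemma completion_class_seq (u : @cauchy_seqs R T) :
  mdist (completion_seq (completion_class u) n) (set_val u n) @[n --> \oo] --> (0 : R).
Proof.
have : same_limit (repr (completion_class u : {eq_quot same_limit_equiv})) u.
  by apply/(@eqmodP _ same_limit_equiv); rewrite reprK.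
by move/asboolP.
Qed.

Lemma completion_dist_cvg (a b : M) :
  mdist (completion_seq a n) (completion_seq b n) @[n --> \oo] --> mdist a b.
Proof. by apply: mdist_cvg; exact: completion_seq_cauchy. Qed.

Lemma completion_dist_le (u v : @cauchy_seqs R T) (c : R) N :
  (forall n, (N <= n)%N -> mdist (set_val u n) (set_val v n) <= c) ->
  mdist (completion_class u) (completion_class v) <= c.
Proof.
move=> uv; have cD := @completion_dist_cvg (completion_class u) (completion_class v).
have cu := completion_class_seq u; have cv := completion_class_seq v.
have c3 : mdist (completion_seq (completion_class u) n) (set_val u n) +
    (mdist (completion_seq (completion_class v) n) (set_val v n) + c) @[n --> \oo] --> 0 + (0 + c).
  by apply: cvgD => //; apply: cvgD => //; exact: cvg_cst.
rewrite !add0r in c3; apply: (ler_cvg_to cD c3); exists N => // n /= Nn.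
set u' := completion_seq _ n; set v' := completion_seq _ n.
have := metric_triangle u' (set_val u n) v'; have := metric_triangle (set_val u n) (set_val v n) v'.
by have := uv n Nn; rewrite (metric_sym (set_val v n) v'); lra.
Qed.

Lemma completion_dist_ge (u v : @cauchy_seqs R T) (c : R) N :
  (forall n, (N <= n)%N -> c <= mdist (set_val u n) (set_val v n)) ->
  c <= mdist (completion_class u) (completion_class v).
Proof.
move=> uv; have cD := @completion_dist_cvg (completion_class u) (completion_class v).
have cu := completion_class_seq u; have cv := completion_class_seq v.
have c3 : mdist (completion_seq (completion_class u) n) (set_val u n) +
    (mdist (completion_seq (completion_class v) n) (set_val v n) +
     mdist (completion_seq (completion_class u) n) (completion_seq (completion_class v) n))
    @[n --> \oo] --> 0 + (0 + mdist (completion_class u) (completion_class v)).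
  by apply: cvgD => //; apply: cvgD.
rewrite !add0r in c3; apply: (ler_cvg_to (@cvg_cst R c nat \oo _) c3); exists N => // n /= Nn.
set u' := completion_seq _ n; set v' := completion_seq _ n.
have := metric_triangle (set_val u n) u' (set_val v n); have := metric_triangle u' v' (set_val v n).
by have := uv n Nn; rewrite (metric_sym (set_val u n) u'); lra.
Qed.

Lemma completion_inj_dist (x y : T) :
  mdist (completion_inj x) (completion_inj y) = mdist x y.
Proof.
apply/eqP; rewrite eq_le; apply/andP; split.
  by apply: (@completion_dist_le _ _ _ 0) => n _.
by apply: (@completion_dist_ge _ _ _ 0) => n _.
Qed.

Lemma completion_mcvg (u : nat -> T) : mcauchy u ->
  exists m : M, mcvg (fun n => completion_inj (u n)) m.
Proof.
move=> cu; have /mcauchyP cu' := cu.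
exists (completion_class (exist _ u (mem_set cu'))) => e e0.
have e20 : 0 < e / 2 by rewrite divr_gt0.
have [N NP] := cu _ e20; exists N => n Nn; apply: (@le_lt_trans _ _ (e / 2)); last by lra.
by apply: (@completion_dist_le _ _ _ N) => k Nk; exact/ltW/NP.
Qed.

Lemma completion_dense (m : M) (e : R) : 0 < e ->
  exists x : T, mdist (completion_inj x) m < e.
Proof.
move=> e0; have e20 : 0 < e / 2 by rewrite divr_gt0.
have [N NP] := completion_seq_cauchy m e20.
exists (completion_seq m N); rewrite -{2}(completion_classE m).
apply: (@le_lt_trans _ _ (e / 2)); last by lra.
by apply: (@completion_dist_le _ _ _ N) => k Nk; exact/ltW/NP.
Qed.

(** A Cauchy sequence of classes is shadowed by one of points of [T], whose class is the limit. *)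
Lemma completion_mcomplete : mcomplete M.
Proof.
move=> a ca.
have /choice [x xP] : forall n, exists x, mdist (completion_inj x) (a n) < 2^-1 ^+ n.
  by move=> n; apply: completion_dense; exact: half_pow_gt0.
have small e : 0 < e -> exists N, forall n, (N <= n)%N -> mdist (completion_inj (x n)) (a n) < e.
  move=> e0; have [N NP] := half_pow_small ler01 e0; exists N => n Nn.
  by apply: lt_trans (xP n) _; have := NP n Nn; rewrite mul1r.
have cx : mcauchy x.
  move=> e e0; have e40 : 0 < e / 4 by rewrite divr_gt0.
  have [N NP] := ca _ e40; have [K KP] := small _ e40.
  exists (maxn N K) => m n; rewrite !geq_max => /andP[Nm Km] /andP[Nn Kn].
  rewrite -completion_inj_dist.
  have := NP _ _ Nm Nn; have := KP _ Km; have := KP _ Kn.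
  have := metric_triangle (completion_inj (x m)) (a m) (completion_inj (x n)).
  have := metric_triangle (a m) (a n) (completion_inj (x n)).
  rewrite (metric_sym (a n) (completion_inj _)); lra.
have [b xb] := completion_mcvg cx; exists b => e e0.
have e20 : 0 < e / 2 by rewrite divr_gt0.
have [N NP] := xb _ e20; have [K KP] := small _ e20.
exists (maxn N K) => n; rewrite geq_max => /andP[Nn Kn].
exact: mdist_lt_half (NP n Nn) (KP n Kn).
Qed.

Lemma completion_compact : tot_bounded [set: T] -> compact [set: M].
Proof.
move=> tT; apply: tot_bounded_compact; [exact: completion_mcomplete| |exact: closedT].
move=> e e0; have e20 : 0 < e / 2 by rewrite divr_gt0.
have [s sP] := tT _ e20; exists (map completion_inj s) => m _.
have [x xm] := completion_dense m e20; have [c cs cx] := sP x I.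
exists (completion_inj c); first exact: map_f.
by apply: mdist_lt_half xm; rewrite completion_inj_dist.
Qed.

End completion_theory.

Section mazurkiewicz_theory.
Context {R : realType} {X : metricType R}.
Variable Om : boundedDomain X.
Local Notation T := (mazurkiewicz Om).
Local Notation M := (completion T).
Implicit Types (x y : T) (E : set X).

Definition mz_point z (Oz : domain_set Om z) : T := exist _ z (mem_set Oz).

Lemma mz_in x : domain_set Om (set_val x). Proof. exact: set_valP. Qed.

Lemma mz_le x y E (c : R) : connected E -> E `<=` Om -> E (set_val x) -> E (set_val y) ->
  (forall a b, E a -> E b -> mdist a b <= c) -> mdist x y <= c.
Proof.
move=> cE EO Ex Ey Ec; have c0 : 0 <= c by apply: le_trans (Ec _ _ Ex Ey); exact: mdist_ge0.
have : (ereal_inf [set diam E | E in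
    [set E : set X | [/\ connected E, E `<=` Om, E (set_val x) & E (set_val y)]]] <= c%:E)%E.
  apply: (@le_trans _ _ (diam E)); first by apply: ereal_inf_lbound; exists E.
  by apply: ge_ereal_sup => _ [[a b] [/= Ea Eb] <-]; rewrite lee_fin Ec.
move=> h; change (mazurkiewicz_dist Om (set_val x) (set_val y) <= c); move: h.
(* [fine] sends an infimum [-oo] to 0, which [c0] takes care of. *)
by rewrite /mazurkiewicz_dist; case: (ereal_inf _) => [s||]//=; rewrite ?leNye_eq.
Qed.

Lemma mz_inf_ge x y : ((mdist (set_val x : X) (set_val y))%:E <= ereal_inf [set diam E | E in
    [set E : set X | [/\ connected E, E `<=` Om, E (set_val x) & E (set_val y)]]])%E.
Proof.
apply: le_ereal_inf_tmp => _ [E [_ _ Ex Ey] <-].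
by apply: ereal_sup_ubound; exists (set_val x, set_val y).
Qed.

Lemma mz_inf_fin x y : ereal_inf [set diam E | E in
    [set E : set X | [/\ connected E, E `<=` Om, E (set_val x) & E (set_val y)]]] \is a fin_num.
Proof.
have [_ _ Oc Ob _] := domainP Om.
rewrite fin_numElt; apply/andP; split.
  by apply: lt_le_trans (mz_inf_ge x y); rewrite ltNyr.
apply: (le_lt_trans _ Ob); apply: ereal_inf_lbound.
by exists (Om : set X) => //; split=> //; exact: mz_in.
Qed.

Lemma mz_ge x y : mdist (set_val x : X) (set_val y) <= mdist x y.
Proof.
change (mdist (set_val x : X) (set_val y) <= mazurkiewicz_dist Om (set_val x) (set_val y)).
by rewrite -lee_fin /mazurkiewicz_dist fineK ?mz_inf_fin// mz_inf_ge.
Qed.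

Lemma mz_lt x y (e : R) : mdist x y < e -> exists E, [/\ connected E, E `<=` Om,
  E (set_val x), E (set_val y) & forall a b, E a -> E b -> mdist a b < e].
Proof.
change (mazurkiewicz_dist Om (set_val x) (set_val y) < e -> exists E, [/\ connected E, E `<=` Om,
  E (set_val x), E (set_val y) & forall a b, E a -> E b -> mdist a b < e]).
rewrite -lte_fin /mazurkiewicz_dist fineK ?mz_inf_fin//.
move=> /ereal_inf_lt [_ [E [cE EO Ex Ey] <-] Ee]; exists E; split=> // a b Ea Eb.
rewrite -lte_fin; apply: le_lt_trans Ee.
by apply: ereal_sup_ubound; exists (a, b).
Qed.

(** Together with [mz_lt_component] this trades Mazurkiewicz distances for components of traces of
    balls, up to constants. *)
Lemma mz_component x y z (r : R) :
  connected_component (Om `&` ball z r) (set_val x) (set_val y) -> mdist x y <= 2 * r.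
Proof.
move=> [E [Ex EO cE] Ey]; apply: (mz_le cE _ Ex Ey) => [a /EO []//|a b].
move=> /EO [_ /ballP za] /EO [_ /ballP zb].
have := metric_triangle a z b; rewrite (metric_sym a z); lra.
Qed.

Lemma mz_lt_component x y z (e r : R) : mdist x y < e -> mdist z (set_val x) + e <= r ->
  connected_component (Om `&` ball z r) (set_val x) (set_val y).
Proof.
move=> /mz_lt [E [cE EO Ex Ey Ee]] zr; exists E => //; split=> // a Ea.
split; first exact: EO.
by apply/ballP; have := metric_triangle z (set_val x) a; have := Ee _ _ Ex Ea; lra.
Qed.

(** The inclusion of [Om] in [X] is 1-Lipschitz for the Mazurkiewicz metric, so it extends to the
    completion when [X] is complete; [z] is the image of [m]. *)
Lemma completion_impression (m : M) : mcomplete X ->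
  exists z : X, forall y : T, mdist (set_val y) z <= mdist (completion_inj y) m.
Proof.
move=> cX.
have /choice [x xP] : forall n, exists x, mdist (completion_inj x) m < 2^-1 ^+ n.
  by move=> n; apply: completion_dense; exact: half_pow_gt0.
have xx n : mdist (set_val (x n) : X) (set_val (x n.+1)) <= 2 * 2^-1 ^+ n.
  apply: le_trans (mz_ge _ _) _; rewrite -completion_inj_dist.
  have := metric_triangle (completion_inj (x n)) m (completion_inj (x n.+1)).
  have := xP n; have := xP n.+1; have := half_pow_gt0 (R := R) n.
  by rewrite (metric_sym m) exprS; lra.
have [z zP] := geometric_lim cX (ler0n R 2) xx.
exists z => y; apply/ler_addgt0Pr => e e0.
have [N NP] := half_pow_small (ler0n R 5) e0; have {}NP := NP N (leqnn N).
have := metric_triangle (set_val y) (set_val (x N)) z.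
have := mz_ge y (x N); rewrite -(completion_inj_dist y).
have := metric_triangle (completion_inj y) m (completion_inj (x N)).
have := zP N; have := xP N; rewrite (metric_sym z) (metric_sym m); lra.
Qed.

Lemma mz_tot_bounded (L : R) : 0 < L -> loc_path_connected X L ->
  almost_john_domain Om -> (forall (z : X) (r : R), tot_bounded (ball z r)) ->
  tot_bounded [set: T].
Proof.
move=> L0 lpc aj tB e e0; have [Ox oO cO bO _] := domainP Om.
have r0 : 0 < e / 4 by rewrite divr_gt0.
(* Half of the radius [e / 4], because [almost_john_joined] serves the points of the concentric half
   ball. *)
have [s0 sP0] : net_covered Om (e / 4 / 2).
  have [x0 Ox0] := Ox.
  have [D OD] : exists D : R, forall y : X, domain_set Om y -> mdist x0 y < D.
    have le (y : X) : domain_set Om y -> ((mdist x0 y)%:E <= diam Om)%E.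
      by move=> Oy; apply: ereal_sup_ubound; exists (x0, y).
    move: bO le; rewrite /metric_bounded; case: (diam Om) => [D _ le||_ le] //.
      exists (D + 1) => y /le; rewrite lee_fin => h; apply: le_lt_trans h _; lra.
    by have := le x0 Ox0; rewrite leeNy_eq.
  have [s sP] := tB x0 D (e / 4 / 2) (divr_gt0 r0 (ltr0n _ 2)).
  by exists s => y /OD /ballP/sP.
have /choice [f fP] := fun c => almost_john_joined L0 lpc aj r0 (tB c (e / 4)).
have fO z : z \in flatten (map f s0) -> domain_set Om z.
  by move=> /flattenP [_ /mapP[c _ ->]]; have [H _] := fP c; exact: H.
(* Points of [T] carry a proof of membership; every point of this list has one, so [pmap] discards
   nothing. *)
exists (pmap (fun z => if pselect (domain_set Om z) is left Oz then Some (mz_point Oz) else None)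
  (flatten (map f s0))) => y _.
have [c cs cy] := sP0 _ (mz_in y).
have [_ /(_ _ (mz_in y) cy) [z zs yz]] := fP c.
have zf : z \in flatten (map f s0) by apply/flattenP; exists (f c) => //; exact: map_f.
have Oz := fO _ zf; exists (mz_point Oz); last first.
  have := @mz_component y (mz_point Oz) c (e / 4) yz.
  have -> : (2 * (e / 4) = e / 2) by lra.
  by rewrite metric_sym => /le_lt_trans; apply; lra.
rewrite mem_pmap; apply/mapP; exists z => //.
by case: pselect => // Oz'; congr (Some (exist _ _ _)); exact: Prop_irrelevance.
Qed.

End mazurkiewicz_theory.

Lemma nbhs_mdistP_cvg (R : realType) (X : metricType R) (u : nat -> X) (x : X) :
  (u n @[n --> \oo] --> x) <-> mcvg u x.
Proof.
split=> [ux e e0|ux B /nbhs_mdistP [e e0 eB]].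
  have : nbhs x [set y | mdist x y < e] by apply/nbhs_mdistP; exists e.
  by move=> /ux [N _ NP]; exists N => n Nn; exact: NP.
by have [N NP] := ux e e0; exists N => // n Nn; apply: eB; exact: NP.
Qed.

(** * Ends and prime ends *)

Section chain_basics.
Context {R : realType} {X : metricType R}.
Variable Om : set X.
Implicit Types (E F G : nat -> set X) (e f : set (nat -> set X)).

Lemma chain_antitone E k l : chain Om E -> (k <= l)%N -> E l `<=` E k.
Proof.
move=> [_ sub _ _] /subnK <-; elim: (l - k)%N => [|n IH] //=.
by rewrite addSn; apply: subset_trans IH; exact: sub.
Qed.

Lemma chain_divides_refl E : chain_divides E E.
Proof. by move=> k; exists k. Qed.

Lemma chain_divides_trans E F G :
  chain_divides E F -> chain_divides F G -> chain_divides E G.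
Proof.
move=> EF FG k; have [l lk] := FG k; have [j jl] := EF l.
by exists j; exact: subset_trans jl lk.
Qed.

Lemma chain_class_self E : chain Om E -> chain_class Om E E.
Proof. by split=> //; exact: chain_divides_refl. Qed.

Lemma chain_class_eq E F : chain_divides E F -> chain_divides F E ->
  chain_class Om E = chain_class Om F.
Proof.
move=> EF FE; apply/seteqP; split=> G [cG h1 h2]; split=> //.
- exact: chain_divides_trans FE h1.
- exact: chain_divides_trans h2 EF.
- exact: chain_divides_trans EF h1.
- exact: chain_divides_trans h2 FE.
Qed.

Lemma ends_class E : chain Om E -> ends Om (chain_class Om E).
Proof. by move=> cE; exists E. Qed.

Lemma end_divides_class E F : chain Om E -> chain Om F ->
  end_divides (chain_class Om E) (chain_class Om F) <-> chain_divides E F.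
Proof.
move=> cE cF; split=> [[E' [F' [[_ EE' _] [_ _ F'F] E'F']]]|EF].
  exact: chain_divides_trans EE' (chain_divides_trans E'F' F'F).
by exists E, F; split=> //; exact: chain_class_self.
Qed.

Lemma impression_divides E F : chain_divides E F -> impression E `<=` impression F.
Proof. by move=> EF x Ex k _; have [l lk] := EF k; exact: closureS lk _ (Ex l I). Qed.

Lemma connected_meets_boundary (A B : set X) x y : connected B -> B x -> B y ->
  A x -> ~ A y -> exists2 z, B z & boundary A z.
Proof.
move=> cB Bx By Ax nAy; apply: contrapT => /forall2NP nb; apply: nAy.
have inA z : B z -> closure A z -> A° z.
  by move=> Bz cz; apply: contrapT => nz; case: (nb z) => //; apply; split.
suff : B `&` A° = B by move=> BE; move: By; rewrite -BE => -[_ /interior_subset].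
apply: cB.
- by exists x; split=> //; apply: inA => //; exact: subset_closure.
- by exists A° => //; exact: open_interior.
- exists (closure A); first exact: closed_closure.
  apply/seteqP; split=> z [Bz Az]; split=> //; last exact: inA.
  exact: subset_closure (interior_subset Az).
Qed.

End chain_basics.

(** * Prime ends as boundary points of the completion *)

Section prime_ends.
Context {R : realType} {X : metricType R}.
Variables (Om : boundedDomain X) (L : R).
Hypotheses (L0 : 0 < L) (lpc : loc_path_connected X L).
Local Notation T := (set_type Om).

(* All that is used of the Mazurkiewicz completion [M]; keeping [M] abstract
   prevents conversion from unfolding the quotient and the infimum. *)
Variables (M : metricType R) (inj : T -> M).
Hypotheses
  (inj_limit : forall m, exists z : X, forall y, mdist (set_val y) z <= mdist (inj y) m)
  (inj_component : forall y y' (z : X) (r : R),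
    connected_component (Om `&` ball z r) (set_val y) (set_val y') ->
    mdist (inj y) (inj y') <= 2 * r)
  (inj_lt_component : forall y y' (z : X) (e r : R), mdist (inj y) (inj y') < e ->
    mdist z (set_val y) + e <= r ->
    connected_component (Om `&` ball z r) (set_val y) (set_val y'))
  (inj_dense : forall m (e : R), 0 < e -> exists y, mdist (inj y) m < e)
  (mz_compact : compact [set: M]).
Implicit Types (m : M) (y : T) (F : nat -> set X).

Let Om_val y : domain_set Om (set_val y). Proof. exact: set_valP. Qed.

Let dom_point z (Oz : domain_set Om z) : T := exist _ z (mem_set Oz).

Let oO : open Om. Proof. by have [] := domainP Om. Qed.
Let cO : connected Om. Proof. by have [] := domainP Om. Qed.

Lemma domain_boundaryP x : boundary Om x <-> closure Om x /\ ~ domain_set Om x.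
Proof. by rewrite /boundary (proj1 (interior_id _) oO). Qed.

Definition mz_limit m : X := sval (cid (inj_limit m)).

Lemma mz_limitP m y : mdist (set_val y) (mz_limit m) <= mdist (inj y) m.
Proof. by rewrite /mz_limit; case: cid. Qed.

Lemma mz_limit_inj y : mz_limit (inj y) = set_val y.
Proof.
apply/esym/mdist_positivity/eqP; rewrite eq_le mdist_ge0 andbT.
by apply: le_trans (mz_limitP _ _) _; rewrite mdistxx.
Qed.

Lemma mz_inj_ge y y' : mdist (set_val y : X) (set_val y') <= mdist (inj y) (inj y').
Proof. by rewrite -(mz_limit_inj y'); exact: mz_limitP. Qed.

(** Local path connectedness gives the converse of [mz_inj_ge] near a point of [Om]: both metrics
    induce the same topology there. *)
Lemma mz_near y (e : R) : 0 < e ->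
  exists2 d : R, 0 < d & forall y', mdist (set_val y : X) (set_val y') < d -> mdist (inj y) (inj y') < e.
Proof.
move=> e0; have e40 : 0 < e / 4 by rewrite divr_gt0.
have oU : open (Om `&` ball (set_val y) (e / 4)).
  by apply: openI => //; exact: open_mball.
have Uy : (Om `&` ball (set_val y) (e / 4)) (set_val y).
  by split; [exact: mz_in|apply/ballP; rewrite mdistxx].
have [d d0 dP] := lpc_ball L0 lpc oU Uy; exists d => // y' /dP/path_in_component yy'.
by apply: le_lt_trans (inj_component yy') _; lra.
Qed.

(** Points [y] with [inj y] close to [m] are close in [X] to the limit of [m], hence, by [mz_near],
    have images close to that of the limit. *)
Lemma mz_limit_interior m (Oz : domain_set Om (mz_limit m)) : m = inj (dom_point Oz).
Proof.
apply/eqP; apply: contrapT => /negP; rewrite -mdist_gt0.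
set z := dom_point Oz; move=> mz.
have e0 : 0 < mdist m (inj z) / 2 by rewrite divr_gt0.
have [d d0 dP] := mz_near z e0.
have [|y] := inj_dense m (e := Num.min d (mdist m (inj z) / 2)).
  by rewrite lt_min d0.
rewrite lt_min => /andP[yd ye].
have := dP y; rewrite metric_sym => /(_ (le_lt_trans (mz_limitP m y) yd)) zy.
have := metric_triangle m (inj y) (inj z).
by rewrite (metric_sym m (inj y)) (metric_sym (inj y) (inj z)); lra.
Qed.

Definition mz_boundary m := ~ domain_set Om (mz_limit m).

Lemma mz_boundaryNinj m y : mz_boundary m -> m <> inj y.
Proof. by move=> bm my; apply: bm; rewrite my mz_limit_inj; exact: set_valP. Qed.

Lemma mz_inj_boundaryP m : mz_boundary m \/ exists y, m = inj y.
Proof.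
have [Oz|] := pselect (domain_set Om (mz_limit m)); [right|by left].
by exists (dom_point Oz); exact: mz_limit_interior.
Qed.

Lemma mz_limit_closure m : closure Om (mz_limit m).
Proof.
apply/closure_mdistP => e e0; have [y ym] := inj_dense m e0.
exists (set_val y); first exact: set_valP.
by rewrite metric_sym; apply: le_lt_trans (mz_limitP _ _) ym.
Qed.

Lemma mz_limit_boundary m : mz_boundary m -> boundary Om (mz_limit m).
Proof. by move=> bm; apply/domain_boundaryP; split=> //; exact: mz_limit_closure. Qed.

(* The bound [r / 4] makes the component independent of the choice of [y]. *)
Definition mz_nbhd m (r : R) : set X := [set w | exists2 y, mdist (inj y) m < r / 4 &
  connected_component (Om `&` ball (mz_limit m) r) (set_val y) w].

Lemma mz_nbhd_sub m r : mz_nbhd m r `<=` Om `&` ball (mz_limit m) r.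
Proof. by move=> w [y _ /connected_component_sub]. Qed.

Lemma mz_nbhd_mono m r r' : r <= r' -> mz_nbhd m r `<=` mz_nbhd m r'.
Proof.
move=> rr w [y ym [E [Ey EO cE] Ew]]; exists y; first by lra.
exists E => //; split=> // z /EO [Oz /ballP mz]; split=> //; apply/ballP; lra.
Qed.

Lemma mz_close_component m r y y' : 0 < r -> mdist (inj y) m < r / 4 -> mdist (inj y') m < r / 4 ->
  connected_component (Om `&` ball (mz_limit m) r) (set_val y) (set_val y').
Proof.
move=> r0 ym y'm; apply: (@inj_lt_component _ _ _ (r / 2)).
  have := metric_triangle (inj y) m (inj y').
  by rewrite (metric_sym m); lra.
by have := mz_limitP m y; rewrite metric_sym; lra.
Qed.

Lemma mz_nbhdE m r y : 0 < r -> mdist (inj y) m < r / 4 ->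
  mz_nbhd m r = connected_component (Om `&` ball (mz_limit m) r) (set_val y).
Proof.
move=> r0 ym; apply/seteqP; split=> w; last by exists y.
move=> [y' y'm]; apply: connected_component_trans.
exact: mz_close_component.
Qed.

Lemma mz_nbhd_mem m r y : 0 < r -> mdist (inj y) m < r / 4 -> mz_nbhd m r (set_val y).
Proof. by move=> r0 ym; exists y => //; exact: mz_close_component. Qed.

Lemma mz_nbhd_connected m r : 0 < r -> connected (mz_nbhd m r).
Proof.
move=> r0; have [|y ym] := inj_dense m (e := r / 4); first by rewrite divr_gt0.
by rewrite (mz_nbhdE r0 ym); exact: component_connected.
Qed.

Lemma mz_nbhd_open m r : 0 < r -> open (mz_nbhd m r).
Proof.
move=> r0; have [|y ym] := inj_dense m (e := r / 4); first by rewrite divr_gt0.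
rewrite (mz_nbhdE r0 ym); apply: (component_open L0 lpc).
by apply: openI => //; exact: open_mball.
Qed.

(** A component of the trace of a ball is open and relatively closed in that trace, so its boundary
    inside [Om] can only lie on the sphere. Different radii then give relative boundaries at a
    positive distance. *)
Lemma mz_nbhd_boundary m r w : 0 < r -> domain_set Om w -> boundary (mz_nbhd m r) w ->
  mdist (mz_limit m) w = r.
Proof.
move=> r0 Ow [cw nw]; apply/eqP; rewrite eq_le; apply/andP; split.
  apply/ler_addgt0Pr => e e0; have [z /mz_nbhd_sub [_ /ballP mz] wz] := (closure_mdistP _ _).1 cw e e0.
  by have := metric_triangle (mz_limit m) z w; rewrite (metric_sym z); lra.
rewrite leNgt; apply/negP => mw; apply: nw.
rewrite (proj1 (interior_id _) (mz_nbhd_open m r0)).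
have [|y ym] := inj_dense m (e := r / 4); first by rewrite divr_gt0.
rewrite (mz_nbhdE r0 ym) in cw *; apply: (component_rel_closed L0 lpc) => //.
  by apply: openI => //; exact: open_mball.
by split=> //; exact/ballP.
Qed.

Lemma mz_nbhd_dist m r y : 0 < r -> mz_nbhd m r (set_val y) -> mdist (inj y) m <= 3 * r.
Proof.
move=> r0 [y' y'm /inj_component yy'].
by have := metric_triangle (inj y) (inj y') m; rewrite (metric_sym (inj y) (inj y')); lra.
Qed.

Let z0 : X := sval (cid (let: And5 h _ _ _ _ := domainP Om in h)).
Let Oz0 : domain_set Om z0. Proof. by rewrite /z0; case: cid. Qed.

(** Starting from the distance to the fixed point [z0] of [Om] keeps [z0] out of all the balls, so
    that no set of the chain is [Om] itself. *)
Definition mz_radius m k : R := mdist (mz_limit m) z0 * 2^-1 ^+ k.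

Lemma mz_radius_gt0 m k : mz_boundary m -> 0 < mz_radius m k.
Proof.
move=> bm; rewrite mulr_gt0 ?half_pow_gt0// mdist_gt0.
by apply/eqP => mz; apply: bm; rewrite mz; exact: Oz0.
Qed.

Lemma mz_radiusS m k : mz_radius m k.+1 = mz_radius m k / 2.
Proof. by rewrite /mz_radius exprSr mulrA. Qed.

Lemma mz_radius_small m (e : R) : 0 < e -> exists k, mz_radius m k < e.
Proof.
by move=> e0; have [N NP] := half_pow_small (mdist_ge0 (mz_limit m) z0) e0; exists N; exact: NP.
Qed.

Definition mz_chain m k : set X := mz_nbhd m (mz_radius m k).

Lemma mz_chain_closure m k : mz_boundary m -> closure (mz_chain m k) (mz_limit m).
Proof.
move=> bm; have r0 := mz_radius_gt0 k bm; apply/closure_mdistP => e e0.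
have [|y] := inj_dense m (e := Num.min e (mz_radius m k / 4)).
  by rewrite lt_min e0 divr_gt0.
rewrite lt_min => /andP[ye yr]; exists (set_val y); first exact: mz_nbhd_mem.
by rewrite metric_sym; apply: le_lt_trans (mz_limitP _ _) ye.
Qed.

Lemma mz_chain_impression m : mz_boundary m -> impression (mz_chain m) = [set mz_limit m].
Proof.
move=> bm; apply/seteqP; split=> [x xI|_ -> k _]; last exact: mz_chain_closure.
apply/eqP; apply: contrapT => /negP; rewrite -mdist_gt0 => xm.
have [k kr] := mz_radius_small m (divr_gt0 xm (ltr0n R 2)).
have [z /mz_nbhd_sub [_ /ballP mz] xz] := (closure_mdistP _ _).1 (xI k I) _ (divr_gt0 xm (ltr0n R 2)).
have := metric_triangle x z (mz_limit m); rewrite (metric_sym z); lra.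
Qed.

Lemma mz_chainP m : mz_boundary m -> chain Om (mz_chain m).
Proof.
move=> bm; split.
- move=> k; have r0 := mz_radius_gt0 k bm; split.
  + by move=> w /mz_nbhd_sub [].
  + move=> E; have /mz_nbhd_sub [_ /ballP] : mz_chain m k z0 by rewrite E.
    apply/negP; rewrite -leNgt /mz_radius ler_piMr ?mdist_ge0// exprn_ile1// ?invr_ge0// invf_le1 ?ler1n//.
  + suff : (diam (mz_chain m k) <= (2 * mz_radius m k)%:E)%E by move/le_lt_trans; apply; exact: ltry.
    apply: ge_ereal_sup => _ [[a b] [/= /mz_nbhd_sub [_ /ballP ma] /mz_nbhd_sub [_ /ballP mb]] <-].
    have := metric_triangle a (mz_limit m) b; rewrite lee_fin (metric_sym a (mz_limit m)); lra.
  + exact: mz_nbhd_connected.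
  + by exists (mz_limit m); split; [exact: mz_chain_closure|exact: mz_limit_boundary].
- move=> k; apply: mz_nbhd_mono; rewrite mz_radiusS.
  by have := mz_radius_gt0 k bm; lra.
(* The relative boundaries lie on spheres whose radii differ by a factor 2; the difference equals
   the smaller radius. *)
- move=> k; have r0 := mz_radius_gt0 k.+1 bm; have rS := mz_radiusS m k.
  apply: (@lt_le_trans _ _ (mz_radius m k.+1)%:E) => //.
  apply: le_ereal_inf_tmp => _ [[a b] [/= [Oa ba] [Ob bb]] <-]; rewrite lee_fin.
  have r0' := mz_radius_gt0 k bm.
  have := mz_nbhd_boundary r0 Oa ba; have := mz_nbhd_boundary r0' Ob bb.
  by have := metric_triangle (mz_limit m) a b; lra.
- by rewrite mz_chain_impression// => _ ->; exact: mz_limit_boundary.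
Qed.

(** Says that [m] belongs to the impression of [F] computed in [M] instead of [X]. *)
Definition chain_near F m := forall k (e : R), 0 < e ->
  exists2 y, F k (set_val y) & mdist (inj y) m < e.

Lemma chain_near_boundary F m : chain Om F -> chain_near F m -> mz_boundary m.
Proof.
move=> [_ _ _ iF] nF; suff /iF /domain_boundaryP [] : impression F (mz_limit m) by [].
move=> k _; apply/closure_mdistP => e e0; have [y Fy ym] := nF k e e0.
exists (set_val y) => //; rewrite metric_sym; exact: le_lt_trans (mz_limitP _ _) ym.
Qed.

(* A connected set meeting [F k.+1] but not contained in [F k] meets both
   relative boundaries, hence is not small. *)
Lemma chain_near_divides F m : chain Om F -> chain_near F m -> chain_divides (mz_chain m) F.
Proof.
move=> cF nF k; have bm := chain_near_boundary cF nF.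
have [_ sF dF _] := cF.
have [d d0 dP] : exists2 d : R, 0 < d & forall a b, (Om `&` boundary (F k.+1)) a ->
    (Om `&` boundary (F k)) b -> d <= mdist a b.
  have le a b : (Om `&` boundary (F k.+1)) a -> (Om `&` boundary (F k)) b ->
      (set_dist (Om `&` boundary (F k.+1)) (Om `&` boundary (F k)) <= (mdist a b)%:E)%E.
    by move=> ha hb; apply: ereal_inf_lbound; exists (a, b).
  move: (dF k) le; case: (set_dist _ _) => [d||]// d0 le.
    by exists d => // a b ha hb; have := le a b ha hb; rewrite lee_fin.
  by exists 1 => // a b ha hb; have := le a b ha hb; rewrite leye_eq.
have [l lr] := mz_radius_small m (divr_gt0 d0 (ltr0n R 2)).
have r0 := mz_radius_gt0 l bm.
exists l => w mw; apply: contrapT => nFw.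
have [y Fy ym] := nF k.+1 _ (divr_gt0 r0 (ltr0n R 4)).
have my : mz_chain m l (set_val y) by exact: mz_nbhd_mem.
have cm := @mz_nbhd_connected m _ r0.
have [a ma ba] := connected_meets_boundary cm my mw (sF k _ Fy) nFw.
have nFw' : ~ F k.+1 w by move/(sF k).
have [b mb bb] := connected_meets_boundary cm my mw Fy nFw'.
have [Oa /ballP ma'] := mz_nbhd_sub ma; have [Ob /ballP mb'] := mz_nbhd_sub mb.
have := dP b a (conj Ob bb) (conj Oa ba).
by have := metric_triangle b (mz_limit m) a; rewrite (metric_sym b (mz_limit m)); lra.
Qed.

Lemma chain_divides_near F m : mz_boundary m -> chain_divides (mz_chain m) F -> chain_near F m.
Proof.
move=> bm dF k e e0; have [l lF] := dF k; have r0 := mz_radius_gt0 l bm.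
have [|y] := inj_dense m (e := Num.min e (mz_radius m l / 4)).
  by rewrite lt_min e0 divr_gt0.
by rewrite lt_min => /andP[ye yr]; exists y => //; apply: lF; exact: mz_nbhd_mem.
Qed.

Lemma chain_nearby F : chain Om F -> exists m, chain_near F m.
Proof.
move=> cF; have [aF _ _ _] := cF.
have /choice [y yP] : forall k, exists y : T, F k (set_val y).
  move=> k; have [FO _ _ _ [x [cx _]]] := aF k.
  by have [z Fz _] := (closure_mdistP _ _).1 cx 1 ltr01; exists (dom_point (FO _ Fz)).
have [m _ mP] := compact_seq_cluster mz_compact (u := fun k => inj (y k)) (fun=> I).
exists m => k e e0; have [n kn mn] := mP e k e0.
by exists (y n); [exact: (chain_antitone cF kn (yP n))|rewrite metric_sym].
Qed.

(** By [mz_nbhd_dist] the sets of the chain of [m'] shrink to [m'] in [M], whereas in [X] several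
    boundary points may share their limit. *)
Lemma mz_chain_near_eq m m' : mz_boundary m' -> chain_near (mz_chain m') m -> m = m'.
Proof.
move=> bm' nm; apply/eqP; apply: contrapT => /negP; rewrite -mdist_gt0 => mm.
have [k kr] := mz_radius_small m' (divr_gt0 mm (ltr0n R 6)).
have [y /mz_nbhd_dist ym' ym] := nm k _ (divr_gt0 mm (ltr0n R 2)).
have := ym' (mz_radius_gt0 k bm'); have := metric_triangle m (inj y) m'.
by rewrite (metric_sym m (inj y)); lra.
Qed.

Lemma mz_chain_inj m m' : mz_boundary m -> mz_boundary m' ->
  chain_class Om (mz_chain m) = chain_class Om (mz_chain m') -> m = m'.
Proof.
move=> bm bm' E.
have : chain_class Om (mz_chain m) (mz_chain m').
  by rewrite E; exact: (chain_class_self (mz_chainP bm')).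
by case=> _ d _; exact: (mz_chain_near_eq bm' (chain_divides_near bm d)).
Qed.

(** If [F] divides the chain of [m], compactness gives an [m'] near [F]. The chain of [m'] divides
    [F], hence that of [m], which forces [m' = m] and closes the circle. *)
Lemma mz_chain_prime m : mz_boundary m -> prime_ends Om (chain_class Om (mz_chain m)).
Proof.
move=> bm; have cm := mz_chainP bm; split; first exact: ends_class.
move=> _ [F cF <-] /(end_divides_class cF cm) Fm.
have [m' nm'] := chain_nearby cF.
have bm' := chain_near_boundary cF nm'; have m'F := chain_near_divides cF nm'.
have mm : m' = m.
  by apply: mz_chain_near_eq bm _; apply: chain_divides_near => //; exact: chain_divides_trans m'F Fm.
by apply: chain_class_eq Fm _; rewrite -mm.
Qed.

Lemma prime_end_mz_chain e : prime_ends Om e ->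
  exists2 m, mz_boundary m & e = chain_class Om (mz_chain m).
Proof.
move=> [[F cF <-] pe]; have [m nm] := chain_nearby cF.
have bm := chain_near_boundary cF nm; exists m => //.
apply/esym/pe; first exact/ends_class/mz_chainP.
by apply/end_divides_class => //; [exact: mz_chainP|exact: chain_near_divides].
Qed.

Lemma mz_end_impression m : mz_boundary m ->
  end_impression (chain_class Om (mz_chain m)) = [set mz_limit m].
Proof.
move=> bm; rewrite -mz_chain_impression//; apply/seteqP; split=> x.
  by move=> [F [_ _ Fm] xF]; exact: impression_divides Fm _ xF.
by move=> xm; exists (mz_chain m) => //; exact/chain_class_self/mz_chainP.
Qed.

Lemma end_divisible_by_prime e : ends Om e -> exists2 f, prime_ends Om f & end_divides f e.
Proof.
move=> [F cF <-]; have [m nm] := chain_nearby cF; have bm := chain_near_boundary cF nm.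
exists (chain_class Om (mz_chain m)); first exact: mz_chain_prime.
by apply/end_divides_class => //; [exact: mz_chainP|exact: chain_near_divides].
Qed.

(** Points of [Om] tending to [x] have a cluster point in the compact space [M], and its limit in
    [X] can only be [x]. *)
Lemma mz_limit_surj x : boundary Om x -> exists2 m, mz_boundary m & mz_limit m = x.
Proof.
move=> /domain_boundaryP [cx nOx].
have /choice [y yP] : forall n, exists y : T, mdist x (set_val y) < 2^-1 ^+ n.
  move=> n; have [z Oz xz] := (closure_mdistP _ _).1 cx _ (half_pow_gt0 n).
  by exists (dom_point Oz).
have [m _ mP] := compact_seq_cluster mz_compact (u := fun k => inj (y k)) (fun=> I).
suff mx : mz_limit m = x by exists m => //; rewrite /mz_boundary mx.
apply/eqP; apply: contrapT => /negP; rewrite -mdist_gt0 => mx.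
have e0 : 0 < mdist (mz_limit m) x / 2 by rewrite divr_gt0.
have [N NP] := half_pow_small ler01 e0; have [n Nn mn] := mP _ N e0.
have := NP n Nn; have := yP n; have := mz_limitP m (y n).
have := metric_triangle (mz_limit m) (set_val (y n)) x.
rewrite metric_sym in mn; rewrite (metric_sym x) (metric_sym (mz_limit m) (set_val _)); lra.
Qed.

(** Points tending to [m] in [M] are chosen in the successive sets of the chain; consecutive ones
    are joined inside an open connected set of the chain, and the paths are glued. *)
Lemma mz_limit_accessible m : mz_boundary m -> accessible Om (mz_limit m).
Proof.
move=> bm; have /choice [y yP] : forall k, exists y : T, mdist (inj y) m < mz_radius m k / 4.
  by move=> k; apply: inj_dense; rewrite divr_gt0// mz_radius_gt0.
apply: (@accessible_glue _ _ _ _ (fun k => set_val (y k)) (mdist (mz_limit m) z0)).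
  exact: mdist_ge0.
move=> k; have r0 := mz_radius_gt0 k bm; have r0' := mz_radius_gt0 k.+1 bm.
apply: (@path_in_sub _ _ (mz_chain m k)); first exact: mz_nbhd_sub.
apply: (connected_open_path L0 lpc).
- exact: mz_nbhd_open.
- exact: mz_nbhd_connected.
- exact: mz_nbhd_mem.
- by apply: (@mz_nbhd_mono _ (mz_radius m k.+1)); [rewrite mz_radiusS; lra|exact: mz_nbhd_mem].
Qed.

Lemma mz_limit_lipschitz m m' : mdist (mz_limit m) (mz_limit m') <= mdist m m'.
Proof.
apply/ler_addgt0Pr => e e0; have [y ym] := inj_dense m (divr_gt0 e0 (ltr0n R 2)).
have := metric_triangle (mz_limit m) (set_val y) (mz_limit m').
have := mz_limitP m y; have := mz_limitP m' y; have := metric_triangle (inj y) m m'.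
rewrite (metric_sym (mz_limit m) (set_val y)); lra.
Qed.

Definition prime_end_of m (bm : mz_boundary m) : ends Om :=
  exist _ (chain_class Om (mz_chain m)) (mem_set (ends_class (mz_chainP bm))).

Lemma mz_interior_ex m : ~ mz_boundary m -> exists y, m = inj y.
Proof. by case: (mz_inj_boundaryP m). Qed.

Definition end_of_mz m : end_space Om :=
  match pselect (mz_boundary m) with
  | left bm => inr (prime_end_of bm)
  | right nb => inl (sval (cid (mz_interior_ex nb)))
  end.

Lemma mz_inj_injective : injective inj.
Proof.
by move=> y y' yy; apply: val_inj; rewrite -[LHS]mz_limit_inj yy; exact: mz_limit_inj.
Qed.

Lemma end_of_mz_inj y : end_of_mz (inj y) = inl y.
Proof.
rewrite /end_of_mz; case: pselect => [bm|nb]; first by have := mz_boundaryNinj bm erefl.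
by case: cid => y' /= /mz_inj_injective ->.
Qed.

Lemma end_of_mz_boundary m (bm : mz_boundary m) : end_of_mz m = inr (prime_end_of bm).
Proof.
rewrite /end_of_mz; case: pselect => [bm'|//].
by rewrite (Prop_irrelevance bm bm').
Qed.


Lemma end_of_mz_prime m : prime_end_closure Om (end_of_mz m).
Proof.
have [bm|[y ->]] := mz_inj_boundaryP m; last by rewrite end_of_mz_inj.
by rewrite (end_of_mz_boundary bm); exact: mz_chain_prime.
Qed.

Lemma end_of_mz_injective : injective end_of_mz.
Proof.
move=> m m' mm'; have [bm|[y my]] := mz_inj_boundaryP m;
  have [bm'|[y' my']] := mz_inj_boundaryP m'; move: mm'.
- rewrite (end_of_mz_boundary bm) (end_of_mz_boundary bm') => H.
  have E : prime_end_of bm = prime_end_of bm' by exact: inr_inj H.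
  exact: (mz_chain_inj bm bm' (congr1 set_val E)).
- by rewrite (end_of_mz_boundary bm) my' end_of_mz_inj.
- by rewrite (end_of_mz_boundary bm') my end_of_mz_inj.
- by rewrite my my' !end_of_mz_inj => H; congr inj; exact: inl_inj H.
Qed.

Lemma end_of_mz_surj z : prime_end_closure Om z -> exists m, end_of_mz m = z.
Proof.
case: z => [y _|e]; first by exists (inj y); exact: end_of_mz_inj.
move=> /prime_end_mz_chain [m bm em]; exists m.
by rewrite (end_of_mz_boundary bm); congr inr; apply: val_inj; exact: esym em.
Qed.

Lemma end_space_open (O : set (end_space Om)) : open O <-> seq_closed Om (~` O).
Proof. by []. Qed.

(** A failure at [m] gives points tending to [m] whose images avoid the open set. Since [seq_limit]
    knows no mixed sequences, they are taken all in [Om] or all in the boundary, and either kind is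
    shown to converge to the image of [m]. *)
Lemma end_of_mz_continuous : continuous end_of_mz.
Proof.
apply/continuousP => O /end_space_open oO'; apply/open_mdistP => m Om_m.
apply: contrapT => nO.
have far (e : R) : 0 < e -> exists m', mdist m m' < e /\ ~ O (end_of_mz m').
  move=> e0; apply: contrapT => nm; apply: nO; exists e; first exact: e0.
  move=> m' mm'.
  apply: contrapT => nOm'.
  by apply: nm; exists m'.
have seqP : (forall e : R, 0 < e -> exists y, mdist m (inj y) < e /\ ~ O (inl y)) ->
    exists v : nat -> T, (forall n, ~ O (inl (v n))) /\ forall e : R, 0 < e ->
      exists N, forall n, (N <= n)%N -> mdist m (inj (v n)) < e.
  move=> H; have /choice [v vP] := fun n => H _ (half_pow_gt0 n).
  exists v; split=> [n|e e0]; first by have [] := vP n.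
  have [N NP] := half_pow_small ler01 e0; exists N => n Nn.
  by have [+ _] := vP n; move/lt_trans; apply; rewrite -[ltLHS]mul1r; exact: NP.
have [bm|[y my]] := mz_inj_boundaryP m; last first.
  have [d d0 dP] := (open_mdistP _).1 oO _ (Om_val y).
  have [|v [vO vm]] := seqP.
    move=> e e0; have [|m'] := far (Num.min d e); first by rewrite lt_min d0.
    rewrite lt_min => -[/andP[md me] nOm'].
    have im' : domain_set Om (mz_limit m').
      apply: dP; apply: le_lt_trans md.
      by rewrite -(mz_limit_inj y) -my; exact: mz_limit_lipschitz.
    have m'E := mz_limit_interior im'.
    have me' : mdist m (inj (dom_point im')) < e by rewrite -m'E; exact: me.
    exists (dom_point im'); apply: (conj me').
    by rewrite -(end_of_mz_inj (dom_point im')) -m'E; exact: nOm'.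
  move: Om_m; rewrite /= my end_of_mz_inj; apply: (oO' (inl \o v)) => //.
  exists v => //; apply/nbhs_mdistP_cvg => e e0.
  have [N NP] := vm e e0; exists N => n Nn.
  by apply: le_lt_trans (mz_inj_ge _ _) _; rewrite -my; exact: NP.
have divm E k : chain_class Om (mz_chain m) E -> exists r, 0 < r /\
    forall y, mdist (inj y) m < r -> E k (set_val y).
  move=> [_ mE _]; have [l lE] := mE k; have r0 := mz_radius_gt0 l bm.
  exists (mz_radius m l / 4); split=> [|y ym]; first by rewrite divr_gt0.
  by apply: lE; exact: mz_nbhd_mem.
have [/seqP [v [vO vm]]|/existsNP [d /not_implyP [d0 dP]]] :=
    pselect (forall e : R, 0 < e -> exists y, mdist m (inj y) < e /\ ~ O (inl y)).
  move: Om_m; rewrite /= (end_of_mz_boundary bm); apply: (oO' (inl \o v)) => //.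
  left; exists v => // E eE k; have [r [r0 rP]] := divm E k eE.
  have [N NP] := vm r r0; exists N => n Nn.
  by apply: rP; rewrite metric_sym; exact: NP.
(* Within [d] of [m] no point of [Om] avoids [O], so all the points found there are boundary
   points. *)
have /choice [w wP] : forall n, exists w : {m' | mz_boundary m'},
    mdist m (sval w) < 2^-1 ^+ n /\ ~ O (end_of_mz (sval w)).
  move=> n; have [|m'] := far (Num.min d (2^-1 ^+ n)); first by rewrite lt_min d0 half_pow_gt0.
  rewrite lt_min => -[/andP[md me] nOm'].
  have [bm'|[y m'y]] := mz_inj_boundaryP m'; first by exists (exist _ m' bm'); exact: conj me nOm'.
  exfalso; apply: dP; rewrite m'y in md nOm'; rewrite end_of_mz_inj in nOm'.
  by exists y; exact: conj md nOm'.
move: Om_m; rewrite /= (end_of_mz_boundary bm).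
apply: (oO' (fun n => inr (prime_end_of (svalP (w n))))).
  by move=> n; have [_] := wP n; rewrite (end_of_mz_boundary (svalP (w n))).
right; exists (fun n => prime_end_of (svalP (w n))) => // E eE k.
have [r [r0 rP]] := divm E k eE.
have [N NP] := half_pow_small ler01 (divr_gt0 r0 (ltr0n R 2)); exists N => n Nn.
have [l lr] := mz_radius_small (sval (w n)) (divr_gt0 r0 (ltr0n R 6)).
exists (mz_chain (sval (w n))), l; split; first exact/chain_class_self/mz_chainP/(svalP (w n)).
move=> z wz; have [Oz _] := mz_nbhd_sub wz.
have := @mz_nbhd_dist (sval (w n)) _ (dom_point Oz) (mz_radius_gt0 l (svalP (w n))) wz.
have [mw _] := wP n; have := NP n Nn; rewrite mul1r => nr zw.
apply: (rP (dom_point Oz)); have := metric_triangle (inj (dom_point Oz)) (sval (w n)) m.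
by rewrite (metric_sym (sval (w n)) m); lra.
Qed.

Lemma chain_near_mono F G m : chain_divides F G -> chain_near F m -> chain_near G m.
Proof.
by move=> FG nF k e e0; have [l lk] := FG k; have [y Fy ym] := nF l e e0; exists y => //; exact: lk.
Qed.

(* The ends divisible by some [mz_chain m] with [m] in [D]; the non-prime ends
   are needed for the set to be closed in the whole space of ends. *)
Definition ends_over (D : set M) : set (end_space Om) := [set z |
  match z with
  | inl y => D (inj y)
  | inr e => exists m F, [/\ D m, set_val e F & chain_near F m]
  end].

Lemma ends_over_closed (D : set M) : closed D -> seq_closed Om (ends_over D).
Proof.
move=> cD u [y|e] uD /=.
  move=> [v uv /nbhs_mdistP_cvg vy]; apply: cD; apply/closure_mdistP => r r0.
  have [d d0 dP] := mz_near y r0; have [N NP] := vy d d0.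
  exists (inj (v N)); first by have := uD N; rewrite uv.
  by apply: dP; exact: NP.
move=> ue; have [F cF eF] : ends Om (set_val e) by exact: set_valP.
have eFF : set_val e F by rewrite -eF; exact: chain_class_self.
suff [m Dm nm] : exists2 m, D m & chain_near F m by exists m, F.
have lim (a : nat -> M) : (forall n, D (a n)) -> exists2 m, D m &
    forall (r : R) N, 0 < r -> exists2 n, (N <= n)%N & mdist m (a n) < r.
  move=> Da; have [m _ mP] := compact_seq_cluster mz_compact (fun n => I : [set: M] (a n)).
  exists m => //; apply: cD; apply/closure_mdistP => r r0.
  by have [n _ mn] := mP r 0%N r0; exists (a n).
case: ue => [[v uv ve]|[f uf fe]].
  have Dv n : D (inj (v n)) by have := uD n; rewrite uv.
  have [m Dm mP] := lim _ Dv; exists m => // k r r0.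
  have [n0 n0P] := ve F eFF k; have [n n0n mn] := mP r n0 r0.
  by exists (v n); [exact: n0P|rewrite metric_sym].
have /choice [a aP] : forall n, exists a, exists G, [/\ D a, set_val (f n) G & chain_near G a].
  by move=> n; have := uD n; rewrite uf => -[a [G H]]; exists a, G.
have Da n : D (a n) by have [G []] := aP n.
have [m Dm mP] := lim a Da.
exists m; first exact: Dm.
move=> k r r0; have r20 := divr_gt0 r0 (ltr0n R 2).
have [n0 n0P] := fe F eFF k; have [n n0n mn] := mP _ n0 r20.
have [G' [l [fG' G'F]]] := n0P n n0n; have [G [_ fG nG]] := aP n.
have GG' : chain_divides G G'.
  have [E cE fE] : ends Om (set_val (f n)) by exact: set_valP.
  have [_ _ GE] : chain_class Om E G by rewrite fE.
  have [_ EG' _] : chain_class Om E G' by rewrite fE.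
  exact: chain_divides_trans GE EG'.
have [y Gy ya] := chain_near_mono GG' nG l r20; exists y; first exact: G'F.
by apply: mdist_lt_half ya _; rewrite metric_sym.
Qed.

Lemma ends_over_prime (D : set M) m : ends_over D (end_of_mz m) <-> D m.
Proof.
have [bm|[y ->]] := mz_inj_boundaryP m; last by rewrite end_of_mz_inj.
rewrite (end_of_mz_boundary bm) /=; split=> [[m' [F [Dm' [_ _ Fm] nF]]]|Dm].
  by rewrite -(mz_chain_near_eq bm (chain_near_mono Fm nF)).
exists m, (mz_chain m); split=> //; first exact/chain_class_self/mz_chainP.
exact: chain_divides_near (@chain_divides_refl _ _ _).
Qed.

Definition mz_prime_end m : prime_end_closure Om := exist _ (end_of_mz m) (mem_set (end_of_mz_prime m)).

Definition prime_end_mz (z : prime_end_closure Om) : M :=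
  sval (cid (end_of_mz_surj (set_valP z))).

Lemma end_of_prime_end_mz z : end_of_mz (prime_end_mz z) = set_val z.
Proof. by rewrite /prime_end_mz; case: cid. Qed.

Lemma mz_prime_endK : cancel mz_prime_end prime_end_mz.
Proof. by move=> m; apply: end_of_mz_injective; rewrite end_of_prime_end_mz. Qed.

Lemma prime_end_mzK : cancel prime_end_mz mz_prime_end.
Proof. by move=> z; apply: val_inj; rewrite /= end_of_prime_end_mz. Qed.

Lemma mz_prime_end_continuous : continuous mz_prime_end.
Proof. exact: (@continuous_comp_initial _ _ _ set_val mz_prime_end end_of_mz_continuous). Qed.

Lemma prime_end_mz_continuous : continuous prime_end_mz.
Proof.
(* The induced topology asks for an open set of the space of all ends. *)
apply/continuousP => V oV; exists (~` ends_over (~` V)).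
  by apply/end_space_open; rewrite setCK; apply: ends_over_closed; exact: open_closedC.
apply/seteqP; split=> z /=; rewrite -end_of_prime_end_mz.
  by move=> H; apply: contrapT => nV; apply: H; apply/ends_over_prime.
by move=> Vz /ends_over_prime.
Qed.

Lemma prime_end_homeomorphism : homeomorphism prime_end_mz.
Proof.
split; first exact: prime_end_mz_continuous.
exists mz_prime_end; split; [exact: mz_prime_end_continuous|exact: prime_end_mzK|exact: mz_prime_endK].
Qed.

Lemma prime_end_mz_inj y : prime_end_mz (prime_closure_inj y) = inj y.
Proof. by apply: end_of_mz_injective; rewrite end_of_prime_end_mz end_of_mz_inj. Qed.

Lemma prime_end_metrizable : metrizable R (prime_end_closure Om).
Proof.
exists (fun z z' => mdist (prime_end_mz z) (prime_end_mz z')); split.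
- move=> z z'; split=> [/mdist_positivity /(can_inj prime_end_mzK)//|->].
  exact: mdistxx.
- by move=> z z'; exact: metric_sym.
- by move=> z z' z''; exact: metric_triangle.
move=> A; split=> [oA z Az|HA].
  have /continuousP /(_ _ oA) /open_mdistP := mz_prime_end_continuous.
  move=> /(_ (prime_end_mz z)) []; first by rewrite /= prime_end_mzK.
  by move=> r r0 rP; exists r => // z' /= /rP /=; rewrite prime_end_mzK.
have -> : A = prime_end_mz @^-1` (mz_prime_end @^-1` A).
  by apply/seteqP; split=> z /=; rewrite prime_end_mzK.
have /continuousP := prime_end_mz_continuous; apply.
apply/open_mdistP => m /HA [r r0 rP]; exists r => // m' mm'.
by apply: rP; rewrite /= !mz_prime_endK.
Qed.

Lemma prime_end_compact : compact [set: prime_end_closure Om].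
Proof.
have -> : [set: prime_end_closure Om] = mz_prime_end @` [set: M].
  by apply/seteqP; split=> z // _; exists (prime_end_mz z) => //; exact: prime_end_mzK.
apply: continuous_compact; last exact: mz_compact.
exact/continuous_subspaceT/mz_prime_end_continuous.
Qed.

End prime_ends.

(** * Weak upper gradients *)

Section interval_integrals.
Context {R : realType}.
Local Notation leb := (@lebesgue_measure R).
Implicit Types (h : R -> \bar R) (f : R -> R) (a b c l s t : R).
Local Open Scope ereal_scope.

Lemma integral_itv_split h a b c : measurable_fun setT h -> (forall t, 0 <= h t) ->
  (a <= b)%R -> (b <= c)%R ->
  \int[leb]_(t in `[a, b]) h t + \int[leb]_(t in `[b, c]) h t <=
  \int[leb]_(t in `[a, c]) h t.
Proof.
move=> mh h0 ab bc; rewrite -(@integral_itv_obnd_cbnd _ b (BRight c)); last exact: measurable_funTS.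
rewrite -ge0_integral_setU//=.
- apply: ge0_subset_integral => //=.
  + exact: measurableU.
  + exact: measurable_funTS.
  + by move=> t [] /=; rewrite !in_itv/= => /andP[? ?]; apply/andP; split; lra.
- exact: measurable_funTS.
- rewrite disj_set2E; apply/eqP; rewrite -subset0 => t [] /=; rewrite !in_itv/=.
  by move=> /andP[_ tb] /andP[bt _]; move: tb; rewrite leNgt bt.
Qed.

(** Lets a gradient inequality be checked on intervals so short that a case distinction on their
    position is possible; the triangle inequality adds up steps of length [d]. *)
Lemma local_to_global_bound f h l (d : R) : (0 <= l)%R -> (0 < d)%R ->
  measurable_fun setT h -> (forall t, 0 <= h t) ->
  (forall s t, (0 <= s)%R -> (s <= t)%R -> (t <= l)%R -> (t - s <= d)%R ->
    `|f s - f t|%:E <= \int[leb]_(x in `[s, t]) h x) ->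
  `|f 0 - f l|%:E <= \int[leb]_(x in `[0%R, l]) h x.
Proof.
move=> l0 d0 mh h0 H.
suff step n t : (0 <= t)%R -> (t <= l)%R -> (t <= n%:R * d)%R ->
    `|f 0 - f t|%:E <= \int[leb]_(x in `[0%R, t]) h x.
  apply: (step (Num.truncn (l / d)).+1) => //.
  by rewrite -ler_pdivrMr//; apply/ltW/truncnS_gt.
elim: n t => [|n IH] t t0 tl; first by rewrite mul0r => t0'; apply: H => //; lra.
have [td|dt] := leP t d; first by move=> _; apply: H => //; lra.
rewrite -natr1 => tn.
have st : (0 <= t - d)%R by lra.
have std : (t - d <= t)%R by lra.
apply: le_trans (integral_itv_split mh h0 st std).
apply: (@le_trans _ _ (`|f 0 - f (t - d)|%:E + `|f (t - d) - f t|%:E)).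
  by rewrite -EFinD lee_fin; apply: ler_distD.
by apply: leeD; [apply: IH|apply: H]; lra.
Qed.

(** Absolute continuity of the integral, read off the real-valued function [f] that agrees with [h]
    almost everywhere on [[0, l]]. *)
Lemma integral_small h l (e : R) : measurable_fun setT h -> (forall t, 0 <= h t) ->
  \int[leb]_(x in `[0%R, l]) h x < +oo -> (0 < e)%R ->
  exists2 d : R, (0 < d)%R & forall B, measurable B -> B `<=` `[0%R, l] ->
    leb B < d%:E -> \int[leb]_(x in B) h x <= e%:E.
Proof.
move=> mh h0 hoo e0; pose D := `[0%R, l]%classic : set (measurableTypeR R).
have mD : measurable D by exact: measurable_itv.
have ih : leb.-integrable D h.
  apply/integrableP; split; first exact: measurable_funTS.
  by under eq_integral do rewrite gee0_abs//.
pose f t := fine ((h \_ D) t).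
have f0 x : (0 <= f x)%R by rewrite fine_ge0//; apply: erestrict_ge0.
have mf : measurable_fun setT f.
  apply: measurableT_comp => //; apply/(measurable_restrictT _ mD).
  exact: measurable_funTS.
have ae : {ae leb, forall x, D x -> h x = (f x)%:E}.
  have := integrable_ae mD ih; apply: filterS => x /= hx Dx.
  by rewrite /f patchE mem_set// fineK//; exact: hx.
have if_ : leb.-integrable setT (EFin \o f).
  apply/integrableP; split; first exact/measurable_EFinP.
  rewrite (_ : \int[leb]_x _ = \int[leb]_(x in D) h x)//.
  rewrite [RHS]integral_mkcond; apply: ge0_ae_eq_integral => //.
  - by do 2 apply: measurableT_comp => //.
  - by apply/(measurable_restrictT _ mD); exact: measurable_funTS.
  - by move=> x _; apply: erestrict_ge0.
  - apply: filterS ae => x /= hx _; rewrite (ger0_norm (f0 x)) patchE; case: ifPn => xD.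
      by rewrite hx//; exact: set_mem.
    by rewrite /f patchE (negbTE xD).
have [d [d0 dP]] := integral_normr_continuous if_ e0.
exists d => // B mB BD Bd; have {dP} := dP B mB Bd.
have -> : \int[leb]_(x in B) h x = \int[leb]_(x in B) `|f x|%:E.
  apply: ge0_ae_eq_integral => //.
  - exact: measurable_funTS.
  - by apply: measurable_funTS; do 2 apply: measurableT_comp => //.
  - apply: filterS ae => x /= hx Bx; rewrite hx; last exact: BD.
    by rewrite ger0_norm.
rewrite /Rintegral => fe.
have fin : \int[leb]_(x in B) `|f x|%:E \is a fin_num.
  rewrite ge0_fin_numE; last by apply: integral_ge0 => x _; rewrite lee_fin.
  have /integrableP [_] := if_; apply: le_lt_trans.
  apply: ge0_subset_integral => //.
  by apply: measurable_funTS; do 2 apply: measurableT_comp => //; exact/measurable_EFinP.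
by rewrite -(fineK fin) lee_fin ltW.
Qed.

End interval_integrals.

Lemma compact_open_margin (R : realType) (X : metricType R) (K V : set X) :
  compact K -> open V -> K `<=` V ->
  exists2 d : R, 0 < d & forall x y, K x -> mdist x y < d -> V y.
Proof.
move=> cK oV KV; apply: contrapT => nd.
have /choice [q qP] : forall n, exists q : X * X,
    [/\ K q.1, mdist q.1 q.2 < 2^-1 ^+ n & ~ V q.2].
  move=> n; apply: contrapT => nq; apply: nd; exists (2^-1 ^+ n); first exact: half_pow_gt0.
  by move=> x y Kx xy; apply: contrapT => nV; apply: nq; exists (x, y).
have Kq n : K (q n).1 by have [] := qP n.
have [x Kx xP] := compact_seq_cluster cK Kq.
have [e e0 eV] := (open_mdistP V).1 oV x (KV x Kx).
have e20 : 0 < e / 2 by rewrite divr_gt0.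
have [N NP] := half_pow_small ler01 e20; have [n Nn xn] := xP _ N e20.
have [_ qq nV] := qP n; apply: nV; apply: eV; apply: mdist_lt_half xn _.
by apply: lt_trans qq _; have := NP n Nn; rewrite mul1r.
Qed.

Section lattice.
Context {R : realType}.
Local Notation leb := (@lebesgue_measure R).
Local Open Scope ereal_scope.

(* Use [h1] near a compact set [K] that almost exhausts [{h1 <= h2}] and [h2]
   off [K]; on short intervals one of the two choices is available. *)
Lemma mine_bound (f : R -> R) (h1 h2 : R -> \bar R) (l : R) : (0 <= l)%R ->
  measurable_fun setT h1 -> measurable_fun setT h2 ->
  (forall t, 0 <= h1 t) -> (forall t, 0 <= h2 t) ->
  \int[leb]_(x in `[0%R, l]) h1 x < +oo -> \int[leb]_(x in `[0%R, l]) h2 x < +oo ->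
  (forall s t, (0 <= s)%R -> (s <= t)%R -> (t <= l)%R ->
    `|f s - f t|%:E <= \int[leb]_(x in `[s, t]) h1 x) ->
  (forall s t, (0 <= s)%R -> (s <= t)%R -> (t <= l)%R ->
    `|f s - f t|%:E <= \int[leb]_(x in `[s, t]) h2 x) ->
  `|f 0 - f l|%:E <= \int[leb]_(x in `[0%R, l]) mine (h1 x) (h2 x).
Proof.
move=> l0 m1 m2 h10 h20 i1 i2 f1 f2; pose D := `[0%R, l]%classic : set (measurableTypeR R).
have mD : measurable D by exact: measurable_itv.
pose A : set (measurableTypeR R) := D `&` [set t | h1 t <= h2 t].
have mA : measurable A by apply: measurable_lee => //; exact: measurable_funTS.
have Dfin : leb D < +oo.
  by rewrite lebesgue_measure_itv/=; case: ifP => _; rewrite ?ltry.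
apply/lee_addgt0Pr => e e0; have e20 : (0 < e / 2)%R by rewrite divr_gt0.
have [d1 d10 d1P] := integral_small m1 h10 i1 e20.
have [d2 d20 d2P] := integral_small m2 h20 i2 e20.
have Afin : leb A < +oo by apply: le_lt_trans Dfin; apply: le_measure; rewrite ?inE// => t [].
have [K [cK KA AK]] := lebesgue_regularity_inner mA Afin d20.
have mK : measurable K by exact: compact_measurable.
have KD : K `<=` D by move=> t /KA [].
have Kfin : leb K < +oo by apply: le_lt_trans Dfin; apply: le_measure; rewrite ?inE.
have [V [oV KV VK]] := lebesgue_regularity_outer mK Kfin d10.
have mV : measurable V by exact: open_measurable.
have [d d0 dP] := @compact_open_margin R R^o K V cK oV KV.
have mDV : measurable (D `&` (V `\` K)) by apply: measurableI => //; exact: measurableD.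
have mAK : measurable (A `\` K) by exact: measurableD.
(* [h] dominates [h1] on [V] and [h2] off [K]; the two corrections live on sets small enough to
   contribute at most [e / 2] each. *)
pose h t := mine (h1 t) (h2 t) + ((h1 \_ (D `&` (V `\` K))) t + (h2 \_ (A `\` K)) t).
have mr1 : measurable_fun setT (h1 \_ (D `&` (V `\` K))).
  by apply/(measurable_restrictT _ mDV); exact: measurable_funTS.
have mr2 : measurable_fun setT (h2 \_ (A `\` K)).
  by apply/(measurable_restrictT _ mAK); exact: measurable_funTS.
have r10 t : 0 <= (h1 \_ (D `&` (V `\` K))) t by apply: erestrict_ge0.
have r20 t : 0 <= (h2 \_ (A `\` K)) t by apply: erestrict_ge0.
have m0 t : 0 <= mine (h1 t) (h2 t) by rewrite le_min h10 h20.
have mm : measurable_fun setT (fun t => mine (h1 t) (h2 t)) by exact: measurable_mine.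
have mr12 : measurable_fun setT (fun t => (h1 \_ (D `&` (V `\` K))) t + (h2 \_ (A `\` K)) t).
  exact: emeasurable_funD.
have mh : measurable_fun setT h by exact: emeasurable_funD.
have h0 t : 0 <= h t by rewrite /h !adde_ge0.
have Vh t : D t -> V t -> h1 t <= h t.
  move=> Dt Vt; have [At|nAt] := pselect (A t).
    have [_ /= h12] := At; rewrite /h (_ : mine _ _ = h1 t); last exact/min_idPl.
    by rewrite leeDl// adde_ge0.
  rewrite /h; apply: (@le_trans _ _ (0 + (h1 t + 0))); first by rewrite adde0 add0e.
  apply: leeD => //; apply: leeD => //; rewrite patchE mem_set//.
  by split=> //; split=> // /KA.
have Kh t : D t -> ~ K t -> h2 t <= h t.
  move=> Dt Kt; have [At|nAt] := pselect (A t).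
    rewrite /h; apply: (@le_trans _ _ (0 + (0 + h2 t))); first by rewrite !add0e.
    by apply: leeD => //; apply: leeD => //; rewrite patchE mem_set.
  rewrite /h (_ : mine _ _ = h2 t); first by rewrite leeDl// adde_ge0.
  apply/min_idPr; rewrite leNgt; apply/negP => h12; apply: nAt; split=> //=.
  exact: ltW.
have -> : \int[leb]_(x in `[0%R, l]) mine (h1 x) (h2 x) + e%:E =
  \int[leb]_(x in `[0%R, l]) mine (h1 x) (h2 x) + ((e / 2)%:E + (e / 2)%:E).
  by rewrite -EFinD -splitr.
apply: (@le_trans _ _ (\int[leb]_(x in `[0%R, l]) h x)).
  apply: (@local_to_global_bound _ _ _ _ (d / 2)) => //; first by rewrite divr_gt0.
  move=> s t s0 st tl std.
  have Dst x : x \in `[s, t] -> D x.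
    by rewrite in_itv/= => /andP[sx xt]; rewrite /D /= in_itv/=; apply/andP; split; lra.
  (* An interval of length at most [d / 2] that meets [K] lies in [V]. *)
  have [[k Kk kst]|nk] := pselect (exists2 k, K k & k \in `[s, t]).
    apply: le_trans (f1 s t s0 st tl) _; apply: ge0_le_integral => //.
    - exact: measurable_funTS.
    - exact: measurable_funTS.
    - move=> x xst; apply: Vh; first exact: Dst.
      apply: (dP k) => //; change (`|x - k| < d)%R.
      move: kst xst; rewrite /= !in_itv/= => /andP[? ?] /andP[? ?].
      by rewrite ltr_norml; apply/andP; split; lra.
  apply: le_trans (f2 s t s0 st tl) _; apply: ge0_le_integral => //.
  - exact: measurable_funTS.
  - exact: measurable_funTS.
  - by move=> x xst; apply: Kh; [exact: Dst|move=> Kx; apply: nk; exists x].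
rewrite ge0_integralD//; do ?exact: measurable_funTS.
apply: leeD => //; rewrite ge0_integralD//; do ?exact: measurable_funTS.
apply: leeD.
  rewrite -integral_mkcondr; apply: d1P.
  - by apply: measurableI.
  - by move=> t [].
  - apply: le_lt_trans VK; apply: le_measure; rewrite ?inE//.
    + by apply: measurableI.
    + exact: measurableD.
    + by move=> t [_ [_ ]].
rewrite -integral_mkcondr; apply: d2P.
- by apply: measurableI.
- by move=> t [].
- by apply: le_lt_trans AK; apply: le_measure; rewrite ?inE//; exact: measurableI.
by move=> x _; exact: adde_ge0.
Qed.

End lattice.

Local Open Scope ereal_scope.

(** The integral of a nonnegative function is a supremum over the simple functions below it, so
    monotonicity asks for no measurability. Weak upper gradients need not be Borel. *)
Lemma ge0_le_integral_nonmeasurable (R : realType) (d : measure_display)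
    (T : measurableType d) (mu : {measure set T -> \bar R}) (D : set T) (f g : T -> \bar R) :
  (forall x, D x -> 0 <= f x) -> (forall x, D x -> f x <= g x) ->
  \int[mu]_(x in D) f x <= \int[mu]_(x in D) g x.
Proof.
move=> f0 fg; have g0 x : D x -> 0 <= g x by move=> Dx; exact: le_trans (f0 x Dx) (fg x Dx).
rewrite !ge0_integralE//; apply: ereal_sup_le => _ [h hf <-]; exists h => //= x.
by apply: le_trans (hf x) _; exact: lee_restrict.
Qed.

(** On [E k] the function [g] exceeds [f] by [1 / (k + 1)]; equality of the finite integrals makes
    every [E k] null, and these sets exhaust the set where [f < g]. *)
Lemma integral_le_ae_ge (R : realType) (d : measure_display) (T : measurableType d)
    (mu : {measure set T -> \bar R}) (f g : T -> \bar R) :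
  measurable_fun setT f -> measurable_fun setT g -> (forall x, 0 <= f x) ->
  (forall x, f x <= g x) -> \int[mu]_x g x < +oo ->
  \int[mu]_x g x <= \int[mu]_x f x -> {ae mu, forall x, g x <= f x}.
Proof.
move=> mf mg f0 fg goo gf.
pose E k := [set x | f x + (k.+1%:R^-1)%:E <= g x].
have mE k : measurable (E k).
  rewrite -[E k]setTI; apply: measurable_lee => //.
  by apply: emeasurable_funD => //; exact: measurable_cst.
have foo : \int[mu]_x f x < +oo by apply: le_lt_trans goo; exact: ge0_le_integral.
have E0 k : mu (E k) = 0.
  pose e x : \bar R := (k.+1%:R^-1)%:E * (\1_(E k) x)%:E.
  have e0 x : 0 <= e x by rewrite mule_ge0// lee_fin.
  have me : measurable_fun setT e.
    by apply: measurable_funeM; apply/measurable_EFinP; exact: measurable_indic.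
  have mi : measurable_fun setT (fun x => (\1_(E k) x)%:E : \bar R).
    by apply/measurable_EFinP; exact: measurable_indic.
  have eE : \int[mu]_x e x = (k.+1%:R^-1)%:E * mu (E k).
    rewrite /e ge0_integralZl// ?lee_fin// ?integral_indic ?setIT//.
  have : \int[mu]_x f x + (k.+1%:R^-1)%:E * mu (E k) <= \int[mu]_x f x.
    rewrite -eE -ge0_integralD//; apply: le_trans gf; apply: ge0_le_integral => //.
    - by move=> x _; exact: adde_ge0.
    - exact: emeasurable_funD.
    - move=> x _; rewrite /e indicE; have [Ex|nEx] := boolP (x \in E k).
        by rewrite mule1; exact: (set_mem Ex).
      by rewrite mule0 adde0.
  have ffin : \int[mu]_x f x \is a fin_num by rewrite ge0_fin_numE// integral_ge0.
  rewrite -[leRHS]adde0 leeD2lE// => h; apply/eqP; rewrite eq_le measure_ge0 andbT.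
  by rewrite -(pmule_rle0 (x := (k.+1%:R^-1)%:E))// lte_fin.
exists (\bigcup_k E k); split.
- exact: bigcup_measurable.
- apply/eqP; rewrite eq_le measure_ge0 andbT.
  apply: le_trans (measure_sigma_subadditive _ _ _ (@subset_refl _ _)) _ => //.
    exact: bigcup_measurable.
  by rewrite eseries0// => k _ _; exact: E0.
- move=> x /= /negP; rewrite -ltNge => fxg.
  have : f x \is a fin_num by rewrite ge0_fin_numE//; apply: lt_le_trans fxg _; rewrite leey.
  move: fxg; case fE: (f x) => [a||] //; case gE: (g x) => [b||] //.
    rewrite lte_fin => /ltr_add_invr [k kb] _; exists k => //.
    by rewrite /E /= fE gE -EFinD lee_fin ltW.
  by move=> _ _; exists 0%N => //; rewrite /E /= gE leey.
Qed.

Local Close Scope ereal_scope.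

Lemma lebesgue_measure_shift (R : realType) (a : R) (A : set R) : measurable A ->
  pushforward lebesgue_measure (+%R a : _ -> measurableTypeR R) A = lebesgue_measure A.
Proof.
move=> mA; have ms : measurable_fun setT (+%R a : measurableTypeR R -> measurableTypeR R).
  by apply: measurable_funD => //; exact: measurable_cst.
apply/esym/lebesgue_measure_unique => //= _ [[b c]] _ <-; rewrite /pushforward.
rewrite (_ : _ @^-1` _ = `](b - a), (c - a)]%classic); last first.
  by apply/seteqP; split=> t /=; rewrite !in_itv/= ltrBlDl lerBrDl.
rewrite !lebesgue_measure_itv/= !lte_fin ltrD2r.
by case: ifP => // _; rewrite -!EFinB; congr (_%:E); lra.
Qed.

Section arc_integrals.
Context {R : realType} {X : pmetricType R}.
Local Notation leb := (@lebesgue_measure R).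
Local Open Scope ereal_scope.
Implicit Types (gamma : arcCurve X) (g rho : X -> \bar R).

Lemma continuous_borel (c : R -> X) : continuous c ->
  measurable_fun setT (c : measurableTypeR R -> borel X).
Proof.
move=> /continuousP cc; apply: (@measurability _ _ (measurableTypeR R) (borel X) setT c (@open X) erefl).
by move=> _ [B oB <-]; rewrite setTI; apply: open_measurable; exact: cc.
Qed.

(** The values of a curve off its parameter interval are arbitrary; clamping yields a continuous
    function on the line, whose compositions with Borel functions are measurable. *)
Definition arc_ext gamma (t : R) : X := gamma (Num.max 0%R (Num.min (arc_len gamma) t)).

Lemma arc_ext_continuous gamma : continuous (arc_ext gamma).
Proof. by case: gamma => l g l0 gP; exact: (arc_continuous gP). Qed.

Lemma arc_len_ge0 gamma : (0 <= arc_len gamma)%R.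
Proof. exact/ltW/arc_len_gt0. Qed.

Lemma arc_extE gamma t : (0 <= t <= arc_len gamma)%R -> arc_ext gamma t = gamma t.
Proof. by move=> /andP[t0 tl]; rewrite /arc_ext (min_idPr tl) (max_idPr t0). Qed.

Lemma arc_ext0 gamma : arc_ext gamma 0%R = gamma 0%R.
Proof. by apply: arc_extE; rewrite lexx arc_len_ge0. Qed.

Lemma arc_ext_len gamma : arc_ext gamma (arc_len gamma) = gamma (arc_len gamma).
Proof. by apply: arc_extE; rewrite lexx arc_len_ge0. Qed.

Lemma arc_ext_dist gamma (s t : R) : (mdist (arc_ext gamma s) (arc_ext gamma t) <= `|s - t|)%R.
Proof.
have l0 := arc_len_ge0 gamma.
have cl u : (0 <= Num.max 0 (Num.min (arc_len gamma) u) <= arc_len gamma)%R.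
  by rewrite le_max lexx ge_max l0 ge_min lexx.
apply: le_trans (arc_dist (arcP gamma) (cl s) (cl t)) _.
by rewrite distrC; exact: clamp_dist.
Qed.

Lemma arc_ext_measurable gamma g : nonneg_borel g -> measurable_fun setT (g \o arc_ext gamma).
Proof. by move=> [mg _]; apply: (measurableT_comp mg); apply: continuous_borel; exact: arc_ext_continuous. Qed.

Lemma curve_integralE gamma g :
  curve_integral gamma g = \int[leb]_(t in `[0%R, arc_len gamma]) g (arc_ext gamma t).
Proof.
by apply: eq_integral => t; rewrite inE/= in_itv/= => tl; rewrite arc_extE.
Qed.

Lemma curve_integral_le gamma g rho : (forall x, 0 <= g x) -> (forall x, g x <= rho x) ->
  curve_integral gamma g <= curve_integral gamma rho.
Proof. by move=> g0 gr; apply: ge0_le_integral_nonmeasurable. Qed.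

Definition subarc gamma (s t : R) (s0 : (0 <= s)%R) (st : (s < t)%R)
    (tl : (t <= arc_len gamma)%R) : arcCurve X :=
  @ArcCurve R X (t - s) (fun u => gamma (s + u)%R) (etrans (subr_gt0 s t) st)
    (arc_shift (arcP gamma) s0 st tl).

Lemma subarc_integral gamma (s t : R) (s0 : (0 <= s)%R) (st : (s < t)%R)
    (tl : (t <= arc_len gamma)%R) g : nonneg_borel g ->
  curve_integral (subarc s0 st tl) g = \int[leb]_(u in `[s, t]) g (arc_ext gamma u).
Proof.
move=> bg; have [_ g0] := bg; have mge := arc_ext_measurable gamma bg.
have ms : measurable_fun setT (+%R s : measurableTypeR R -> measurableTypeR R).
  by apply: measurable_funD => //; exact: measurable_cst.
transitivity (\int[leb]_(u in (+%R s) @^-1` `[s, t]) (g \o arc_ext gamma \o +%R s) u).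
  rewrite (_ : _ @^-1` _ = `[0%R, (t - s)%R]%classic); last first.
    by apply/seteqP; split=> u /=; rewrite !in_itv/= lerDl lerBrDl.
  apply: eq_integral => u; rewrite inE/= in_itv/= => /andP[u0 ut].
  by rewrite /= arc_extE// addr_ge0//= (le_trans _ tl)//; lra.
rewrite -(@ge0_integral_pushforward _ _ _ _ _ (+%R s : measurableTypeR R -> measurableTypeR R))//.
- by apply: eq_measure_integral => A mA _; exact: lebesgue_measure_shift.
- exact: measurable_funTS.
- by move=> u _; exact: g0.
Qed.

End arc_integrals.

Section weak_upper_gradients.
Context {R : realType} {X : pmetricType R}.
Variables (mu : {measure set (borel X) -> \bar R}) (p : R).
Hypothesis p_gt0 : (0 < p)%R.
Local Notation leb := (@lebesgue_measure R).
Local Open Scope ereal_scope.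
Implicit Types (gamma : arcCurve X) (g h rho : X -> \bar R) (u : X -> R).

Lemma borel_poweR g : nonneg_borel g -> measurable_fun setT (fun x : borel X => g x `^ p).
Proof. by move=> [mg _]; exact: (measurableT_comp (measurable_poweR p) mg). Qed.

Lemma borel_mine g h : nonneg_borel g -> nonneg_borel h -> nonneg_borel (fun x => mine (g x) (h x)).
Proof. by move=> [mg g0] [mh h0]; split; [exact: measurable_mine|move=> x; rewrite le_min g0 h0]. Qed.

Lemma borel_maxe g h : nonneg_borel g -> nonneg_borel h -> nonneg_borel (fun x => maxe (g x) (h x)).
Proof. by move=> [mg g0] [mh h0]; split; [exact: measurable_maxe|move=> x; rewrite le_max g0]. Qed.

Lemma p_integralE g : (forall x, 0 <= g x) -> p_integral mu p g = \int[mu]_x (g x `^ p).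
Proof. by move=> g0; apply: eq_integral => x _; rewrite gee0_abs. Qed.

Lemma poweR_le (a b : \bar R) : 0 <= a -> a <= b -> a `^ p <= b `^ p.
Proof.
move=> a0 ab; apply: gt0_ler_poweR => //; first exact: ltW.
  by rewrite in_itv/= a0 leey.
by rewrite in_itv/= (le_trans a0 ab) leey.
Qed.

Lemma poweR_le_inv (a b : \bar R) : 0 <= a -> 0 <= b -> a `^ p <= b `^ p -> a <= b.
Proof.
move=> a0 b0 ab.
have pp : (p * p^-1 = 1)%R by rewrite divff// gt_eqF.
rewrite -(poweRe1 a0) -(poweRe1 b0) -pp !poweRrM.
apply: gt0_ler_poweR; rewrite ?in_itv/= ?poweR_ge0 ?leey//.
by rewrite invr_ge0 ltW.
Qed.

Lemma p_integral_le g h : (forall x, 0 <= g x) -> (forall x, g x <= h x) ->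
  p_integral mu p g <= p_integral mu p h.
Proof.
move=> g0 gh; rewrite !p_integralE//; last by move=> x; exact: le_trans (g0 x) (gh x).
by apply: ge0_le_integral_nonmeasurable => x _; [exact: poweR_ge0|exact: poweR_le].
Qed.

Lemma p_integral_maxe g h : nonneg_borel g -> nonneg_borel h ->
  p_integral mu p g < +oo -> p_integral mu p h < +oo ->
  p_integral mu p (fun x => maxe (g x) (h x)) < +oo.
Proof.
move=> bg bh; have [_ g0] := bg; have [_ h0] := bh; have [_ m0] := borel_maxe bg bh.
rewrite !p_integralE// => ig ih.
apply: (@le_lt_trans _ _ (\int[mu]_x (g x `^ p + h x `^ p))).
  apply: ge0_le_integral_nonmeasurable => x _; first exact: poweR_ge0.
  by rewrite maxEle; case: ifP => _; [apply: leeDr|apply: leeDl]; exact: poweR_ge0.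
rewrite ge0_integralD//; do ?exact: borel_poweR.
- exact: lte_add_pinfty.
- by move=> x _; exact: poweR_ge0.
- by move=> x _; exact: poweR_ge0.
Qed.

(* Borel representatives of the weak upper gradients of [u]; [rho] witnesses
   that the exceptional family is negligible and includes the curves on which
   [g] is not integrable. *)
Definition borel_weak_gradient u g : Prop :=
  [/\ nonneg_borel g, p_integral mu p g < +oo
    & exists rho, [/\ nonneg_borel rho, p_integral mu p rho < +oo
      & forall gamma, curve_integral gamma rho < +oo -> curve_integral gamma g < +oo /\
          `|u (gamma 0%R) - u (gamma (arc_len gamma))|%:E <= curve_integral gamma g]].

Lemma borel_weak_gradientP u g : borel_weak_gradient u g ->
  p_weak_upper_gradient mu p (EFin \o u) g.
Proof.
move=> [[mg g0] ig [rho [br ir rP]]]; split=> //.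
  by exists g; split=> //; apply: aeW.
exists [set gamma | curve_integral gamma rho = +oo]; first by exists rho.
move=> gamma /= nr; have [|_ ug] := rP gamma.
  by rewrite ltey; apply/eqP.
by split=> // -[]; split.
Qed.

(** Raising the Borel version [v] to [+oo] on the null set [N] keeps the [p]-integral and gives a
    function above [h] everywhere, so that no curve integral decreases. *)
Lemma weak_gradient_borel u h : p_weak_upper_gradient mu p (EFin \o u) h ->
  p_integral mu p h < +oo ->
  exists2 w, borel_weak_gradient u w & {ae mu, forall x, w x <= h x}.
Proof.
move=> [[v [mv [N [mN N0 Nv]]]] h0 [Gam [rho [br ir rG]] Gu]] ih.
have hv x : ~ N x -> h x = v x by move=> nN; apply: contrapT => hv; apply: nN; exact: Nv.
pose w x := if x \in N then +oo else v x.
have w0 x : 0 <= w x.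
  by rewrite /w; case: ifPn => [_|/negP nN]; [rewrite leey|rewrite -hv// => Nx; apply: nN; rewrite inE].
have hw x : h x <= w x.
  by rewrite /w; case: ifPn => [_|/negP nN]; [rewrite leey|rewrite hv// => Nx; apply: nN; rewrite inE].
have bw : nonneg_borel w.
  split=> //; apply: measurable_fun_ifT => //.
  by apply: (measurable_fun_bool true); rewrite setTI (_ : _ @^-1` _ = N)//;
    apply/seteqP; split=> x /=; [exact: set_mem|exact: mem_set].
have bwN : nonneg_borel (w \_ (~` N)).
  split; last by move=> x; apply: erestrict_ge0.
  apply/(measurable_restrictT _ (measurableC mN)); apply: measurable_funTS; exact: bw.1.
have wN x : (w \_ (~` N)) x <= h x.
  rewrite patchE; case: ifPn => [|_]; last exact: h0.
  by rewrite inE => nN; rewrite /w ifN ?hv//; apply/negP; rewrite inE.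
have iw : p_integral mu p w < +oo.
  apply: le_lt_trans ih; apply: le_trans (p_integral_le _ wN); last exact: bwN.2.
  rewrite !p_integralE//; last exact: bwN.2.
  rewrite (ge0_ae_eq_integral _ (borel_poweR bw) (borel_poweR bwN))//.
  - by move=> x _; exact: poweR_ge0.
  - by move=> x _; exact: poweR_ge0.
  - exists N; split=> // x /= nx; apply: contrapT => nN; apply: nx => _.
    by rewrite patchE mem_set.
exists w; last first.
  exists N; split=> // x /= /negP; rewrite -ltNge => hwx; apply: contrapT => nN.
  by move: hwx; rewrite hv// /w ifN ?ltxx//; apply/negP; rewrite inE.
split=> //; exists (fun x => maxe (rho x) (w x)).
split; [exact: borel_maxe|exact: p_integral_maxe|].
move=> gamma im; split.
  by apply: le_lt_trans im; apply: curve_integral_le => // x; rewrite le_max lexx orbT.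
have nG : ~ Gam gamma.
  move=> /rG E; move: im; apply/negP; rewrite -leNgt -E.
  by apply: curve_integral_le; [exact: br.2|move=> x; rewrite le_max lexx].
have [/(_ isT isT) + _] := Gu gamma nG; rewrite /= => /le_trans; apply.
exact: curve_integral_le.
Qed.

(** A curve along which [rg] and [rh] are integrable has the same property on all its subarcs, so
    both inequalities hold on every subinterval, as [mine_bound] demands. *)
Lemma borel_weak_gradient_mine u g h : borel_weak_gradient u g -> borel_weak_gradient u h ->
  borel_weak_gradient u (fun x => mine (g x) (h x)).
Proof.
move=> [bg ig [rg [brg irg rgP]]] [bh ih [rh [brh irh rhP]]].
split; first exact: borel_mine.
  by apply: le_lt_trans ig; apply: p_integral_le => x; [exact: (borel_mine bg bh).2|rewrite ge_min lexx].
exists (fun x => maxe (rg x) (rh x)); split; [exact: borel_maxe|exact: p_integral_maxe|].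
move=> gamma im.
have im1 : curve_integral gamma rg < +oo.
  by apply: le_lt_trans im; apply: curve_integral_le => [|x]; [exact: brg.2|rewrite le_max lexx].
have im2 : curve_integral gamma rh < +oo.
  by apply: le_lt_trans im; apply: curve_integral_le => [|x]; [exact: brh.2|rewrite le_max lexx orbT].
have [cg ug] := rgP gamma im1; have [ch uh] := rhP gamma im2.
split.
  by apply: le_lt_trans cg; apply: curve_integral_le => x; [exact: (borel_mine bg bh).2|rewrite ge_min lexx].
have sub k rk : nonneg_borel k -> nonneg_borel rk -> curve_integral gamma rk < +oo ->
    (forall gamma, curve_integral gamma rk < +oo -> curve_integral gamma k < +oo /\
      `|u (gamma 0%R) - u (gamma (arc_len gamma))|%:E <= curve_integral gamma k) ->
    forall s t, (0 <= s)%R -> (s <= t)%R -> (t <= arc_len gamma)%R ->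
      `|u (arc_ext gamma s) - u (arc_ext gamma t)|%:E <=
      \int[leb]_(x in `[s, t]) k (arc_ext gamma x).
  move=> bk brk ik kP s t s0; rewrite le_eqVlt => /orP[/eqP -> _|st tl].
    by rewrite subrr normr0; apply: integral_ge0 => x _; exact: bk.2.
  have [|_] := kP (subarc s0 st tl).
    rewrite subarc_integral//; apply: le_lt_trans ik; rewrite curve_integralE.
    apply: ge0_subset_integral => //.
    - by apply: measurable_funTS; exact: (arc_ext_measurable gamma brk).
    - by move=> x _; exact: brk.2.
    - by move=> x /=; rewrite !in_itv/= => /andP[? ?]; apply/andP; split; lra.
  rewrite subarc_integral//= addr0 (_ : s + (t - s) = t)%R; last by rewrite addrC subrK.
  by rewrite !arc_extE// ?s0 ?tl ?(le_trans s0 (ltW st)) ?(le_trans (ltW st) tl).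
rewrite curve_integralE -(arc_ext0 gamma) -(arc_ext_len gamma).
apply: (@mine_bound _ (u \o arc_ext gamma) (g \o arc_ext gamma) (h \o arc_ext gamma)).
- exact: arc_len_ge0.
- exact: arc_ext_measurable.
- exact: arc_ext_measurable.
- by move=> t; exact: bg.2.
- by move=> t; exact: bh.2.
- by rewrite -curve_integralE.
- by rewrite -curve_integralE.
- exact: (sub g rg).
- exact: (sub h rh).
Qed.

End weak_upper_gradients.

(** * Existence of minimal weak upper gradients *)

Section minimal_weak_upper_gradient.
Context {R : realType} {X : pmetricType R}.
Variables (mu : {measure set (borel X) -> \bar R}) (p : R).
Hypothesis p_gt0 : (0 < p)%R.
Local Notation leb := (@lebesgue_measure R).
Local Open Scope ereal_scope.
Implicit Types (gamma : arcCurve X) (g h rho : X -> \bar R) (u : X -> R).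

Lemma term_le_nneseries (a : nat -> \bar R) n : (forall k, 0 <= a k) ->
  a n <= \sum_(0 <= k <oo) a k.
Proof.
move=> a0; apply: le_trans (nneseries_lim_ge n.+1 (fun k _ _ => a0 k)).
by rewrite big_nat_recr//= leeDr// sume_ge0.
Qed.

(* With [w n] summable weights, [(sum_n w n * rho n ^ p) ^ p^-1] dominates a
   multiple of each [rho n]. *)
Lemma exceptional_countable (rho : nat -> X -> \bar R) :
  (forall n, nonneg_borel (rho n)) -> (forall n, p_integral mu p (rho n) < +oo) ->
  exists rho', [/\ nonneg_borel rho', p_integral mu p rho' < +oo &
    forall gamma, curve_integral gamma rho' < +oo ->
      forall n, curve_integral gamma (rho n) < +oo].
Proof.
move=> br ir; pose a n := fine (p_integral mu p (rho n)).
have pI n : p_integral mu p (rho n) = (a n)%:E.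
  rewrite /a fineK// ge0_fin_numE//; apply: integral_ge0 => x _; exact: poweR_ge0.
have a0 n : (0 <= a n)%R.
  by rewrite fine_ge0//; apply: integral_ge0 => x _; exact: poweR_ge0.
(* Since [a n / (1 + a n) <= 1], the weighted [p]-integrals sum to at most 1. *)
pose w n : R := (1 / (2 ^ n.+1)%:R / (1 + a n))%R.
have a1 n : (0 < 1 + a n)%R by rewrite ltr_pwDl.
have w0 n : (0 < w n)%R by rewrite !divr_gt0// ltr0n expn_gt0.
have mr n := borel_poweR p (br n).
have r0 n x : 0 <= (w n)%:E * (rho n x) `^ p.
  by rewrite mule_ge0// ?poweR_ge0// lee_fin ltW.
pose S x := \sum_(0 <= n <oo) ((w n)%:E * (rho n x) `^ p).
have S0 x : 0 <= S x by apply: nneseries_ge0 => n _ _; exact: r0.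
have mS : measurable_fun setT (S : borel X -> \bar R).
  apply: ge0_emeasurable_sum => [k x _ _|k _]; first exact: r0.
  exact: measurable_funeM.
have pp : (p^-1 * p = 1)%R by rewrite mulVf// gt_eqF.
have SP x : (S x `^ p^-1) `^ p = S x by rewrite -poweRrM pp poweRe1.
have bS : nonneg_borel (fun x => S x `^ p^-1).
  by split=> [|x]; [exact: (measurableT_comp (measurable_poweR _) mS)|exact: poweR_ge0].
exists (fun x => S x `^ p^-1); split=> //.
- rewrite p_integralE; last exact: bS.2.
  under eq_integral do rewrite SP.
  rewrite integral_nneseries//; last by move=> n; exact: measurable_funeM.
  apply: le_lt_trans (ltry (1%R : R)); apply: le_trans (epsilon_trick0 xpredT (@ler01 R)).
  apply: lee_nneseries => n _; first by move=> _; apply: integral_ge0 => x _; exact: r0.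
  rewrite ge0_integralZl//; last 2 first.
  - by move=> x _; exact: poweR_ge0.
  - by rewrite lee_fin ltW.
  rewrite -p_integralE; last exact: (br n).2.
  rewrite pI -EFinM lee_fin.
  have -> : (w n * a n = 1 / (2 ^ n.+1)%:R * (a n / (1 + a n)))%R by rewrite /w; ring.
  apply: ler_piMr; first by rewrite divr_ge0// ler0n.
  by rewrite ler_pdivrMr// mul1r lerDr.
- move=> gamma ig n; pose c := (w n `^ p^-1)%R.
  have c0 : (0 < c)%R by rewrite powR_gt0.
  have : c%:E * curve_integral gamma (rho n) < +oo.
    apply: le_lt_trans ig; rewrite curve_integralE -ge0_integralZl//; last 3 first.
    - by apply: measurable_funTS; exact: arc_ext_measurable.
    - by move=> x _; exact: (br n).2.
    - by rewrite lee_fin ltW.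
    rewrite curve_integralE; apply: ge0_le_integral_nonmeasurable => x _.
      by rewrite mule_ge0//; [rewrite lee_fin ltW|exact: (br n).2].
    rewrite /c -poweR_EFin -[X in _ * X](poweRe1 ((br n).2 _)) -(divff (lt0r_neq0 p_gt0)).
    rewrite poweRrM -poweRM ?poweR_ge0 ?lee_fin ?(ltW (w0 n))//.
    apply: poweR_le; rewrite ?invr_gt0//.
    exact: (@term_le_nneseries (fun k => (w k)%:E * (rho k (arc_ext gamma x)) `^ p)).
  have: 0 <= curve_integral gamma (rho n) by apply: integral_ge0 => x _; exact: (br n).2.
  case: (curve_integral gamma (rho n)) => [b _ _|_|//]; first exact: ltry.
  by rewrite gt0_muley ?lte_fin.
Qed.

(** The countably many exceptional families are merged into one. Along any other curve [G 0] is
    integrable and dominates the sequence, so the inequality passes to the limit. *)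
Lemma borel_weak_gradient_inf u (G : nat -> X -> \bar R) :
  (forall n, borel_weak_gradient mu p u (G n)) ->
  (forall n x, G n.+1 x <= G n x) ->
  borel_weak_gradient mu p u (fun x => ereal_inf (range (fun n => G n x))).
Proof.
move=> wG dG; set g := fun x => ereal_inf _.
have bG n : nonneg_borel (G n) by have [] := wG n.
have iG n : p_integral mu p (G n) < +oo by have [] := wG n.
have /choice [rho rhoP] := fun n => let: And3 _ _ h := wG n in h.
have [r [br ir rP]] := exceptional_countable (fun n => let: And3 h _ _ := rhoP n in h)
  (fun n => let: And3 _ h _ := rhoP n in h).
have Gg x : G n x @[n --> \oo] --> g x.
  apply: ereal_nonincreasing_cvgn; apply/nonincreasing_seqP => n; exact: dG.
have gG n x : g x <= G n x by apply: ereal_inf_lbound; exists n.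
have g0 x : 0 <= g x by apply: le_ereal_inf_tmp => _ [n _ <-]; exact: (bG n).2.
have bg : nonneg_borel g.
  split=> //; apply: (emeasurable_fun_cvg (fun n => (G n : borel X -> \bar R))) => //.
  by move=> n; exact: (bG n).1.
split=> //; first by apply: le_lt_trans (iG 0%N); exact: p_integral_le.
exists r; split=> // gamma /rP ig.
have cG n : curve_integral gamma (G n) < +oo by have [_ _ /(_ gamma (ig n)) []] := rhoP n.
have uG n : `|u (gamma 0%R) - u (gamma (arc_len gamma))|%:E <= curve_integral gamma (G n).
  by have [_ _ /(_ gamma (ig n)) []] := rhoP n.
split; first by apply: le_lt_trans (cG 0%N); exact: curve_integral_le.
have mG n : measurable_fun `[0%R, arc_len gamma] (G n \o arc_ext gamma).
  by apply: measurable_funTS; exact: arc_ext_measurable.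
pose D := `[0%R, arc_len gamma]%classic : set (measurableTypeR R).
have iG0 : leb.-integrable D (G 0%N \o arc_ext gamma).
  apply/integrableP; split; first exact: mG.
  under eq_integral do rewrite gee0_abs ?(bG 0%N).2//.
  by have := cG 0%N; rewrite curve_integralE.
have G0 n x : G n x <= G 0%N x.
  by elim: n => // n IH; exact: le_trans (dG _ _) IH.
have aeg : {ae leb, forall x, D x -> (G n \o arc_ext gamma) x @[n --> \oo] --> (g \o arc_ext gamma) x}.
  by apply: aeW => x _; exact: Gg.
have aed : {ae leb, forall x n, D x -> `|(G n \o arc_ext gamma) x| <= (G 0%N \o arc_ext gamma) x}.
  by apply: aeW => x n _ /=; rewrite gee0_abs//; exact: (bG n).2.
have mg : measurable_fun D (g \o arc_ext gamma).
  by apply: measurable_funTS; exact: (arc_ext_measurable gamma bg).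
have mD : measurable D by exact: measurable_itv.
have [_ _ lim] := @dominated_convergence _ _ _ leb D mD (fun n => G n \o arc_ext gamma)
  (g \o arc_ext gamma) (G 0%N \o arc_ext gamma) mG mg aeg iG0 aed.
rewrite curve_integralE -(cvg_lim _ lim)//; apply: lime_ge; first by apply/cvg_ex; eexists; exact: lim.
by apply: nearW => n /=; rewrite -curve_integralE.
Qed.

(** By the lattice property a minimizing sequence may be taken decreasing, and its infimum [gi]
    attains the least [p]-integral. For a competitor [w], the minimum of [gi] and [w] cannot have a
    smaller one, whence [gi <= w] almost everywhere. *)
Lemma minimal_weak_gradient_exists u g0 : borel_weak_gradient mu p u g0 ->
  exists2 g, borel_weak_gradient mu p u g & minimal_p_weak_upper_gradient mu p (EFin \o u) g.
Proof.
move=> wg0; pose S := [set p_integral mu p g | g in borel_weak_gradient mu p u].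
have pI0 g : 0 <= p_integral mu p g by apply: integral_ge0 => x _; exact: poweR_ge0.
have SI : ereal_inf S \is a fin_num.
  rewrite ge0_fin_numE; last by apply: le_ereal_inf_tmp => _ [g _ <-].
  have [_ ig0 _] := wg0; apply: le_lt_trans ig0; apply: ereal_inf_lbound.
  by exists g0.
have /choice [g gP] : forall n, exists g, borel_weak_gradient mu p u g /\
    p_integral mu p g < ereal_inf S + (2^-1 ^+ n)%:E.
  move=> n; have [_ [g wg <-] gI] := lb_ereal_inf_adherent (half_pow_gt0 n) SI.
  by exists g.
pose G := fix G n := if n is m.+1 then (fun x => mine (G m x) (g m.+1 x)) else g 0%N.
have wG n : borel_weak_gradient mu p u (G n).
  elim: n => [|n IH] /=; first by have [] := gP 0%N.
  by apply: borel_weak_gradient_mine => //; have [] := gP n.+1.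
have Gg n x : G n x <= g n x by case: n => [|n] //=; rewrite ge_min lexx orbT.
have wi := borel_weak_gradient_inf wG (fun n x => (ltac:(by rewrite /= ge_min lexx) : G n.+1 x <= G n x)).
set gi := fun x => _ in wi.
have giS : p_integral mu p gi <= ereal_inf S.
  apply/lee_addgt0Pr => e e0; have [N /(_ N (leqnn N)) NP] := half_pow_small ler01 e0.
  have [_ gN] := gP N; apply: le_trans (le_trans (ltW gN) _); last first.
    by rewrite leeD2l// lee_fin -[leLHS]mul1r ltW.
  have [[_ gi0] _ _] := wi; apply: p_integral_le => // x.
  by apply: le_trans (Gg N x); apply: ereal_inf_lbound; exists N.
exists gi => //; have [bgi igi _] := wi; split=> //; first exact: borel_weak_gradientP.
move=> h /(weak_gradient_borel p_gt0) H /H [w ww wh].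
have wm := borel_weak_gradient_mine p_gt0 wi ww.
have [bm im _] := wm; have [bw _ _] := ww.
have : {ae mu, forall x, gi x `^ p <= (mine (gi x) (w x)) `^ p}.
  apply: integral_le_ae_ge.
  - exact: (borel_poweR p bm).
  - exact: (borel_poweR p bgi).
  - by move=> x; exact: poweR_ge0.
  - by move=> x; apply: poweR_le => //; [exact: bm.2|rewrite ge_min lexx].
  - by rewrite -p_integralE//; exact: bgi.2.
  - rewrite -!p_integralE; [|exact: bm.2|exact: bgi.2].
    by apply: le_trans giS _; apply: ereal_inf_lbound; exists (fun x => mine (gi x) (w x)).
move=> ae; apply: (negligibleS _ (negligibleU ae wh)) => x /= nx.
apply: contrapT => /not_orP [/contrapT /(poweR_le_inv p_gt0 (bgi.2 x) (bm.2 x)) gm /contrapT wx].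
by apply: nx; move: gm; rewrite le_min => /andP[_ /le_trans]; apply.
Qed.

End minimal_weak_upper_gradient.

(** * Poincare's inequality and chains *)

Section indicator_gradients.
Context {R : realType} {X : pmetricType R}.
Variables (mu : {measure set (borel X) -> \bar R}) (p : R).
Hypothesis p_gt0 : (0 < p)%R.
Local Notation leb := (@lebesgue_measure R).
Local Open Scope ereal_scope.
Implicit Types (gamma : arcCurve X) (K : set X) (u : X -> R).

Lemma open_borel (U : set X) : open U -> measurable (U : set (borel X)).
Proof. exact: sub_sigma_algebra. Qed.

Lemma closed_borel K : closed K -> measurable (K : set (borel X)).
Proof.
by move=> cK; rewrite -[K]setCK; apply: measurableC; apply: open_borel; exact: closed_openC.
Qed.

Definition scaled_indic (L : R) K (x : X) : \bar R := (L * \1_K x)%:E.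

Lemma scaled_indic_borel (L : R) K : (0 <= L)%R -> measurable (K : set (borel X)) ->
  nonneg_borel (scaled_indic L K).
Proof.
move=> L0 mK; split=> [|x]; last by rewrite lee_fin mulr_ge0.
apply/measurable_EFinP; apply: measurable_funM; first exact: measurable_cst.
exact: (@measurable_indic _ (borel X) R setT K).
Qed.

Lemma p_integral_scaled_indic (L : R) K : (0 <= L)%R -> measurable (K : set (borel X)) ->
  p_integral mu p (scaled_indic L K) = (L `^ p)%:E * mu K.
Proof.
move=> L0 mK; have [_ g0] := scaled_indic_borel L0 mK.
rewrite p_integralE//.
transitivity (\int[mu]_x ((L `^ p)%:E * (\1_K x)%:E)).
  apply: eq_integral => x _; rewrite /scaled_indic poweR_EFin -EFinM.
  rewrite powRM//; congr (_ * _)%:E; rewrite indicE; case: (x \in K).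
    by rewrite powR1.
  by rewrite powR0 ?gt_eqF.
have mi : measurable_fun setT (fun x : borel X => (\1_K x)%:E : \bar R).
  by apply/measurable_EFinP; exact: measurable_indic.
by rewrite ge0_integralZl ?lee_fin ?powR_ge0 ?integral_indic ?setIT// => x _; rewrite lee_fin.
Qed.

(** A short piece of a curve either runs inside [K], where the Lipschitz constant bounds the
    variation, or contains a point off [K], around which [u] is constant at the scale [d]. *)
Lemma lipschitz_upper_gradient u (L d : R) K : (0 <= L)%R -> (0 < d)%R -> closed K ->
  (forall x y, `|u x - u y| <= L * mdist x y)%R ->
  (forall x, ~ K x -> forall y, (mdist x y < d)%R -> u y = u x) ->
  forall gamma, `|u (gamma 0%R) - u (gamma (arc_len gamma))|%:E <=
    curve_integral gamma (scaled_indic L K).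
Proof.
move=> L0 d0 cK uL uK gamma; have bg := scaled_indic_borel L0 (closed_borel cK).
rewrite curve_integralE -(arc_ext0 gamma) -(arc_ext_len gamma).
have mg := arc_ext_measurable gamma bg.
apply: (@local_to_global_bound _ (u \o arc_ext gamma) (scaled_indic L K \o arc_ext gamma) _ (d / 2)).
- exact: arc_len_ge0.
- by rewrite divr_gt0.
- exact: mg.
- by move=> t; exact: bg.2.
move=> s t s0 st tl std /=.
have [allK|] := pselect (forall v, v \in `[s, t] -> K (arc_ext gamma v)).
  apply: (@le_trans _ _ (L * (t - s))%:E).
    rewrite lee_fin; apply: le_trans (uL _ _) _; apply: ler_wpM2l => //.
    by apply: le_trans (arc_ext_dist _ _ _) _; rewrite distrC ger0_norm// subr_ge0.
  have -> : \int[leb]_(x in `[s, t]) scaled_indic L K (arc_ext gamma x) =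
      \int[leb]_(x in `[s, t]) (cst L%:E x).
    apply: eq_integral => v; rewrite inE => vst.
    by rewrite /scaled_indic indicE mem_set ?mulr1//; exact: allK.
  rewrite integral_cst//= lebesgue_measure_itv/= lte_fin.
  move: st; rewrite le_eqVlt => /orP[/eqP ->|->]; first by rewrite subrr mulr0 ltxx mule0.
  by rewrite -EFinB -EFinM.
move=> /existsNP [v /not_implyP [vst nK]].
have near w : w \in `[s, t] -> u (arc_ext gamma w) = u (arc_ext gamma v).
  move=> wst; apply: uK => //; apply: le_lt_trans (arc_ext_dist _ _ _) _.
  apply: (@le_lt_trans _ _ (d / 2)%R); last by lra.
  move: wst vst; rewrite !in_itv/= => /andP[? ?] /andP[? ?].
  by rewrite ler_norml; apply/andP; split; lra.
rewrite near ?in_itv/= ?lexx//; rewrite [u (arc_ext gamma t)]near ?in_itv/= ?lexx ?andbT//.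
by rewrite subrr normr0; apply: integral_ge0 => w _; exact: bg.2.
Qed.

Lemma lipschitz_borel u (L : R) : (0 <= L)%R ->
  (forall x y, `|u x - u y| <= L * mdist x y)%R -> measurable_fun setT (u : borel X -> R).
Proof.
move=> L0 uL; apply: (measurability _ (RGenOpens.measurableE R)) => //.
move=> _ [_ [a [b ->] <-]]; rewrite setTI; apply: open_borel.
apply/open_mdistP => x /=; rewrite in_itv/= => /andP[ax xb].
pose e := (Num.min (u x - a) (b - u x))%R.
have e0 : (0 < e)%R by rewrite lt_min !subr_gt0 ax.
exists (e / (L + 1))%R; first by rewrite divr_gt0// ltr_wpDl.
move=> y xy; rewrite in_itv/=.
have : (`|u x - u y| < e)%R.
  apply: le_lt_trans (uL x y) _; move: xy; rewrite ltr_pdivlMr; last by rewrite ltr_wpDl.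
  have := mdist_ge0 x y; nra.
by rewrite /e lt_min !ltr_norml => /andP[/andP[? ?] /andP[? ?]]; apply/andP; split; lra.
Qed.

Hypothesis mu_ball : forall (x : X) (r : R), (0 < r)%R ->
  (0 < mu (ball x r)) /\ (mu (ball x r) < +oo).

(* If [y] were not reached by [e]-chains, the cut-off indicator of the set of
   points reached from [x] would take the values 1 and 0 near [x] and [y] while
   having zero upper gradient on the ball where Poincare's inequality tests it. *)
Lemma poincare_chainable : poincare mu p -> exists2 kappa : R, (0 < kappa)%R & chainable X kappa.
Proof.
move=> [C [lam [C0 lam1 PI]]]; exists (4 * lam)%R; first by lra.
move=> x y r e e0 xy; have r0 : (0 < r)%R by apply: le_lt_trans xy; exact: mdist_ge0.
(* The ball on the right-hand side of Poincare's inequality has radius [lam * r = Rb / 4]. *)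
pose Rb := (4 * lam * r)%R.
have Rr : (4 * r <= Rb)%R by rewrite /Rb -mulrA ler_pM2l// ler_peMl// ltW.
have Rb0 : (0 < Rb)%R by lra.
pose A := [set z | exists s : seq X, [/\ path (fun a b => mdist a b < e)%R x s, last x s = z
    & forall z, z \in s -> (mdist x z < Rb)%R]].
suff : A y by [].
apply: contrapT => nAy.
have Ax : A x by exists [::].
have Ball z : A z -> (mdist x z < Rb)%R.
  move=> [s [_ <- sR]]; case: s sR => [_|a s sR] /=; first by rewrite mdistxx.
  by apply: sR; exact: mem_last.
have Anear z w : A z -> (mdist z w < e)%R -> (mdist x w < Rb)%R -> A w.
  move=> [s [s1 s2 s3]] zw xw; exists (rcons s w); split.
  - by rewrite rcons_path s1 s2.
  - by rewrite last_rcons.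
  - by move=> v; rewrite mem_rcons inE => /orP[/eqP ->|/s3].
(* Equal to 1 up to the radius [Rb / 2] and to 0 from [3 / 4 * Rb] on, well before the radius [Rb]
   at which chains are stopped. *)
pose eta z := clamp01 (3 - 4 / Rb * mdist x z).
have Rb4 : (0 < 4 / Rb)%R by rewrite divr_gt0.
have RbK : (4 / Rb * Rb = 4)%R by rewrite divfK// gt_eqF.
have eta1 z : (mdist x z <= Rb / 2)%R -> eta z = 1%R.
  move=> xz; rewrite /eta; case: (clamp01P (3 - 4 / Rb * mdist x z)) => [[h _]|[h1 h2 ->]|[_ ->]]//.
    by have : (4 / Rb * mdist x z <= 4 / Rb * (Rb / 2))%R by [rewrite ler_pM2l|lra]; lra.
  by have : (4 / Rb * mdist x z <= 4 / Rb * (Rb / 2))%R by [rewrite ler_pM2l|lra]; lra.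
have eta0 z : (3 / 4 * Rb <= mdist x z)%R -> eta z = 0%R.
  move=> xz; have : (4 / Rb * (3 / 4 * Rb) <= 4 / Rb * mdist x z)%R by rewrite ler_pM2l.
  by rewrite /eta; case: (clamp01P (3 - 4 / Rb * mdist x z)) => [[h ->]|[h1 h2 ->]|[h1 ->]]//; lra.
have eta01 z : (0 <= eta z <= 1)%R.
  by rewrite /eta; case: (clamp01P (3 - 4 / Rb * mdist x z)) => [[h ->]|[h1 h2 ->]|[h1 ->]];
    apply/andP; split; lra.
have etaL z w : (`|eta z - eta w| <= 4 / Rb * mdist z w)%R.
  apply: le_trans (clamp01_dist _ _) _.
  have -> : (3 - 4 / Rb * mdist x z - (3 - 4 / Rb * mdist x w) = 4 / Rb * (mdist x w - mdist x z))%R by ring.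
  rewrite normrM gtr0_norm// ler_pM2l// ler_norml.
  have := metric_triangle x z w; have := metric_triangle x w z; rewrite (metric_sym w z).
  by move=> ? ?; apply/andP; split; lra.
pose u z := if z \in A then eta z else 0%R.
have uA z : A z -> u z = eta z by move=> Az; rewrite /u mem_set.
have unA z : ~ A z -> u z = 0%R by move=> nA; rewrite /u ifN//; apply/negP; rewrite inE.
have u01 z : (0 <= u z <= 1)%R by rewrite /u; case: ifP; rewrite // lexx ler01.
(* A point of [A] has a point off [A] closer than [e] only if the latter lies beyond [Rb], where
   [eta] is 0 and its slope [4 / Rb] suffices; at distance at least [e] the slope [e^-1] does. *)
pose L := (4 / Rb + e^-1)%R.
have ei0 : (0 < e^-1)%R by rewrite invr_gt0.
have L0 : (0 <= L)%R by rewrite /L; lra.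
have uLAn z w : A z -> ~ A w -> (`|u z - u w| <= L * mdist z w)%R.
  move=> Az nAw; rewrite (unA w)// subr0 uA//.
  have zw0 := mdist_ge0 z w.
  have [zw|zw] := leP e (mdist z w).
    have /andP[u0 u1] := eta01 z; rewrite ger0_norm//; apply: le_trans u1 _.
    have : (1 <= e^-1 * mdist z w)%R by rewrite mulrC ler_pdivlMr ?mul1r.
    rewrite /L mulrDl; have := mulr_ge0 (ltW Rb4) zw0; lra.
  have xw : (Rb <= mdist x w)%R.
    by rewrite leNgt; apply/negP => xw; apply: nAw; exact: Anear Az zw xw.
  have := etaL z w; rewrite (eta0 w); last by lra.
  rewrite subr0 /L mulrDl; have := mulr_ge0 (ltW ei0) zw0; lra.
have uL z w : (`|u z - u w| <= L * mdist z w)%R.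
  have [Az|nAz] := pselect (A z); have [Aw|nAw] := pselect (A w).
  - rewrite !uA//; apply: le_trans (etaL z w) _.
    by have := mulr_ge0 (ltW ei0) (mdist_ge0 z w); rewrite /L mulrDl; lra.
  - exact: uLAn.
  - by rewrite distrC metric_sym; exact: uLAn.
  - by rewrite !unA// subrr normr0 mulr_ge0// mdist_ge0.
(* Inside [K] is not controlled; nearer to [x] the set [A] cannot change within [e] and [eta] is 1,
   farther away [eta] is 0. *)
pose K := [set z | Rb / 4 <= mdist x z <= Rb]%R.
have cK : closed K.
  rewrite -[K]setCK; apply: open_closedC; apply/open_mdistP => z nKz.
  have [h|h] := ltP (mdist x z) (Rb / 4)%R.
    exists (Rb / 4 - mdist x z)%R; first by rewrite subr_gt0.
    move=> w zw /andP[h1 h2]; have := metric_triangle x z w; lra.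
  have h2 : (Rb < mdist x z)%R by rewrite ltNge; apply/negP => h2; apply: nKz; rewrite /K /= h.
  exists (mdist x z - Rb)%R; first by rewrite subr_gt0.
  move=> w zw /andP[h3 h4]; have := metric_triangle x w z; rewrite (metric_sym w z); lra.
pose d := (Num.min e (Rb / 4))%R.
have d0 : (0 < d)%R by rewrite lt_min e0; lra.
have uK z : ~ K z -> forall w, (mdist z w < d)%R -> u w = u z.
  move=> nKz w; rewrite lt_min => /andP[zwe zwR].
  have [h|h] := ltP (mdist x z) (Rb / 4)%R.
    have xw : (mdist x w < Rb / 2)%R by have := metric_triangle x z w; lra.
    have [Az|nAz] := pselect (A z).
      have Aw : A w by apply: Anear Az zwe _; lra.
      by rewrite !uA// !eta1//; lra.
    rewrite !unA// => Aw; apply: nAz; apply: Anear Aw _ _; last by lra.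
    by rewrite metric_sym.
  have h2 : (Rb < mdist x z)%R by rewrite ltNge; apply/negP => h2; apply: nKz; rewrite /K /= h.
  have far v : (3 / 4 * Rb <= mdist x v)%R -> u v = 0%R.
    by move=> xv; have [Av|nAv] := pselect (A v); [rewrite uA// eta0|rewrite unA].
  have xw : (3 / 4 * Rb <= mdist x w)%R.
    have := metric_triangle x w z; rewrite (metric_sym w z); lra.
  by rewrite (far w)// (far z)//; lra.
pose g0 := scaled_indic L K.
have mK := closed_borel cK.
have bg0 : nonneg_borel g0 by exact: scaled_indic_borel.
have muB : mu (ball x (2 * Rb)%R) < +oo by apply: (mu_ball _ _).2; lra.
have ig0 : p_integral mu p g0 < +oo.
  rewrite p_integral_scaled_indic//; apply: lte_mul_pinfty.
  - by rewrite lee_fin powR_ge0.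
  - by [].
  apply: le_lt_trans muB; apply: le_measure; rewrite ?inE//.
    exact: (open_borel (@open_mball _ _ _ _)).
  by move=> z /andP[_ zR]; apply/ballP; lra.
have ug := lipschitz_upper_gradient L0 d0 cK uL uK.
have wg : borel_weak_gradient mu p u g0 by split=> //; exists g0; split.
have mu_ : measurable_fun setT (u : borel X -> R) by exact: (lipschitz_borel L0).
have [g [[mg g_ge0] ig _] ming] := minimal_weak_gradient_exists p_gt0 wg.
have newt : newtonian mu p (EFin \o u).
  split.
    by exists (EFin \o u); split; [exact/measurable_EFinP|exact: aeW].
  apply: lte_add_pinfty.
    apply: le_lt_trans (_ : p_integral mu p (scaled_indic 1 (ball x (2 * Rb)%R)) < _).
      have u0 z : 0 <= (EFin \o u) z by rewrite lee_fin; have /andP[] := u01 z.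
      rewrite !p_integralE//; last exact: (scaled_indic_borel ler01 (open_borel (@open_mball _ _ _ _))).2.
      apply: ge0_le_integral_nonmeasurable => z _; first exact: poweR_ge0.
      apply: poweR_le => //; rewrite /scaled_indic mul1r /= lee_fin indicE.
      have /andP[z0 z1] := u01 z.
      have [xz|xz] := pselect (ball x (2 * Rb)%R z); first by rewrite mem_set.
      rewrite unA; first by case: (_ \in _).
      by move=> /Ball zR; apply: xz; apply/ballP; lra.
    rewrite p_integral_scaled_indic//; last exact: (open_borel (@open_mball _ _ _ _)).
    by apply: lte_mul_pinfty => //; rewrite lee_fin powR_ge0.
  apply: le_lt_trans ig0; apply: ereal_inf_lbound; exists g0 => //; split=> // gamma.
  by split=> [_ _|[]]; [exact: ug|split].
have := PI x r (EFin \o u) g r0 newt ming.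
have [_ _ gmin] := ming.
have gg0 := gmin g0 (borel_weak_gradientP wg) ig0.
have mB z s : measurable (ball z s : set (borel X)) by exact: (open_borel (@open_mball _ _ _ _)).
(* The minimal gradient is almost everywhere below [g0], which vanishes on the ball of radius
   [Rb / 4]. *)
have -> : ball_average mu x (lam * r)%R (fun y => g y `^ p) = 0.
  rewrite /ball_average (_ : \int[mu]_(z in _) _ = 0) ?mule0//.
  rewrite -(@integral0 _ _ _ mu (ball x (lam * r)%R)).
  apply: ge0_ae_eq_integral => //.
  - by apply: measurable_funTS; exact: (borel_poweR p (conj mg g_ge0)).
  - by move=> z _; exact: poweR_ge0.
  - apply: negligibleS gg0 => z /= nz gz; apply: nz => /ballP xz.
    have nKz : z \notin K.
      apply/negP; rewrite inE => /andP[h _]; move: xz h; rewrite /Rb; lra.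
    move: gz; rewrite /g0 /scaled_indic indicE (negbTE nKz) mulr0 => gz.
    have -> : g z = 0 by apply/eqP; rewrite eq_le gz g_ge0.
    by rewrite poweR0r// gt_eqF.
rewrite poweR0r ?mule0; last by rewrite invr_eq0 gt_eqF.
set a := ball_average mu x r (EFin \o u).
have mBx := mB x r; have [muB0 muBoo] := mu_ball x r0.
have mua : measurable_fun (ball x r : set (borel X)) (fun z => (EFin \o u) z - a).
  apply: measurable_funTS; apply: emeasurable_funB; last exact: measurable_cst.
  exact/measurable_EFinP.
rewrite {1}/ball_average => le0.
have : \int[mu]_(z in ball x r) `|(EFin \o u) z - a| = 0.
  apply/eqP; rewrite eq_le; apply/andP; split; last by apply: integral_ge0.
  rewrite -(@pmule_rle0 _ ((fine (mu (ball x r)))^-1)%:E)//.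
  by rewrite lte_fin invr_gt0 fine_gt0// muB0.
move=> /(ae_eq_integral_abs mu mBx mua) ae0.
(* A ball has positive measure, so a value that [u] takes on a whole small ball is its average [a];
   this applies to 1 near [x] and to 0 near [y]. *)
have val (z : X) (s c : R) : (0 < s)%R -> (mdist x z + s <= r)%R ->
    (forall w, (mdist z w < s)%R -> u w = c) -> c%:E - a = 0.
  move=> s0 zr uc; apply: contrapT => ca; have [+ _] := mu_ball z s0.
  suff -> : mu (ball z s) = 0 by rewrite ltxx.
  apply/(negligibleP _ (mB z s)); apply: negligibleS ae0 => w /ballP zw /= H; apply: ca.
  by rewrite -(uc w zw); apply: H; apply/ballP; have := metric_triangle x z w; lra.
have a1 : 1%:E - a = 0.
  apply: (val x (Num.min d r)); first by rewrite lt_min d0.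
    by rewrite mdistxx add0r ge_min lexx orbT.
  move=> w; rewrite !lt_min -andbA => /and3P[we wR wr].
  rewrite uA; first by apply: eta1; lra.
  by apply: Anear Ax we _; lra.
have a0 : 0%:E - a = 0.
  apply: (val y (Num.min e (r - mdist x y))%R); first by rewrite lt_min e0 subr_gt0.
    by rewrite -lerBrDl ge_min lexx orbT.
  move=> w; rewrite lt_min => /andP[we _]; apply: unA => Aw; apply: nAy.
  by apply: Anear Aw _ _; [rewrite metric_sym|lra].
move: a1 a0; case: (a) => [b||] //.
by rewrite -!EFinB => -[b1] [b0]; lra.
Qed.

End indicator_gradients.

(** * Doubling and the modulus of points *)

Section doubling_bounded.
Context {R : realType} {X : pmetricType R}.
Variable mu : {measure set (borel X) -> \bar R}.
Hypothesis mu_ball : forall (x : X) (r : R), 0 < r ->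
  ((0 < mu (ball x r)) /\ (mu (ball x r) < +oo))%E.

Let mB (z : X) s : measurable (ball z s : set (borel X)).
Proof. exact: (open_borel (@open_mball _ _ _ _)). Qed.

Let muE (z : X) (r : R) : 0 < r -> mu (ball z r) = (fine (mu (ball z r)))%:E.
Proof. by move=> r0; have [_ h] := mu_ball z r0; rewrite fineK// ge0_fin_numE. Qed.

Let mu_le (z w : X) (r s : R) : ball z r `<=` ball w s -> (mu (ball z r) <= mu (ball w s))%E.
Proof. by move=> zw; apply: le_measure; rewrite ?inE//; exact: mB. Qed.

Lemma doubling_iter (C : R) : 0 < C ->
  (forall (x : X) (r : R), (0 < r)%R -> (mu (ball x (2 * r)%R) <= C%:E * mu (ball x r))%E) ->
  forall k (x : X) (r : R), 0 < r -> (mu (ball x (2 ^+ k * r)) <= (C ^+ k)%:E * mu (ball x r))%E.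
Proof.
move=> C0 dbl; elim=> [|k IH] x r r0; first by rewrite !expr0 mul1r mul1e.
rewrite exprS -mulrA; apply: le_trans (dbl _ _ _) _; first by rewrite mulr_gt0// exprn_gt0.
by rewrite exprS EFinM -muleA lee_pmul2l ?lte_fin// IH.
Qed.

(** Without a finite [e]-net there are arbitrarily long [e]-separated lists in the ball. The balls
    of radius [e / 2] around their points are disjoint, lie in a fixed ball of finite measure, and
    by doubling have measures bounded below by [c]. *)
Lemma doubling_tot_bounded : doubling mu -> forall (x : X) (r : R), tot_bounded (ball x r).
Proof.
move=> [C C0 dbl] x r e e0; apply: contrapT => nc.
have [r0|r0] := ltP 0 r; last first.
  by apply: nc; exists [::] => y /ballP xy; have := mdist_ge0 x y; rewrite leNgt (lt_le_trans xy).
have e20 : 0 < e / 2 by rewrite divr_gt0.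
have sep n : exists s : seq X, [/\ size s = n, forall z, z \in s -> ball x r z
    & pairwise (fun a b => e <= mdist a b) s].
  elim: n => [|n [s [s1 s2 s3]]]; first by exists [::].
  have [y [xy ys]] : exists y, ball x r y /\ forall c, c \in s -> e <= mdist c y.
    apply: contrapT => ny; apply: nc; exists s => y xy.
    apply: contrapT => /forall2NP nys; apply: ny; exists y; split=> // c cs.
    by case: (nys c) => [//|/negP]; rewrite -leNgt.
  exists (y :: s); split=> /=; first by rewrite s1.
    by move=> z; rewrite inE => /orP[/eqP ->|/s2].
  by rewrite s3 andbT; apply/allP => c /ys; rewrite metric_sym.
have [k kr] : exists k, 2 * r <= 2 ^+ k * (e / 2).
  have [N /(_ N (leqnn N))] := half_pow_small (mulr_ge0 (ler0n R 2) (ltW r0)) e20.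
  by rewrite exprVn ltr_pdivrMr ?exprn_gt0// => /ltW; rewrite [leRHS]mulrC => h; exists N.
pose c := fine (mu (ball x r)) / C ^+ k.
have Ck : 0 < C ^+ k by rewrite exprn_gt0.
have mur : 0 < fine (mu (ball x r)) by have [h1 h2] := mu_ball x r0; rewrite fine_gt0// h1.
have c0 : 0 < c by rewrite divr_gt0.
have cz z : ball x r z -> (c%:E <= mu (ball z (e / 2)))%E.
  move=> /ballP xz; have : (mu (ball x r) <= (C ^+ k)%:E * mu (ball z (e / 2)))%E.
    apply: le_trans (doubling_iter C0 dbl k z e20); apply: mu_le => w /ballP xw.
    by apply/ballP; have := metric_triangle z x w; rewrite (metric_sym z x); lra.
  rewrite (muE _ r0) (muE _ e20) -EFinM !lee_fin => h.
  by rewrite /c ler_pdivrMr// mulrC.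
pose U (s : seq X) : set X := foldr (fun z V => ball z (e / 2) `|` V) set0 s.
have UP (s : seq X) (y : X) : U s y <-> exists2 z, z \in s & ball z (e / 2) y.
  elim: s => [|z s IH] /=; first by split=> // -[].
  split=> [[zy|/IH [w ws wy]]|[w]]; first by exists z; rewrite ?mem_head.
    by exists w; rewrite // inE ws orbT.
  by rewrite inE => /orP[/eqP ->|ws wy]; [left|right; apply/IH; exists w].
have mU (s : seq X) : measurable (U s : set (borel X)).
  by elim: s => [|z s IH] /=; [exact: measurable0|apply: measurableU].
have Uc (s : seq X) : (forall z, z \in s -> ball x r z) -> pairwise (fun a b => e <= mdist a b) s ->
    ((c * (size s)%:R)%:E <= mu (U s))%E.
  elim: s => [|z s IH] /= sB; first by rewrite mulr0 measure0.
  move=> /andP[/allP zs ps]; rewrite measureU//; last first.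
    rewrite -subset0 => w [/ballP zw /UP [v vs /ballP vw]].
    by have := zs v vs; have := metric_triangle z w v; rewrite (metric_sym w); lra.
  rewrite -natr1 mulrDr mulr1 addrC EFinD; apply: leeD.
    by apply: cz; apply: sB; rewrite mem_head.
  by apply: IH => // w ws; apply: sB; rewrite inE ws orbT.
have re0 : 0 < r + e by rewrite addr_gt0.
have [s [sn sB sp]] := sep (Num.truncn (fine (mu (ball x (r + e))) / c)).+1.
have := Uc s sB sp; apply/negP; rewrite -ltNge.
apply: (@le_lt_trans _ _ (mu (ball x (r + e)))).
  apply: le_measure; rewrite ?inE; [exact: mU|exact: mB|].
  move=> y /UP [z zs /ballP zy]; apply/ballP.
  by have /ballP := sB z zs; have := metric_triangle x z y; lra.
by rewrite (muE _ re0) lte_fin mulrC -ltr_pdivrMr// sn truncnS_gt.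
Qed.

End doubling_bounded.

Section modulus_of_points.
Context {R : realType} {X : pmetricType R}.
Variables (mu : {measure set (borel X) -> \bar R}) (p : R).
Hypothesis p_ge1 : 1 <= p.
Hypothesis mu_ball : forall (x : X) (r : R), 0 < r ->
  ((0 < mu (ball x r)) /\ (mu (ball x r) < +oo))%E.
Implicit Types (gamma : arcCurve X) (E F U : set X).
Local Open Scope ereal_scope.

Let p_gt0 : (0 < p)%R. Proof. exact: lt_le_trans p_ge1. Qed.

Lemma modulus_le E F U rho : nonneg_borel rho ->
  (forall gamma, E (gamma 0%R) -> F (gamma (arc_len gamma)) -> 1 <= curve_integral gamma rho) ->
  modulus mu p E F U <= p_integral mu p rho.
Proof.
move=> br H; apply: ereal_inf_lbound; exists rho => //; split=> // gamma [_ Eg Fg].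
exact: H.
Qed.

Lemma modulus_ge0 E F U : 0 <= modulus mu p E F U.
Proof.
by apply: le_ereal_inf_tmp => _ [rho _ <-]; apply: integral_ge0 => x _; exact: poweR_ge0.
Qed.

Definition annulus (x : X) (a : R) : set X := [set z | a <= mdist x z <= 4 * a]%R.

Lemma annulus_closed x a : closed (annulus x a).
Proof.
have -> : annulus x a = (mdist x : X -> R) @^-1` `[a, (4 * a)%R].
  by apply/seteqP; split=> z /=; rewrite in_itv.
by apply: preimage_closed => [z _|]; [exact: mdist_continuous|exact: itv_closed].
Qed.

(* The cut-off [min (max (d(x, .)) 2a) 3a] has upper gradient [1] on the
   annulus and varies by [a] along a curve crossing it. *)
Lemma annulus_crossing x (a : R) gamma : (0 < a)%R ->
  (mdist x (gamma 0%R) <= a)%R -> (4 * a <= mdist x (gamma (arc_len gamma)))%R ->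
  1 <= curve_integral gamma (scaled_indic a^-1 (annulus x a)).
Proof.
move=> a0 ga ga4; pose u z : R := (Num.max 0 (Num.min a (mdist x z - 2 * a)) / a)%R.
have ai0 : (0 < a^-1)%R by rewrite invr_gt0.
have uL z w : (`|u z - u w| <= a^-1 * mdist z w)%R.
  rewrite /u -mulrBl normrM (gtr0_norm ai0) mulrC ler_pM2l//.
  apply: le_trans (clamp_dist _ _ (ltW a0)) _.
  have -> : (mdist x z - 2 * a - (mdist x w - 2 * a) = mdist x z - mdist x w)%R by ring.
  rewrite ler_norml; have := metric_triangle x z w; have := metric_triangle x w z.
  by rewrite (metric_sym w z); move=> ? ?; apply/andP; split; lra.
have u0 z : (mdist x z <= 2 * a)%R -> u z = 0%R.
  move=> h; rewrite /u.
  case: (clampP (mdist x z - 2 * a)%R (ltW a0)) => [[h1 ->]|[h1 h2 ->]|[h1 _]]; last by lra.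
    by rewrite mul0r.
  by have -> : (mdist x z - 2 * a = 0)%R by [lra]; rewrite mul0r.
have u1 z : (3 * a <= mdist x z)%R -> u z = 1%R.
  move=> h; rewrite /u.
  case: (clampP (mdist x z - 2 * a)%R (ltW a0)) => [[h1 ->]|[h1 h2 ->]|[h1 ->]]; first lra.
    by have -> : (mdist x z - 2 * a = a)%R by [lra]; rewrite divff// gt_eqF.
  by rewrite divff// gt_eqF.
have uK z : ~ annulus x a z -> forall w, (mdist z w < a)%R -> u w = u z.
  move=> nz w zw; have := metric_triangle x z w; have := metric_triangle x w z.
  rewrite (metric_sym w z) => h1 h2.
  have [h|h] := ltP (mdist x z) a; first by rewrite !u0//; lra.
  have h3 : (4 * a < mdist x z)%R by rewrite ltNge; apply/negP => h3; apply: nz; rewrite /annulus /= h.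
  by rewrite !u1//; lra.
have := lipschitz_upper_gradient (ltW ai0) a0 (@annulus_closed x a) uL uK gamma.
rewrite u0; last by lra.
rewrite u1; last by lra.
by rewrite sub0r normrN normr1.
Qed.

(* The annuli [annulus x (S / 8 ^ j.+1)], [j < N], are disjoint, so that the
   [p]-integrals of their contributions add up. *)
Lemma annuli_density x (S c D : R) : (0 < S)%R -> (0 < c)%R -> (0 <= D)%R ->
  (forall j, mu (annulus x (S / 8 ^+ j.+1)) <= (D * (S / 8 ^+ j.+1) `^ p)%:E) ->
  forall N, exists rho, [/\ nonneg_borel rho,
    p_integral mu p rho <= (N%:R * (c `^ p * D))%:E,
    forall z, (mdist x z < S / 8 ^+ N)%R -> rho z = 0
    & forall gamma, (mdist x (gamma 0%R) <= S / 8 ^+ N)%R ->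
        (S <= mdist x (gamma (arc_len gamma)))%R -> (N%:R * c)%:E <= curve_integral gamma rho].
Proof.
move=> S0 c0 D0 muA; have a0 j : (0 < S / 8 ^+ j)%R by rewrite divr_gt0// exprn_gt0.
have aS j : (S / 8 ^+ j = 8 * (S / 8 ^+ j.+1))%R.
  by rewrite exprS; field; rewrite expf_neq0// pnatr_eq0.
have aleS j : (S / 8 ^+ j <= S)%R.
  rewrite ler_pdivrMr ?exprn_gt0// ler_peMr//; first exact: ltW.
  by rewrite exprn_ege1// ler1n.
elim=> [|N [rho [br ir r0 rc]]].
  exists (cst 0); split=> //.
  - rewrite mul0r /p_integral; under eq_integral do rewrite abse0 poweR0r ?gt_eqF//.
    by rewrite integral0.
  - by move=> gamma _ _; rewrite mul0r; apply: integral_ge0.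
pose A := annulus x (S / 8 ^+ N.+1); have mA : measurable (A : set (borel X)) by apply: closed_borel; exact: annulus_closed.
pose sg := scaled_indic (c / (S / 8 ^+ N.+1)) A.
have cA0 : (0 <= c / (S / 8 ^+ N.+1))%R by rewrite divr_ge0 ?ltW.
have bs : nonneg_borel sg by exact: scaled_indic_borel.
have [mr rg0] := br; have [ms sg0] := bs.
have aN := aS N; have aN0 := a0 N.+1.
have brs : nonneg_borel (fun z => rho z + sg z).
  by split=> [|z]; [exact: emeasurable_funD|exact: adde_ge0].
exists (fun z => rho z + sg z); split=> //.
- rewrite p_integralE; last exact: brs.2.
  apply: (@le_trans _ _ (\int[mu]_z (rho z `^ p + sg z `^ p))).
    apply: ge0_le_integral_nonmeasurable => z _; first exact: poweR_ge0.
    (* Within [S / 8 ^ N] only the new annulus contributes; beyond it, only the previous ones. *)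
    have [h|h] := ltP (mdist x z) (S / 8 ^+ N)%R.
      by rewrite r0// add0e poweR0r ?gt_eqF// add0e.
    have -> : sg z = 0.
      rewrite /sg /scaled_indic indicE memNset ?mulr0// => /andP[_ h4].
      by move: h h4; rewrite aN; lra.
    by rewrite adde0 poweR0r ?gt_eqF// adde0.
  rewrite ge0_integralD//; do ?by move=> z _; exact: poweR_ge0.
  + rewrite -!p_integralE// -natr1 mulrDl mul1r EFinD; apply: leeD => //.
    rewrite p_integral_scaled_indic//.
    apply: (@le_trans _ _ (((c / (S / 8 ^+ N.+1)) `^ p)%:E * (D * (S / 8 ^+ N.+1) `^ p)%:E)).
      by apply: lee_wpmul2l; [rewrite lee_fin powR_ge0|exact: muA].
    set a := (S / 8 ^+ N.+1)%R; have a00 : (0 <= a)%R := ltW aN0.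
    rewrite -EFinM lee_fin (powRM _ (ltW c0)) ?invr_ge0// -mulrA ler_pM2l ?powR_gt0//.
    by rewrite mulrCA -powRM ?invr_ge0// mulVf ?gt_eqF// powR1 mulr1.
  + exact: (borel_poweR p br).
  + exact: (borel_poweR p bs).
- move=> z zN; rewrite r0; last by rewrite aN; have := mdist_ge0 x z; lra.
  rewrite add0e /sg /scaled_indic indicE memNset ?mulr0// => /andP[h _].
  by move: zN; rewrite ltNge h.
move=> gamma g0 gl; rewrite curve_integralE ge0_integralD//; last 2 first.
- by apply: measurable_funTS; exact: (arc_ext_measurable gamma br).
- by apply: measurable_funTS; exact: (arc_ext_measurable gamma bs).
rewrite -natr1 mulrDl mul1r EFinD; apply: leeD.
  by rewrite -curve_integralE; apply: rc => //; rewrite aN; lra.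
have -> : c%:E = c%:E * 1 by rewrite mule1.
have gl' : (4 * (S / 8 ^+ N.+1) <= mdist x (gamma (arc_len gamma)))%R.
  by apply: le_trans gl; have := aleS N; rewrite aN; lra.
apply: (@le_trans _ _ (c%:E * curve_integral gamma (scaled_indic (S / 8 ^+ N.+1)^-1 A))).
  by rewrite lee_pmul2l ?lte_fin//; exact: annulus_crossing.
have bA : nonneg_borel (scaled_indic (S / 8 ^+ N.+1)^-1 A).
  by apply: scaled_indic_borel => //; rewrite invr_ge0 ltW.
rewrite curve_integralE -ge0_integralZl//; last 3 first.
- by apply: measurable_funTS; exact: (arc_ext_measurable gamma bA).
- by move=> t _; exact: bA.2.
- by rewrite lee_fin ltW.
by under eq_integral do rewrite /scaled_indic -EFinM mulrA.
Qed.

(* Averaging [N] annuli gains the factor [N ^ (1 - p)]; for [p = 1] a single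
   small annulus and an exponent [q > p] do. *)
Lemma modulus_point_zero x (C q R0 : R) : (0 < R0)%R -> (0 < C)%R ->
  (p < q \/ (1 < p /\ p <= q))%R ->
  (forall r : R, (0 < r)%R -> (r <= R0)%R -> mu (ball x r) <= (C * r `^ q)%:E) ->
  forall e s : R, (0 < e)%R -> (0 < s)%R -> exists2 r : R, (0 < r)%R &
    forall E F U, E `<=` ball x r -> (forall z, F z -> (s <= mdist x z)%R) ->
      modulus mu p E F U <= e%:E.
Proof.
move=> R00 C0 pq muC e s e0 s0; have pq' : (p <= q)%R by case: pq => [/ltW|[]].
(* An annulus of inner radius [a] lies in the ball of radius [5 * a], so its measure is at most
   [K * a ^ q], and [a ^ q <= S ^ (q - p) * a ^ p]. *)
pose K := (C * 5 `^ q)%R; have K0 : (0 < K)%R by rewrite mulr_gt0// powR_gt0.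
have gen (S : R) N : (0 < S)%R -> (S <= R0)%R -> (S <= s)%R ->
    (N.+1%:R * (N.+1%:R^-1 `^ p * (K * S `^ (q - p))) <= e)%R ->
    exists2 r : R, (0 < r)%R & forall E F U, E `<=` ball x r ->
      (forall z, F z -> (s <= mdist x z)%R) -> modulus mu p E F U <= e%:E.
  move=> S0 SR Ss Ne; have a0 j : (0 < S / 8 ^+ j)%R by rewrite divr_gt0// exprn_gt0.
  have D0 : (0 <= K * S `^ (q - p))%R by rewrite mulr_ge0 ?powR_ge0// ltW.
  have muA j : mu (annulus x (S / 8 ^+ j.+1)) <= (K * S `^ (q - p) * (S / 8 ^+ j.+1) `^ p)%:E.
    set a := (S / 8 ^+ j.+1)%R; have aa : (0 < a)%R := a0 j.+1.
    have a8 : (8 * a <= S)%R.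
      have -> : (8 * a = S / 8 ^+ j)%R by rewrite /a exprS; field; rewrite expf_neq0// pnatr_eq0.
      by rewrite ler_pdivrMr ?exprn_gt0// ler_peMr ?exprn_ege1 ?ler1n// ltW.
    apply: (@le_trans _ _ (mu (ball x (5 * a)))).
      apply: le_measure; rewrite ?inE; [by apply: closed_borel; exact: annulus_closed| |].
        exact: (open_borel (@open_mball _ _ _ _)).
      by move=> z /andP[_ h]; apply/ballP; lra.
    apply: le_trans (muC _ _ _) _; [lra|lra|].
    rewrite lee_fin /K -!mulrA ler_pM2l// (powRM _ (ler0n _ 5) (ltW aa)) ler_pM2l ?powR_gt0//.
    have -> : q = (q - p + p)%R by rewrite subrK.
    rewrite powRD; last by rewrite (gt_eqF aa) implybT.
    rewrite addrK ler_pM2r ?powR_gt0//; apply: ge0_ler_powR; rewrite ?nnegrE ?subr_ge0 ?(ltW aa) ?(ltW S0)//.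
    by lra.
  have c0 : (0 < N.+1%:R^-1 :> R)%R by rewrite invr_gt0.
  have [rho [br ir _ rc]] := annuli_density S0 c0 D0 muA N.+1.
  exists (S / 8 ^+ N.+1)%R => // E F U EB Fs.
  apply: (@le_trans _ _ (p_integral mu p rho)).
    apply: modulus_le => // gamma /EB /ballP g0 /Fs gl.
    have := rc gamma (ltW g0) (le_trans Ss gl).
    by rewrite divff.
  by apply: le_trans ir _; rewrite lee_fin.
case: pq => [pq|[p1 _]].
  have qp : (0 < q - p)%R by rewrite subr_gt0.
  (* One annulus suffices, with [S] so small that [K * S ^ (q - p) <= e]. *)
  pose S0 := ((e / K) `^ (q - p)^-1)%R; have S00 : (0 < S0)%R by rewrite powR_gt0// divr_gt0.
  pose S := Num.min S0 (Num.min R0 s).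
  have S0' : (0 < S)%R by rewrite !lt_min S00 R00.
  apply: (gen S 0%N) => //; rewrite ?ge_min ?lexx ?orbT//.
  rewrite invr1 powR1 !mul1r mulrC -ler_pdivlMr//.
  apply: (@le_trans _ _ (S0 `^ (q - p))%R).
    by apply: ge0_ler_powR; rewrite ?nnegrE ?(ltW qp) ?(ltW S0') ?(ltW S00)// ge_min lexx.
  by rewrite /S0 -powRrM mulVf ?gt_eqF// powRr1// divr_ge0// ltW.
have p10 : (0 < p - 1)%R by rewrite subr_gt0.
pose S := Num.min R0 s; have S0 : (0 < S)%R by rewrite lt_min R00.
pose D := (K * S `^ (q - p))%R; have D0 : (0 < D)%R by rewrite mulr_gt0 ?powR_gt0.
(* Chosen so that [(N + 1) ^ (p - 1) >= D / e]. *)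
pose N := Num.truncn ((D / e) `^ (p - 1)^-1).
apply: (gen S N) => //; rewrite ?ge_min ?lexx ?orbT//.
have N0 : (0 < N.+1%:R :> R)%R by [].
have NP : (D / e <= N.+1%:R `^ (p - 1))%R.
  apply: (@le_trans _ _ (((D / e) `^ (p - 1)^-1) `^ (p - 1))%R).
    by rewrite -powRrM mulVf ?gt_eqF// powRr1// divr_ge0// ltW.
  apply: ge0_ler_powR; rewrite ?nnegrE ?powR_ge0 ?(ltW p10) ?(ltW N0)//.
  exact/ltW/truncnS_gt.
pose y : R := (N.+1%:R^-1)%R; have y0 : (0 < y)%R by rewrite invr_gt0.
have yN : (N.+1%:R * (y `^ p * D) = y `^ (p - 1) * D)%R.
  by rewrite -(mulr_powRB1 (ltW y0) p_gt0) mulrA mulrA divff ?mul1r// gt_eqF.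
have yp : (y `^ (p - 1) * N.+1%:R `^ (p - 1) = 1)%R.
  by rewrite -powRM ?(ltW y0) ?(ltW N0)// mulVf ?powR1// gt_eqF.
rewrite -/y -/D yN -(ler_pM2r (powR_gt0 (p - 1) N0)) mulrAC yp mul1r.
by rewrite mulrC -ler_pdivrMr.
Qed.

End modulus_of_points.

(** * Modulus prime ends *)

Section modulus_prime_ends.
Context {R : realType} {X : pmetricType R}.
Variables (mu : {measure set (borel X) -> \bar R}) (p : R).
Hypothesis p_ge1 : 1 <= p.
Hypothesis mu_ball : forall (x : X) (r : R), 0 < r ->
  ((0 < mu (ball x r)) /\ (mu (ball x r) < +oo))%E.

Let mu_fin (x : X) (r : R) : 0 < r ->
  (mu (ball x r) = (fine (mu (ball x r)))%:E)%E /\ 0 < fine (mu (ball x r)).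
Proof.
move=> r0; have [h1 h2] := mu_ball x r0; split; last by rewrite fine_gt0// h1.
by rewrite fineK// ge0_fin_numE.
Qed.

Lemma pointwise_dims_le (x : X) (q q' : R) : 0 < q' -> q' <= q ->
  pointwise_dims mu x q -> pointwise_dims mu x q'.
Proof.
move=> q'0 qq [q0 [C [R0 [C0 R00 H]]]]; split=> //; exists C, R0; split=> // r s r0 rs sR.
have s0 : 0 < s by apply: lt_le_trans rs.
apply: le_trans (H r s r0 rs sR) _; rewrite ler_pM2l//; apply: ger_powR => //.
by rewrite divr_gt0//= ler_pdivrMr// mul1r.
Qed.

Lemma pointwise_dims_growth (x : X) (q : R) : pointwise_dims mu x q ->
  exists C R0 : R, [/\ 0 < C, 0 < R0 &
    forall r : R, 0 < r -> r <= R0 -> (mu (ball x r) <= (C * r `^ q)%:E)%E].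
Proof.
move=> [q0 [C [R0 [C0 R00 H]]]]; have [mE m0] := mu_fin x R00.
have Rq : 0 < R0 `^ q by rewrite powR_gt0.
exists (C * fine (mu (ball x R0)) / R0 `^ q), R0.
split=> //; first by rewrite divr_gt0// mulr_gt0.
move=> r r0 rR; have [rE _] := mu_fin x r0; rewrite rE lee_fin.
have := H r R0 r0 rR (lexx R0); rewrite ler_pdivrMr//.
have -> : (r / R0) `^ q = r `^ q / R0 `^ q.
  apply: (mulIf (lt0r_neq0 Rq)); rewrite divfK ?lt0r_neq0// -powRM ?divr_ge0 ?(ltW r0) ?(ltW R00)//.
  by rewrite divfK// lt0r_neq0.
move/le_trans; apply; rewrite le_eqVlt; apply/orP; left; apply/eqP; ring.
Qed.

(** For [p > 1] the exponent [q = p] will do. For [p = 1] the dimension set is closed downwards and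
    contains 1, so being different from []0, 1]] it contains some [q > 1]. *)
Lemma dims_modulus_zero (x : X) : pointwise_dims mu x p ->
  pointwise_dims mu x <> `]0, 1]%classic ->
  forall e s : R, 0 < e -> 0 < s -> exists2 r : R, 0 < r &
    forall E F U, E `<=` ball x r -> (forall z, F z -> s <= mdist x z) ->
      (modulus mu p E F U <= e%:E)%E.
Proof.
move=> dp d1; have p0 : 0 < p by apply: lt_le_trans p_ge1.
have [q dq pq] : exists2 q, pointwise_dims mu x q & p < q \/ (1 < p /\ p <= q).
  move: (p_ge1); rewrite le_eqVlt => /orP[/eqP p1|p1]; last by exists p => //; right.
  apply: contrapT => /forall2NP nq; apply: d1; apply/seteqP; split=> q /=; rewrite in_itv/=.
    move=> dq; have [q0 _] := dq; rewrite q0/= leNgt; apply/negP => q1.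
    by case: (nq q) => // -[]; left; rewrite -p1.
  by move=> /andP[q0 q1]; apply: pointwise_dims_le dp => //; rewrite -p1.
have [C [R0 [C0 R00 H]]] := pointwise_dims_growth dq.
exact: modulus_point_zero R00 C0 pq H.
Qed.

Variables (Om : boundedDomain X) (L : R).
Hypotheses (L0 : 0 < L) (lpc : loc_path_connected X L).
Variables (M : metricType R) (inj : set_type Om -> M).
Hypotheses
  (inj_limit : forall m, exists z : X, forall y, mdist (set_val y) z <= mdist (inj y) m)
  (inj_component : forall y y' (z : X) (r : R),
    connected_component (Om `&` ball z r) (set_val y) (set_val y') ->
    mdist (inj y) (inj y') <= 2 * r)
  (inj_lt_component : forall y y' (z : X) (e r : R), mdist (inj y) (inj y') < e ->
    mdist z (set_val y) + e <= r ->
    connected_component (Om `&` ball z r) (set_val y) (set_val y'))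
  (inj_dense : forall m (e : R), 0 < e -> exists y, mdist (inj y) m < e)
  (mz_compact : compact [set: M]).
Hypothesis dims : forall x : X, boundary Om x ->
  pointwise_dims mu x p /\ pointwise_dims mu x <> `]0, 1]%classic.

(** A compact subset of [Om] has a positive distance from the boundary point [x], while the chain
    shrinks to [x]. *)
Lemma mz_mod_chain m : mz_boundary inj_limit m -> mod_chain mu p Om (mz_chain inj_limit m).
Proof.
move=> bm; split; first exact: (mz_chainP L0 lpc).
move=> K cK KO; set x := mz_limit inj_limit m.
have oV : open (~` [set x]).
  apply/open_mdistP => z zx; exists (mdist x z).
    by rewrite mdist_gt0; apply/eqP => xz; apply: zx.
  by move=> y zy yx; move: zy; rewrite yx metric_sym ltxx.
have [s s0 sP] : exists2 s : R, 0 < s & forall z y, K z -> mdist z y < s -> (~` [set x]) y.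
  by apply: compact_open_margin => // z Kz zx; apply: bm; rewrite -/x -zx; exact: KO.
have xb : boundary Om x := mz_limit_boundary inj_dense bm.
have [dp d1] := dims xb.
have far z : K z -> s <= mdist x z.
  by move=> Kz; rewrite leNgt; apply/negP => xz; apply: (sP z x Kz); rewrite 1?metric_sym.
have small e : 0 < e -> exists N, forall k, (N <= k)%N ->
    (modulus mu p (mz_chain inj_limit m k) K Om <= e%:E)%E.
  move=> e0; have [r r0 rP] := dims_modulus_zero dp d1 e0 s0.
  have [N Nr] := mz_radius_small inj_limit m r0; exists N => k Nk; apply: rP => // z mz.
  have {mz} mz := chain_antitone (mz_chainP L0 lpc inj_lt_component inj_dense bm) Nk mz.
  by have [_ /ballP xz] := mz_nbhd_sub mz; apply/ballP; apply: lt_trans Nr.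
have m0 k := modulus_ge0 mu p (mz_chain inj_limit m k) K Om.
apply/fine_cvgP; split.
  have [N NP] := small 1 ltr01; exists N => // k Nk.
  by rewrite ge0_fin_numE//; apply: le_lt_trans (NP k Nk) (ltry _).
apply/cvgrPdist_le => e e0; have [N NP] := small e e0; exists N => // k Nk /=.
rewrite sub0r normrN ger0_norm ?fine_ge0// -lee_fin fineK; first exact: NP.
by rewrite ge0_fin_numE//; apply: le_lt_trans (NP k Nk) (ltry _).
Qed.

(** The class of each [mz_chain] is a modulus end. So every prime end is one, and it stays prime
    among fewer competitors; conversely a modulus prime end is divisible by such a class and hence
    equal to it. *)
Lemma prime_ends_mod : prime_ends Om = mod_prime_ends mu p Om.
Proof.
have mod_end m : mz_boundary inj_limit m ->
    mod_ends mu p Om (chain_class Om (mz_chain inj_limit m)).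
  move=> bm; have cm := mz_chainP L0 lpc inj_lt_component inj_dense bm.
  split; first exact: ends_class.
  by exists (mz_chain inj_limit m); [exact: chain_class_self|exact: mz_mod_chain].
apply/seteqP; split=> e.
  move=> pe; have [_ prime] := pe.
  have [m bm em] := prime_end_mz_chain L0 lpc inj_limit inj_lt_component inj_dense mz_compact pe.
  split; first by rewrite em; exact: mod_end.
  by move=> f [ef _]; exact: prime.
move=> [[[F cF <-] _] prime].
have [m nm] := chain_nearby inj mz_compact cF.
have bm : mz_boundary inj_limit m by exact: chain_near_boundary cF nm.
have cm := mz_chainP L0 lpc inj_lt_component inj_dense bm.
rewrite -(prime _ (mod_end m bm)); first exact: (mz_chain_prime L0 lpc).
apply/end_divides_class => //; exact: (chain_near_divides inj_limit inj_lt_component inj_dense cF nm).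
Qed.

End modulus_prime_ends.

Lemma complete_mcomplete (R : realType) (X : completeMetricType R) : mcomplete X.
Proof.
move=> u /mcauchyP /cauchy_cvg /cvg_ex [x ux]; exists x.
exact: (proj1 (nbhs_mdistP_cvg u x)).
Qed.

Theorem corollary11p7 (R : realType) (X : completeMetricType R)
    (mu : {measure set (borel X) -> \bar R}) (p : R) (Om : boundedDomain X)
    (X_nontrivial : exists x y : X, x <> y)
    (mu_ball : forall (x : X) (r : R), 0 < r ->
       (0 < mu (ball x r))%E /\ (mu (ball x r) < +oo)%E)
    (p_ge1 : 1 <= p)
    (mu_doubling : doubling mu)
    (X_poincare : poincare mu p)
    (Om_almost_john : almost_john_domain Om) :
  (* (a) *)
  (forall e, ends Om e -> exists2 f, prime_ends Om f & end_divides f e) /\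
  (* (b) *)
  (forall e, prime_ends Om e -> exists x : X, end_impression e = [set x]) /\
  (* (c) *)
  (forall x : X, boundary Om x -> accessible Om x /\
     exists2 e, prime_ends Om e & end_impression e = [set x]) /\
  (* (d) *)
  (exists Phi : prime_end_closure Om -> completion (mazurkiewicz Om),
     homeomorphism Phi /\
     forall x : mazurkiewicz Om,
       Phi (prime_closure_inj x) = completion_inj x) /\
  (* (e) *)
  ((forall x : X, boundary Om x ->
      pointwise_dims mu x p /\ pointwise_dims mu x <> `]0, 1]%classic) ->
   prime_ends Om = mod_prime_ends mu p Om) /\
  (* (f) *)
  (metrizable R (prime_end_closure Om) /\
   compact [set: prime_end_closure Om]).
Proof.
have p0 : 0 < p by apply: lt_le_trans p_ge1.
have cX : mcomplete X by exact: complete_mcomplete.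
have [kappa k0 ch] := poincare_chainable p0 mu_ball X_poincare.
pose L := 1 + 2 * kappa; have L0 : 0 < L by rewrite /L; lra.
have lpc : loc_path_connected X L by move=> x y r; exact: (chainable_path k0 ch cX).
have tT := mz_tot_bounded L0 lpc Om_almost_john (doubling_tot_bounded mu_ball mu_doubling).
have cM := completion_compact tT.
pose inj : set_type Om -> completion (mazurkiewicz Om) := @completion_inj R (mazurkiewicz Om).
have i1 m : exists z : X, forall y : set_type Om, mdist (set_val y) z <= mdist (inj y) m.
  exact: completion_impression.
have i2 (y y' : set_type Om) (z : X) (r : R) :
    connected_component (Om `&` ball z r) (set_val y) (set_val y') ->
    mdist (inj y) (inj y') <= 2 * r.
  by move=> yy; rewrite completion_inj_dist; exact: mz_component yy.
have i3 (y y' : set_type Om) (z : X) (e r : R) : mdist (inj y) (inj y') < e ->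
    mdist z (set_val y) + e <= r ->
    connected_component (Om `&` ball z r) (set_val y) (set_val y').
  by rewrite completion_inj_dist => h1 h2; exact: (mz_lt_component h1 h2).
have i4 m (e : R) : 0 < e -> exists y, mdist (inj y) m < e.
  by move=> e0; have [y ym] := completion_dense m e0; exists y.
do ![split].
- by move=> e; exact: (end_divisible_by_prime L0 lpc i1 i2 i3 i4 cM).
- move=> e /(prime_end_mz_chain L0 lpc i1 i3 i4 cM) [m bm ->].
  by exists (mz_limit i1 m); exact: (mz_end_impression L0 lpc i3 i4 bm).
- have [m bm <-] := mz_limit_surj i1 cM H.
  exact: (mz_limit_accessible L0 lpc i3 i4 bm).
- have [m bm <-] := mz_limit_surj i1 cM H.
  exists (chain_class Om (mz_chain i1 m)); first exact: (mz_chain_prime L0 lpc i2 i3 i4 cM bm).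
  exact: (mz_end_impression L0 lpc i3 i4 bm).
- exists (prime_end_mz L0 lpc i1 i2 i3 i4 cM); split; first exact: prime_end_homeomorphism.
  by move=> y; exact: prime_end_mz_inj.
- by move=> dims; exact: (prime_ends_mod p_ge1 mu_ball L0 lpc i1 i2 i3 i4 cM dims).
- exact: (prime_end_metrizable L0 lpc i1 i2 i3 i4 cM).
- exact: (prime_end_compact L0 lpc i1 i2 i3 i4 cM).
Qed.
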